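(* Let $a_{02}>0$ and $a_{11}$ be real constants, and let $f_0:\mathbf{R}^2\to\mathbf{R}^3$ be the degenerate quadratic cross cap $$f_0(u,v)=\tfrac12(0,0,a_{02}v^2)+u\,(1,v,a_{11}v).$$ Let $c(s)$ $(|s|<\pi/2)$ be a $C^\infty$ regular curve in the unit sphere $S^2\subset\mathbf{R}^3$ parametrized by arc length. For $v\in\mathbf{R}$ set $$\xi(v):=\sqrt{1+(1+a_{11}^2)v^2}\;\hat c(v),\qquad \hat c(v):=c\left(\arctan\bigl(v\sqrt{1+a_{11}^2}\bigr)\right),$$ $$B(v):=a_{11}\xi'(v)+\xi(v)\times\xi'(v),\qquad \gamma(v):=\frac{a_{02}}{1+a_{11}^2}\int_0^v tB(t)\,dt,$$ where the prime denotes the derivative with respect to $v$ and $\times$ is the vector product of $\mathbf{R}^3$. Let $f_c:\mathbf{R}^2\to\mathbf{R}^3$ be the ruled surface $f_c(u,v):=\gamma(v)+u\,\xi(v)$. Then: (1) $f_c$ has a cross cap singularity at the origin, and $f_c$ is isometric to $f_0$. (2) If $c_1(s)$ and $c_2(s)$ $(|s|<\pi/2)$ are two regular curves in $S^2$ parametrized by arc length, then $f_{c_1}$ is congruent to $f_{c_2}$ if and only if $c_1$ is congruent to $c_2$ in $S^2$. (3) $f_c$ is congruent to $f_0$ if and only if $c$ is a geodesic in $S^2$.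
   Context: Let $f_{\mathrm{std}}(u,v)=(u,uv,v^2)$. A singular point $p$ of a $C^\infty$ map $f:U\to\mathbf{R}^3$ ($U\subset\mathbf{R}^2$ a domain), i.e. a point where the Jacobi matrix has rank less than $2$, is a cross cap singularity if there are a local diffeomorphism $\varphi$ of $\mathbf{R}^2$ (taking $p$ to the origin) and a local diffeomorphism $\Phi$ of $\mathbf{R}^3$ (taking $f(p)$ to the origin) such that $\Phi\circ f=f_{\mathrm{std}}\circ\varphi$ near $p$. Two $C^\infty$ maps $f_0,f_1:U\to\mathbf{R}^3$ having a cross cap singularity at $(0,0)\in U$ are isometric if on $U$ one has $(f_0)_u\cdot(f_0)_u=(f_1)_u\cdot(f_1)_u$, $(f_0)_u\cdot(f_0)_v=(f_1)_u\cdot(f_1)_v$ and $(f_0)_v\cdot(f_0)_v=(f_1)_v\cdot(f_1)_v$, where the dot is the Euclidean inner product. Two maps $f,\tilde f:\mathbf{R}^2\to\mathbf{R}^3$ are congruent if $\tilde f=T\circ f$ for some orientation-preserving isometry $T$ of $\mathbf{R}^3$. Two curves $c_1,c_2$ in $S^2$ (with the same parameter interval) are congruent in $S^2$ if $c_2=R\circ c_1$ for some $R\in SO(3)$; equivalently, they have the same geodesic curvature function. *)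

(* Defs.v *)
From HB Require Import structures.
From mathcomp Require Export all_boot all_order all_algebra.
From mathcomp Require Export all_classical all_reals all_analysis.
Export Order.TTheory GRing.Theory Num.Theory.
Export numFieldNormedType.Exports.

Set Implicit Arguments.
Unset Strict Implicit.
Unset Printing Implicit Defensive.

Local Open Scope ring_scope.
Local Open Scope classical_set_scope.

(* Points and vectors of R^n are row vectors 'rV[R]_n. The library's norm
   `|_| on 'rV[R]_n is the sup norm: it is used here only through the topology
   and the derivatives it induces; lengths and distances are [enorm]. *)
Section Euclidean.
Context {R : realType}.

Definition vec3 (x y z : R) : 'rV[R]_3 := \row_(j < 3) [:: x; y; z]`_j.

Definition dot n (x y : 'rV[R]_n) : R := \sum_(i < n) x 0 i * y 0 i.

Definition enorm n (x : 'rV[R]_n) : R := Num.sqrt (dot x x).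

Definition cross (x y : 'rV[R]_3) : 'rV[R]_3 :=
  vec3 (x 0 1 * y 0 2 - x 0 2 * y 0 1)
       (x 0 2 * y 0 0 - x 0 0 * y 0 2)
       (x 0 0 * y 0 1 - x 0 1 * y 0 0).

End Euclidean.

Section Smooth.
Context {R : realType}.

Definition partial n m (i : 'I_n) (f : 'rV[R]_n -> 'rV[R]_m) :
  'rV[R]_n -> 'rV[R]_m := fun x => 'D_(delta_mx 0 i) f x.

(* For open U: class C^k, i.e. all partial derivatives of order at most k
   exist and are continuous on U. *)
Fixpoint Ck n m (k : nat) (U : set 'rV[R]_n) (f : 'rV[R]_n -> 'rV[R]_m) : Prop :=
  (forall x, U x -> {for x, continuous f}) /\
  match k with
  | 0 => True
  | k'.+1 => forall i : 'I_n,
      (forall x, U x -> derivable f x (delta_mx 0 i)) /\ Ck k' U (partial i f)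
  end.

Definition smooth_on n m (U : set 'rV[R]_n) (f : 'rV[R]_n -> 'rV[R]_m) : Prop :=
  forall k, Ck k U f.

(* phi is a total function, but only its values near p matter. *)
Definition local_diffeo_at n (phi : 'rV[R]_n -> 'rV[R]_n) (p : 'rV[R]_n) : Prop :=
  exists (U V : set 'rV[R]_n) (psi : 'rV[R]_n -> 'rV[R]_n),
    [/\ open U, open V & U p] /\
    [/\ smooth_on U phi, smooth_on V psi,
        forall x, U x -> V (phi x) /\ psi (phi x) = x &
        forall y, V y -> U (psi y) /\ phi (psi y) = y].

End Smooth.

Section CrossCap.
Context {R : realType}.

Definition fstd (x : 'rV[R]_2) : 'rV[R]_3 :=
  let u := x 0 0 in let v := x 0 1 in vec3 u (u * v) (v ^+ 2).

(* The library's 'J f p is the transpose of the usual Jacobi matrix. *)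
Definition singular_point (f : 'rV[R]_2 -> 'rV[R]_3) (p : 'rV[R]_2) : Prop :=
  (\rank ('J f p) < 2)%N.

Definition cross_cap (U : set 'rV[R]_2) (f : 'rV[R]_2 -> 'rV[R]_3)
    (p : 'rV[R]_2) : Prop :=
  [/\ open U, U p, smooth_on U f, singular_point f p &
      exists (phi : 'rV[R]_2 -> 'rV[R]_2) (Phi : 'rV[R]_3 -> 'rV[R]_3),
        [/\ local_diffeo_at phi p, phi p = 0,
            local_diffeo_at Phi (f p), Phi (f p) = 0 &
            \forall x \near p, Phi (f x) = fstd (phi x)]].

Definition isometric (U : set 'rV[R]_2) (f0 f1 : 'rV[R]_2 -> 'rV[R]_3) : Prop :=
  [/\ cross_cap U f0 0, cross_cap U f1 0 &
      forall (x : 'rV[R]_2), U x ->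
        [/\ dot (partial 0 f0 x) (partial 0 f0 x)
              = dot (partial 0 f1 x) (partial 0 f1 x),
            dot (partial 0 f0 x) (partial 1 f0 x)
              = dot (partial 0 f1 x) (partial 1 f1 x) &
            dot (partial 1 f0 x) (partial 1 f0 x)
              = dot (partial 1 f1 x) (partial 1 f1 x)]].

End CrossCap.

Section Congruence.
Context {R : realType}.

Definition isometry n (T : 'rV[R]_n -> 'rV[R]_n) : Prop :=
  forall x y, enorm (T x - T y) = enorm (x - y).

Definition orientation_preserving n (T : 'rV[R]_n -> 'rV[R]_n) : Prop :=
  forall p, differentiable T p /\ 0 < \det ('J T p).

Definition congruent (f g : 'rV[R]_2 -> 'rV[R]_3) : Prop :=
  exists T : 'rV[R]_3 -> 'rV[R]_3,
    [/\ isometry T, orientation_preserving T & forall x, g x = T (f x)].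

End Congruence.

Section SphericalCurves.
Context {R : realType}.

(* Curves are total functions; only their restriction to |s| < pi/2 matters. *)
Definition curve_dom : set R := `]- (pi / 2), (pi / 2)[.

Definition arclength_sphere_curve (c : R -> 'rV[R]_3) : Prop :=
  forall s, curve_dom s ->
    [/\ forall k, derivable (derive1n k c) s 1,
        enorm (c s) = 1 & enorm (derive1 c s) = 1].

Definition SO3 (A : 'M[R]_3) : Prop := A *m A^T = 1%:M /\ \det A = 1.

(* Row-vector convention: A acts by x |-> x *m A. *)
Definition congruent_S2 (c1 c2 : R -> 'rV[R]_3) : Prop :=
  exists A : 'M[R]_3, SO3 A /\ forall s, curve_dom s -> c2 s = c1 s *m A.

(* The covariant derivative of c' along c, i.e. the orthogonal projection of
   c'' to the tangent plane of the sphere at c, vanishes. *)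
Definition geodesic_S2 (c : R -> 'rV[R]_3) : Prop :=
  forall s, curve_dom s -> derive1n 2 c s - dot (derive1n 2 c s) (c s) *: c s = 0.

End SphericalCurves.

Section RuledSurface.
Context {R : realType}.

(* The integral from 0 to v, for v of either sign, computed componentwise. *)
Definition int0 (h : R -> R) (v : R) : R :=
  if 0 <= v then \int[lebesgue_measure]_(t in `[0, v]) h t
  else - \int[lebesgue_measure]_(t in `[v, 0]) h t.

Definition vint0 n (h : R -> 'rV[R]_n) (v : R) : 'rV[R]_n :=
  \row_(j < n) int0 (fun t => h t 0 j) v.

Variables (a02 a11 : R).

Definition f_0 (x : 'rV[R]_2) : 'rV[R]_3 :=
  let u := x 0 0 in let v := x 0 1 in
  2^-1 *: vec3 0 0 (a02 * v ^+ 2) + u *: vec3 1 v (a11 * v).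

Variable c : R -> 'rV[R]_3.

Definition chat (v : R) : 'rV[R]_3 := c (atan (v * Num.sqrt (1 + a11 ^+ 2))).

Definition xi (v : R) : 'rV[R]_3 :=
  Num.sqrt (1 + (1 + a11 ^+ 2) * v ^+ 2) *: chat v.

Definition B (v : R) : 'rV[R]_3 := a11 *: derive1 xi v + cross (xi v) (derive1 xi v).

Definition gamma (v : R) : 'rV[R]_3 :=
  (a02 / (1 + a11 ^+ 2)) *: vint0 (fun t => t *: B t) v.

Definition f_ (x : 'rV[R]_2) : 'rV[R]_3 :=
  let u := x 0 0 in let v := x 0 1 in gamma v + u *: xi v.

End RuledSurface.

(* Main.v *)
(* The surface f_c is ruled, f_c = gamma + u xi, and the curve xi on the cone
   over c is parametrized so that |xi|^2, xi.xi' and |xi'|^2 do not depend on c;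
   since gamma' is a multiple of v B, the first fundamental form does not depend
   on c either, and f_0 is itself f_c for a great circle c. A congruence between
   f_{c1} and f_{c2} is linear (both surfaces pass through the origin) and
   carries rulings to rulings, hence c1 to c2; conversely a rotation taking c1
   to c2 commutes with the construction of f_c. This gives (2), and (3) is the
   case c2 = great circle of (2).

   For the cross cap, pass to the parameters (U, v) where U is the first
   coordinate, and find the double point curve: the parameters v = tau + V and
   v = tau - V have the same image for U = q. Here tau and q are even functions
   of V, obtained by solving one scalar equation between divided differences.
   In the parameters (X, V), X = U - q(V), the surface is affine in X with
   coefficients of the form a(V) + V b(V), a and b even, the odd part of the
   X-free term being zero. Writing even functions of V as smooth functions of V^2
   expresses it as a diffeomorphism applied to (X, X V, V^2). The extension of an
   even function a(V) = A(V^2) to negative arguments is by Seeley's reflection: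
   A(-z) is a series of values A(l_k z), l_k > 0, whose weights have the moments
   of the Dirac mass at -1. *)

From HB Require Import structures.
Require Import Defs.
From mathcomp Require Import ring lra zify.

Set Implicit Arguments.
Unset Strict Implicit.
Unset Printing Implicit Defensive.

Local Open Scope ring_scope.
Local Open Scope classical_set_scope.

(** * Smooth functions *)

Section Differentiability.
Context {R : realType} (V W : normedModType R).

(** A cross cap has to be certified by explicit diffeomorphisms of the source and of the target. All
    of them are built from linear maps and maps that change a single coordinate; for the latter, the
    inverse function theorem reduces to monotonicity in one variable. The linear map comes from the
    frame xi(0), xi'(0), gamma''(0), which is independent because a02 > 0; in its dual coordinates
    the 2-jets of the surface take fixed values, and every later positivity condition is read off
    from them. The obstacle is the passage from V to V^2. A smooth even function is a function of
    V^2 for V^2 >= 0 only, whereas a diffeomorphism of R^3 must be defined on a full neighbourhood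
    of the origin; this forces an extension whose derivatives of all orders match at 0. Divided
    differences stay smooth at coinciding arguments because they are averages over segments.
    Derivatives of integrals and of series are obtained from Taylor estimates with a quadratic
    remainder, which can be integrated and summed. *)

Lemma differentiable_eps (f : V -> W) (x : V) (e : R) :
  differentiable f x -> 0 < e ->
  \forall y \near x, `|f y - f x - 'd f x (y - x)| <= e * `|y - x|.
Proof.
move=> /diff_locally /eqaddoP df /df.
rewrite (near_shift 0 x) subr0; apply: filterS => y /=.
by rewrite !fctE /= addrK opprD addrA.
Qed.

Lemma eps_differentiable (f : V -> W) (x : V) (L : {linear V -> W}) :
  continuous L ->
  (forall e : R, 0 < e ->
    \forall y \near x, `|f y - f x - L (y - x)| <= e * `|y - x|) ->
  is_diff x f L.
Proof.
move=> cL H.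
have E : f \o shift x = cst (f x) + L +o_ 0 id.
  apply/eqaddoP => e e0; rewrite [\forall y \near _, _ <= _](near_shift x) sub0r.
  apply: filterS (H e e0) => y /=.
  by rewrite !fctE /= subrK opprD addrA.
have dE := diff_unique cL E.
by split; [apply/diff_locallyP; rewrite dE|rewrite dE].
Qed.

Lemma near_eq_is_diff (f g : V -> W) (x : V) :
  (\forall y \near x, f y = g y) -> differentiable f x -> differentiable g x.
Proof.
move=> fg df; have dc : continuous ('d f x) by apply: diff_continuous.
suff [] : is_diff x g ('d f x) by [].
apply: (eps_differentiable dc) => e e0.
have fgx := nbhs_singleton fg.
apply: filterS2 fg (differentiable_eps df e0) => y <-.
by rewrite fgx.
Qed.

(** A quadratic remainder passes through integrals and dominated sums, so this form yields the
    derivatives of segment averages and of the reflection series. *)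
Lemma quadratic_is_diff (f : V -> W) (x : V) (L : {linear V -> W}) (C : R) :
  continuous L ->
  (\forall y \near x, `|f y - f x - L (y - x)| <= C * `|y - x| ^+ 2) ->
  is_diff x f L.
Proof.
move=> cL H; apply: (eps_differentiable cL) => e e0.
have d0 : 0 < e / (`|C| + 1) by rewrite divr_gt0// ltr_wpDl.
apply: filterS2 H (nbhsx_ballx x _ d0) => y Hy.
rewrite -ball_normE /= distrC => yx.
apply: (le_trans Hy); rewrite expr2 mulrA ler_wpM2r//.
apply: (@le_trans _ _ ((`|C| + 1) * `|y - x|)).
  by rewrite ler_wpM2r// (le_trans (ler_norm C))// lerDl.
by rewrite mulrC -ler_pdivlMr ?ltr_wpDl// ltW.
Qed.
End Differentiability.

Section Smooth.
Context {R : realType}.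

Lemma diff_real (phi : R -> R) (y a : R) :
  differentiable phi y -> 'd phi y a = a * 'D_1 phi y.
Proof. by move=> /derivable1_diffP/deriv1E ->; rewrite derive1E. Qed.

(* Differentiability in place of existence of partial derivatives makes the
   chain rule available at every order. *)
Fixpoint sm (V : normedModType R) (k : nat) (U : set V) (f : V -> R) : Prop :=
  (forall x, U x -> differentiable f x) /\
  if k is k'.+1 then forall v, sm k' U ('D_v f) else True.

Definition smooth (V : normedModType R) (U : set V) (f : V -> R) := forall k, sm k U f.

Section Calculus.
Context (V : normedModType R) (U : set V) (oU : open U).

Lemma sm_diff k (f : V -> R) x : sm k U f -> U x -> differentiable f x.
Proof. by case: k => [|k] [df _]; apply: df. Qed.

Lemma smooth_diff (f : V -> R) x : smooth U f -> U x -> differentiable f x.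
Proof. by move=> /(_ 0) /sm_diff; apply. Qed.

Lemma smS k (f : V -> R) : sm k.+1 U f -> sm k U f.
Proof.
elim: k f => [|k IH] f [df Df]; first by split.
by split=> // v; apply/IH/Df.
Qed.

Lemma sm_ext k (f g : V -> R) :
  (forall x, U x -> f x = g x) -> sm k U f -> sm k U g.
Proof.
elim: k f g => [|k IH] f g fg.
  move=> [df _]; split=> // x Ux; apply: near_eq_is_diff (df x Ux).
  by apply: filterS (open_nbhs_nbhs (conj oU Ux)) => y /fg.
move=> [df Df]; split.
  move=> x Ux; apply: near_eq_is_diff (df x Ux).
  by apply: filterS (open_nbhs_nbhs (conj oU Ux)) => y /fg.
move=> v; apply: IH (Df v) => x Ux; apply: near_eq_derive.
by apply: filterS (open_nbhs_nbhs (conj oU Ux)) => y /fg.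
Qed.

(** Induction step of the closure rules: a formula for the derivative, valid on [U] only, has to be
    smooth to one order less. *)
Lemma smSI k (f : V -> R) (df : V -> V -> R) :
  (forall x, U x -> differentiable f x) ->
  (forall v x, U x -> 'D_v f x = df v x) ->
  (forall v, sm k U (df v)) -> sm k.+1 U f.
Proof.
by move=> Hd HD Hk; split=> // v; apply: sm_ext (Hk v) => x Ux; rewrite HD.
Qed.

Lemma smooth_derive (f : V -> R) v : smooth U f -> smooth U ('D_v f).
Proof. by move=> sf k; case: (sf k.+1) => _; apply. Qed.

Lemma smooth_ext (f g : V -> R) :
  (forall x, U x -> f x = g x) -> smooth U f -> smooth U g.
Proof. by move=> fg sf k; apply: sm_ext (sf k). Qed.

Lemma sm_cst k (c : R) : sm k U (fun=> c).
Proof.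
elim: k c => [|k IH] c; first by split=> // x _; exact: differentiable_cst.
apply: (@smSI _ _ (fun _ _ => 0)) => [x _||]; first exact: differentiable_cst.
  by move=> v x _; rewrite derive_cst.
by move=> v; apply: IH.
Qed.

Lemma sm_lin k (L : {linear V -> R}) : continuous L -> sm k U L.
Proof.
move=> cL; have dL x : differentiable L x by apply: linear_differentiable.
case: k => [|k]; first by split=> // x _.
apply: (@smSI _ _ (fun v _ => L v)) => //; last by move=> v; apply: sm_cst.
by move=> v x _; rewrite deriveE// diff_lin.
Qed.

Lemma smD k (f g : V -> R) : sm k U f -> sm k U g -> sm k U (fun x => f x + g x).
Proof.
elim: k f g => [|k IH] f g [df Df] [dg Dg].
  by split=> // x Ux; exact: (differentiableD (df x Ux) (dg x Ux)).
apply: (@smSI _ _ (fun v x => 'D_v f x + 'D_v g x)); last by move=> v; exact: (IH _ _ (Df v) (Dg v)).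
  by move=> x Ux; exact: (differentiableD (df x Ux) (dg x Ux)).
move=> v x Ux; have Dfx := @diff_derivable _ _ _ _ _ v (df x Ux).
have Dgx := @diff_derivable _ _ _ _ _ v (dg x Ux).
by rewrite -[LHS]/('D_v (f + g) x) deriveD.
Qed.

Lemma smM k (f g : V -> R) : sm k U f -> sm k U g -> sm k U (fun x => f x * g x).
Proof.
elim: k f g => [|k IH] f g Hf Hg; have := Hf; have := Hg => -[dg Dg] [df Df].
  by split=> // x Ux; exact: (differentiableM (df x Ux) (dg x Ux)).
apply: (@smSI _ _ (fun v x => f x * 'D_v g x + g x * 'D_v f x)).
- by move=> x Ux; exact: (differentiableM (df x Ux) (dg x Ux)).
- move=> v x Ux; have Dfx := @diff_derivable _ _ _ _ _ v (df x Ux).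
  have Dgx := @diff_derivable _ _ _ _ _ v (dg x Ux).
  exact: (deriveM Dfx Dgx).
- by move=> v; exact: (smD (IH _ _ (smS Hf) (Dg v)) (IH _ _ (smS Hg) (Df v))).
Qed.

Lemma sm_comp1 k (I : set R) (phi : R -> R) (f : V -> R) :
  (forall x, U x -> I (f x)) -> sm k I phi -> sm k U f -> sm k U (phi \o f).
Proof.
move=> UI; elim: k phi f UI => [|k IH] phi f UI Hp Hf.
  move: Hp Hf => [dp _] [df _]; split=> // x Ux.
  by exact: (differentiable_comp (df x Ux) (dp _ (UI x Ux))).
have := Hf; have := Hp => -[dp Dp] [df Df].
apply: (@smSI _ _ (fun v x => ('D_1 phi \o f) x * 'D_v f x)).
- by move=> x Ux; exact: (differentiable_comp (df x Ux) (dp _ (UI x Ux))).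
- move=> v x Ux; have dfx := df x Ux; have dpx := dp _ (UI x Ux).
  rewrite deriveE; last exact: differentiable_comp.
  by rewrite diff_comp//= diff_real// -deriveE// mulrC.
- move=> v; apply: smM; last exact: Df.
  by apply: IH => //; [exact: Dp|exact: smS].
Qed.

Lemma smooth_cst (c : R) : smooth U (fun=> c).
Proof. by move=> k; apply: sm_cst. Qed.

Lemma smooth_lin (L : {linear V -> R}) : continuous L -> smooth U L.
Proof. by move=> cL k; apply: sm_lin. Qed.

Lemma smoothD (f g : V -> R) : smooth U f -> smooth U g -> smooth U (fun x => f x + g x).
Proof. by move=> sf sg k; apply: smD. Qed.

Lemma smoothM (f g : V -> R) : smooth U f -> smooth U g -> smooth U (fun x => f x * g x).
Proof. by move=> sf sg k; apply: smM. Qed.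

Lemma smoothN (f : V -> R) : smooth U f -> smooth U (fun x => - f x).
Proof.
move=> sf; apply: (@smooth_ext (fun x => -1 * f x)) => [x _|].
  by rewrite mulN1r.
by apply: smoothM => //; apply: smooth_cst.
Qed.

Lemma smoothB (f g : V -> R) : smooth U f -> smooth U g -> smooth U (fun x => f x - g x).
Proof. by move=> sf sg; apply: smoothD => //; apply: smoothN. Qed.

Lemma sm_sum k n (f : 'I_n -> V -> R) :
  (forall i, sm k U (f i)) -> sm k U (fun x => \sum_i f i x).
Proof.
elim: n f => [|n IH] f sf.
  by apply: (@sm_ext _ (fun=> 0)) (sm_cst k 0) => x _; rewrite big_ord0.
apply: (@sm_ext _ (fun x => \sum_i f (widen_ord (leqnSn n) i) x + f ord_max x)).
  by move=> x _; rewrite big_ord_recr.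
by apply: smD => //; apply: IH.
Qed.

Lemma smooth_sum n (f : 'I_n -> V -> R) :
  (forall i, smooth U (f i)) -> smooth U (fun x => \sum_i f i x).
Proof. by move=> sf k; apply: sm_sum => i; apply: sf. Qed.

Lemma smooth_comp1 (I : set R) (phi : R -> R) (f : V -> R) :
  (forall x, U x -> I (f x)) -> smooth I phi -> smooth U f -> smooth U (phi \o f).
Proof. by move=> UI sp sf k; apply: (@sm_comp1 _ I). Qed.

End Calculus.

Lemma smooth_sub (V : normedModType R) (U U' : set V) (f : V -> R) :
  U' `<=` U -> smooth U f -> smooth U' f.
Proof.
move=> UU sf k; elim: k f {sf}(sf k) => [|k IH] f [df Df]; split=> //.
- by move=> x /UU/df.
- by move=> x /UU/df.
- by move=> v; apply/IH/Df.
Qed.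

Lemma smooth_id (I : set R) : open I -> smooth I (fun x : R => x).
Proof.
move=> oI; apply: (@smooth_lin _ _ oI (idfun : {linear R -> R})).
by move=> x; exact: cvg_id.
Qed.

Lemma smooth_coord n (U : set 'rV[R]_n) i : open U -> smooth U (fun x => x 0 i).
Proof.
move=> oU k; have dc x : differentiable (fun x : 'rV[R]_n => x 0 i) x.
  exact: differentiable_coord.
case: k => [|k]; first by split.
apply: (@smSI 'rV[R]_n U oU k _ (fun v _ => v 0 i)) => //; last by move=> v; apply: sm_cst.
move=> v x Ux; rewrite /derive.
apply: (@cvg_lim R) => //.
apply: (@cvg_trans _ ((fun=> v 0 i) @ (0:R)^')); last exact: cvg_cst.
apply: near_eq_cvg; near=> h.
rewrite /= !mxE addrK /GRing.scale /= mulrA mulVf ?mul1r//.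
by near: h; exact: nbhs_dnbhs_neq.
Unshelve. all: by end_near. Qed.

Lemma smooth_derive_is (V : normedModType R) (U : set V) (f : V -> R) x v :
  smooth U f -> U x -> is_derive x v f ('D_v f x).
Proof. by move=> sf Ux; apply/derivableP/diff_derivable/(smooth_diff sf). Qed.

End Smooth.

Section SmoothRow.
Context {R : realType}.

Lemma smV (V : normedModType R) (U : set V) (oU : open U) k (f : V -> R) :
  (forall x, U x -> f x != 0) -> sm k U f -> sm k U (fun x => (f x)^-1).
Proof.
move=> f0; elim: k => [|k IH] Hf; have [df Df] := Hf.
  by split=> // x Ux; exact: (differentiableV (df x Ux) (f0 x Ux)).
apply: (@smSI _ _ U oU k _ (fun v x => (- ((f x)^-1 * (f x)^-1)) * 'D_v f x)).
- by move=> x Ux; exact: (differentiableV (df x Ux) (f0 x Ux)).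
- move=> v x Ux; have Dfx := @diff_derivable _ _ _ _ _ v (df x Ux).
  rewrite (deriveV (f0 x Ux) Dfx) /GRing.scale /=.
  by rewrite -exprVn expr2.
- move=> v; apply: (smM oU); last exact: Df.
  have smk := IH (smS Hf).
  apply: (@sm_ext _ _ U oU k (fun x => -1 * ((f x)^-1 * (f x)^-1))).
    by move=> x _; rewrite mulN1r.
  by apply: (smM oU); [exact: sm_cst|exact: (smM oU)].
Qed.

Lemma smoothV (V : normedModType R) (U : set V) (f : V -> R) : open U ->
  (forall x, U x -> f x != 0) -> smooth U f -> smooth U (fun x => (f x)^-1).
Proof. by move=> oU f0 sf k; apply: smV. Qed.

Lemma diff_rVE n (F : 'rV[R]_n -> R) y w : differentiable F y ->
  'd F y w = \sum_j w 0 j * 'D_(delta_mx 0 j) F y.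
Proof.
move=> dF; rewrite {1}(row_sum_delta w) linear_sum; apply: eq_bigr => j _.
by rewrite linearZ /= deriveE.
Qed.

Lemma differentiable_row (V : normedModType R) n (g : V -> 'rV[R]_n) x :
  (forall j, differentiable (fun y => g y 0 j) x) -> differentiable g x.
Proof.
move=> dg.
have -> : g = \sum_j (fun y => g y 0 j *: (delta_mx 0 j : 'rV[R]_n)).
  by apply/funext => y; rewrite fct_sumE -row_sum_delta.
apply: differentiable_sum => j; exact: differentiableZl.
Qed.

Lemma derivable_row (V : normedModType R) n (g : V -> 'rV[R]_n) x v :
  (forall j, derivable (fun y => g y 0 j) x v) -> derivable g x v.
Proof. by move=> dg; apply/derivable_mxP => i j; rewrite ord1. Qed.

Lemma derive_row (V : normedModType R) n (g : V -> 'rV[R]_n) x v j :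
  derivable g x v -> ('D_v g x) 0 j = 'D_v (fun y => g y 0 j) x.
Proof. by move=> dg; rewrite derive_mx// mxE. Qed.

Lemma sm_comp (V : normedModType R) n (U : set V) (W : set 'rV[R]_n) k
    (F : 'rV[R]_n -> R) (g : V -> 'rV[R]_n) :
  open U -> (forall x, U x -> W (g x)) -> sm k W F ->
  (forall j, sm k U (fun x => g x 0 j)) -> sm k U (F \o g).
Proof.
move=> oU UW; elim: k F => [|k IH] F HF Hg.
  split=> // x Ux; apply: differentiable_comp.
    by apply: differentiable_row => j; case: (Hg j) => dg _; apply: dg.
  by case: HF => dF _; apply/dF/UW.
have dgx x : U x -> differentiable g x.
  by move=> Ux; apply: differentiable_row => j; case: (Hg j) => dg _; apply: dg.
have [dF DF] := HF.
have dFx x : U x -> differentiable F (g x) by move=> /UW/dF.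
apply: (@smSI _ _ U oU k _ (fun v x => \sum_j ('D_v (fun y => g y 0 j) x * ('D_(delta_mx 0 j) F \o g) x))).
- by move=> x Ux; exact: (differentiable_comp (dgx x Ux) (dFx x Ux)).
- move=> v x Ux; rewrite deriveE; last exact: (differentiable_comp (dgx x Ux) (dFx x Ux)).
  rewrite (diff_comp (dgx x Ux) (dFx x Ux)) /= diff_rVE; last exact: dFx.
  apply: eq_bigr => j _; congr (_ * _).
  by rewrite -deriveE ?derive_row//; [exact/diff_derivable/dgx|exact: dgx].
- move=> v; apply: (sm_sum oU) => j; apply: (smM oU); first by case: (Hg j) => _; apply.
  by apply: IH; [exact: DF|move=> i; exact: smS].
Qed.

Lemma smooth_comp (V : normedModType R) n (U : set V) (W : set 'rV[R]_n)
    (F : 'rV[R]_n -> R) (g : V -> 'rV[R]_n) :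
  open U -> (forall x, U x -> W (g x)) -> smooth W F ->
  (forall j, smooth U (fun x => g x 0 j)) -> smooth U (F \o g).
Proof. by move=> oU UW sF sg k; apply: (sm_comp oU UW) => // j; apply: sg. Qed.

Definition smoothv (V : normedModType R) n (U : set V) (f : V -> 'rV[R]_n) :=
  forall j, smooth U (fun x => f x 0 j).

Lemma smoothv_diff (V : normedModType R) n (U : set V) (f : V -> 'rV[R]_n) x :
  smoothv U f -> U x -> differentiable f x.
Proof. by move=> sf Ux; apply: differentiable_row => j; apply: smooth_diff (sf j) Ux. Qed.

Lemma smoothv_derive (V : normedModType R) n (U : set V) (f : V -> 'rV[R]_n) v :
  open U -> smoothv U f -> smoothv U ('D_v f).
Proof.
move=> oU sf j; apply: (smooth_ext oU _ (smooth_derive v (sf j))) => x Ux.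
by rewrite derive_row//; apply/diff_derivable/(smoothv_diff sf).
Qed.

(** Passage from directional derivatives of all orders to the class [Ck], in terms of which
    [cross_cap] and [local_diffeo_at] are stated. *)
Lemma smoothv_smooth_on n m (U : set 'rV[R]_n) (f : 'rV[R]_n -> 'rV[R]_m) :
  open U -> smoothv U f -> smooth_on U f.
Proof.
move=> oU sf k; elim: k f sf => [|k IH] f sf.
  by split=> // x Ux; apply/differentiable_continuous/(smoothv_diff sf).
split; first by move=> x Ux; apply/differentiable_continuous/(smoothv_diff sf).
move=> i; split; first by move=> x Ux; apply/diff_derivable/(smoothv_diff sf).
by apply: IH; apply: smoothv_derive.
Qed.

Lemma smoothv_comp (V : normedModType R) n m (U : set V) (W : set 'rV[R]_n)
    (F : 'rV[R]_n -> 'rV[R]_m) (g : V -> 'rV[R]_n) :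
  open U -> (forall x, U x -> W (g x)) -> smoothv W F -> smoothv U g -> smoothv U (F \o g).
Proof. by move=> oU UW sF sg j; apply: (smooth_comp oU UW (sF j)). Qed.

End SmoothRow.

(** * Local diffeomorphisms *)

Section Linear.
Context {R : realType}.

Definition mk_linear (V W : normedModType R) (f : V -> W) (lf : linear f) :
  {linear V -> W} := HB.pack f (GRing.isLinear.Build R V W _ f lf).

Lemma is_diff_quadratic (V W : normedModType R) (f L : V -> W) (x : V) (C : R) :
  linear L -> continuous L ->
  (\forall y \near x, `|f y - f x - L (y - x)| <= C * `|y - x| ^+ 2) ->
  is_diff x f L.
Proof. by move=> lL cL H; apply: (quadratic_is_diff (L := mk_linear lL)) H. Qed.

Lemma is_diff_eps (V W : normedModType R) (f L : V -> W) (x : V) :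
  linear L -> continuous L ->
  (forall e : R, 0 < e ->
    \forall y \near x, `|f y - f x - L (y - x)| <= e * `|y - x|) ->
  is_diff x f L.
Proof. by move=> lL cL H; apply: (eps_differentiable (L := mk_linear lL)) H. Qed.

Lemma coord_norm_le n (x : 'rV[R]_n) j : `|x 0 j| <= `|x|.
Proof.
rewrite [leRHS]/Num.norm /= mx_normrE.
exact: (le_bigmax _ (fun ij : 'I_1 * 'I_n => `|x ij.1 ij.2|) (0, j)).
Qed.

Lemma row_norm_le n (x : 'rV[R]_n) (e : R) : 0 <= e ->
  (forall j, `|x 0 j| <= e) -> `|x| <= e.
Proof.
move=> e0 H; rewrite [leLHS]/Num.norm /= mx_normrE.
by apply: bigmax_le => // -[i j] _ /=; rewrite ord1.
Qed.

Lemma ball_rowP n (p x : 'rV[R]_n) (r : R) : 0 < r ->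
  ball p r x <-> forall j, `|x 0 j - p 0 j| < r.
Proof.
move=> r0; split=> [[_ H] j|H]; first by have := H 0 j; rewrite -ball_normE /= distrC.
by split=> // i j; rewrite ord1 -ball_normE /= distrC.
Qed.

Lemma linear_row_lipschitz n (L : 'rV[R]_n -> R) : linear L ->
  exists2 C, 0 <= C & forall w, `|L w| <= C * `|w|.
Proof.
move=> lL; exists (\sum_j `|L (delta_mx 0 j)|); first exact: sumr_ge0.
move=> w; rewrite {1}(row_sum_delta w).
rewrite -[L _]/(mk_linear lL _) linear_sum mulr_suml.
apply: (le_trans (ler_norm_sum _ _ _)); apply: ler_sum => j _.
rewrite linearZ normrZ mulrC ler_wpM2l//; exact: coord_norm_le.
Qed.

Lemma linear_row_continuous n (L : 'rV[R]_n -> R) : linear L -> continuous L.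
Proof.
move=> lL; have [C C0 HC] := linear_row_lipschitz lL.
move=> w; apply: (proj2 (@cvgrPdist_lt _ _ _ _ (nbhs_filter w) _ _)) => e e0.
have d0 : 0 < e / (C + 1) by rewrite divr_gt0// ltr_wpDl.
apply/nbhs_ballP; exists (e / (C + 1)) => // y; rewrite -ball_normE /= => wy.
rewrite -[L w]/(mk_linear lL w) -[L y]/(mk_linear lL y) -linearB /=.
apply: (le_lt_trans (HC _)); apply: (@le_lt_trans _ _ ((C + 1) * `|w - y|)).
  by rewrite ler_wpM2r// lerDl.
by rewrite mulrC -ltr_pdivlMr// ltr_wpDl.
Qed.

Lemma derivable_line (V : normedModType R) (G : V -> R) (a v : V) (s : R) :
  derivable G (a + s *: v) v -> is_derive s 1 (fun t => G (a + t *: v)) ('D_v G (a + s *: v)).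
Proof.
have E : (fun h : R => h^-1 *: (((fun t => G (a + t *: v)) \o shift s) (h *: (1:R)) - G (a + s *: v)))
  = (fun h => h^-1 *: ((G \o shift (a + s *: v)) (h *: v) - G (a + s *: v))).
  apply/funext => h /=; congr (_ *: (G _ - _)).
  by rewrite scalerDl [h *: 1]mulr1 addrCA.
by split; rewrite ?/derivable /derive E.
Qed.

End Linear.

(** * Inverse function theorem for maps that change one coordinate *)

Section Elementary.
Context {R : realType} (n : nat) (i : 'I_n).

Definition upd (x : 'rV[R]_n) (t : R) : 'rV[R]_n := x + (t - x 0 i) *: delta_mx 0 i.

Lemma updE x t j : upd x t 0 j = if j == i then t else x 0 j.
Proof.
rewrite !mxE eqxx /=; case: eqP => [->|_]; first by rewrite mulr1 addrC subrK.
by rewrite mulr0 addr0.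
Qed.

Lemma upd_upd x s t : upd (upd x s) t = upd x t.
Proof. by apply/rowP => j; rewrite !updE; case: eqP. Qed.

Lemma upd_id x : upd x (x 0 i) = x.
Proof. by rewrite /upd subrr scale0r addr0. Qed.

Lemma upd_line x t : upd x t = (x - x 0 i *: delta_mx 0 i) + t *: delta_mx 0 i.
Proof. by rewrite /upd scalerBl addrA addrAC. Qed.

(** The building block of the nonlinear diffeomorphisms below: invertible locally as soon as [G]
    increases strictly in coordinate [i]. *)
Definition replace_coord (G : 'rV[R]_n -> R) (x : 'rV[R]_n) := upd x (G x).

Context (p : 'rV[R]_n) (r : R) (r0 : 0 < r) (G : 'rV[R]_n -> R).
Let U : set 'rV[R]_n := ball p r.
Let e : 'rV[R]_n := delta_mx 0 i.
Context (sG : smooth U G) (G0 : forall x, U x -> 0 < 'D_e G x).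

Let oU : open U. Proof. exact: ball_open. Qed.

(** Balls of the sup norm are boxes, hence convex along the coordinate axes. *)
Let convU x s t m : U (upd x s) -> U (upd x t) -> s <= m <= t -> U (upd x m).
Proof.
move=> /ball_rowP/= -/(_ r0) Hs /ball_rowP/= -/(_ r0) Ht /andP[sm mt].
apply/ball_rowP => // j; have := Hs j; have := Ht j; rewrite !updE.
case: eqP => // _; rewrite !ltr_norml => /andP[h1 h2] /andP[h3 h4].
apply/andP; split; lra.
Qed.

Let der x s : U (upd x s) -> is_derive s 1 (fun t => G (upd x t)) ('D_e G (upd x s)).
Proof.
move=> Us; rewrite upd_line.
have -> : (fun t => G (upd x t)) = (fun t => G ((x - x 0 i *: delta_mx 0 i) + t *: e)).
  by apply/funext => t; rewrite upd_line.
apply: derivable_line; apply: diff_derivable; apply: (smooth_diff sG).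
by rewrite -upd_line.
Qed.

Let mono x s t : U (upd x s) -> U (upd x t) -> s < t -> G (upd x s) < G (upd x t).
Proof.
move=> Us Ut st.
have Um m : m \in `[s, t]%R -> U (upd x m).
  by move=> H; apply: (convU Us Ut); rewrite !(itvP H).
have [||c cst E] := @MVT R (fun t => G (upd x t)) (fun t => 'D_e G (upd x t)) s t st.
- by move=> m mst; apply/der/Um/subset_itv_oo_cc.
- apply: derivable_within_continuous => m mst; exact: (@ex_derive _ _ _ _ _ _ _ (der (Um _ mst))).
- rewrite -subr_gt0 E mulr_gt0 ?subr_gt0//; apply/G0/Um/subset_itv_oo_cc/cst.
Qed.

Let inj x y : U x -> U y -> replace_coord G x = replace_coord G y -> x = y.
Proof.
move=> Ux Uy E.
have xy : y = upd x (y 0 i).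
  apply/rowP => j; rewrite updE; case: eqP => [->//|ji].
  by have := congr1 (fun z : 'rV[R]_n => z 0 j) E; rewrite /= !updE; case: eqP.
have EG : G x = G y.
  by have := congr1 (fun z : 'rV[R]_n => z 0 i) E; rewrite /= !updE eqxx.
have := mono (x := x) (s := x 0 i) (t := y 0 i); rewrite upd_id -xy EG ltxx.
move=> /(_ Ux Uy) H1.
have := mono (x := x) (t := x 0 i) (s := y 0 i); rewrite upd_id -xy EG ltxx.
move=> /(_ Uy Ux) H2.
rewrite xy; case: (ltgtP (x 0 i) (y 0 i)) => [/H1|/H2|<-] //.
by rewrite upd_id.
Qed.

(** Openness of the image and continuity of the inverse at once. At the ends [a] and [b] of a short
    segment in direction [i], the function [G (upd y s) - y 0 i] has opposite signs; this persists
    for nearby [y], and the intermediate value theorem gives a preimage within distance [d]. *)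
Let key x0 (d : R) : U x0 -> 0 < d -> \forall y \near replace_coord G x0,
  exists x, [/\ U x, `|x - x0| <= d & replace_coord G x = y].
Proof.
move=> Ux0 d0.
have [e1 /= e10 He1] : nbhs_ball x0 U by apply/nbhs_ballP/open_nbhs_nbhs.
pose h := Num.min (e1 / 2) d.
have h0 : 0 < h by rewrite lt_min d0 divr_gt0.
have he1 : h < e1 by rewrite gt_min; apply/orP; left; rewrite ltr_pdivrMr// mulr_natr mulr2n ltrDl.
have hd : h <= d by rewrite ge_min lexx orbT.
pose a := x0 0 i - h; pose b := x0 0 i + h.
have Uh (y : 'rV[R]_n) (s : R) : (forall j, j != i -> `|y 0 j - x0 0 j| < h) -> a <= s <= b -> U (upd y s).
  move=> Hy /andP[as_ sb]; apply: He1; apply/ball_rowP => // j; rewrite updE.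
  case: eqP => [->|/eqP ji]; last exact: lt_trans (Hy j ji) he1.
  apply: le_lt_trans he1; rewrite ler_norml; rewrite /a /b in as_ sb.
  apply/andP; split; lra.
have ab : a < b by rewrite /a /b; lra.
pose y0 := replace_coord G x0.
have y0j j : j != i -> y0 0 j = x0 0 j by rewrite /y0 /replace_coord updE => /negbTE ->.
have y0i : y0 0 i = G x0 by rewrite /y0 /replace_coord updE eqxx.
have updy0 s : upd y0 s = upd x0 s by rewrite /y0 /replace_coord upd_upd.
have Ua : U (upd x0 a) by apply: Uh => [j _|]; rewrite ?subrr ?normr0 // lexx ltW.
have Ub : U (upd x0 b) by apply: Uh => [j _|]; rewrite ?subrr ?normr0 // lexx ltW.
have Ga : G (upd y0 a) < y0 0 i.
  rewrite updy0 y0i -[x0 in X in _ < X]upd_id; apply: mono => //; rewrite ?upd_id//.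
  by rewrite /a; lra.
have Gb : y0 0 i < G (upd y0 b).
  rewrite updy0 y0i -[x0 in X in X < _]upd_id; apply: mono => //; rewrite ?upd_id//.
  by rewrite /b; lra.
have contG s : U (upd y0 s) -> {for y0, continuous (fun y : 'rV[R]_n => G (upd y s) - y 0 i)}.
  move=> Us; apply: differentiable_continuous; apply: differentiableB; last exact: differentiable_coord.
  apply: (@differentiable_comp _ _ _ _ (fun y => upd y s) G); last exact: (smooth_diff sG).
  apply: differentiable_row => j.
  have -> : (fun y => upd y s 0 j) = if j == i then cst s else (fun y => y 0 j).
    by apply/funext => y; rewrite updE; case: eqP.
  by case: eqP => _; [exact: differentiable_cst|exact: differentiable_coord].
have N1 : \forall y \near y0, G (upd y a) - y 0 i < 0.
  have := contG a; rewrite updy0 => /(_ Ua) /cvgr_lt; apply.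
  by rewrite subr_lt0.
have N2 : \forall y \near y0, 0 < G (upd y b) - y 0 i.
  have := contG b; rewrite updy0 => /(_ Ub) /cvgr_gt; apply.
  by rewrite subr_gt0.
have N3 : \forall y \near y0, forall j, j != i -> `|(y : 'rV[R]_n) 0 j - x0 0 j| < h.
  apply/nbhs_ballP; exists h => //= y /ball_rowP -/(_ h0) By j ji.
  by rewrite -y0j.
rewrite -/y0; near=> y.
have Hy : forall j, j != i -> `|y 0 j - x0 0 j| < h by near: y.
have Uy s : a <= s <= b -> U (upd y s) by exact: Uh.
have [||s sab Es] := @IVT R (fun s => G (upd y s)) a b (y 0 i) (ltW ab).
- apply: derivable_within_continuous => m mst.
  by apply: (@ex_derive _ _ _ _ _ _ _ (der (Uy m _))); rewrite !(itvP mst).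
- rewrite ge_min le_max; apply/andP; split; apply/orP; [left|right]; apply/ltW.
    by rewrite -subr_lt0; near: y.
  by rewrite -subr_gt0; near: y.
exists (upd y s); split.
- by apply: Uy; rewrite !(itvP sab).
- apply: le_trans hd; apply: row_norm_le; first exact: ltW.
  move=> j; have -> : (upd y s - x0) 0 j = upd y s 0 j - x0 0 j by rewrite !mxE.
  rewrite updE; case: eqP => [->|/eqP ji]; last exact/ltW/Hy.
  rewrite ler_norml; have := itvP sab; rewrite /a /b => H.
  have h1 : x0 0 i - h <= s by rewrite H.
  have h2 : s <= x0 0 i + h by rewrite H.
  apply/andP; split; lra.
- by rewrite /replace_coord upd_upd Es upd_id.
Unshelve. all: by end_near. Qed.

Let V := replace_coord G @` U.
(** The default value [p] of [xget] occurs only outside [V]. *)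
Let psi (y : 'rV[R]_n) := xget p [set x | U x /\ replace_coord G x = y].

Let psiP y : V y -> U (psi y) /\ replace_coord G (psi y) = y.
Proof.
move=> [x Ux E]; rewrite /psi.
by case: (xgetP p [set x | U x /\ replace_coord G x = y]) => [_ _ []//|/(_ x) H]; case: H.
Qed.

Let psiK x : U x -> psi (replace_coord G x) = x.
Proof.
move=> Ux; have [U1 E] := psiP (ex_intro2 _ _ x Ux erefl).
exact: inj.
Qed.

Let oV : open V.
Proof.
rewrite openE => y [x Ux <-]; rewrite /interior.
near=> z.
have [x1 [Ux1 _ <-]] : exists x1, [/\ U x1, `|x1 - x| <= 1 & replace_coord G x1 = z].
  by near: z; apply: key.
by exists x1.
Unshelve. all: by end_near. Qed.

Let psij y j : V y -> j != i -> psi y 0 j = y 0 j.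
Proof.
move=> /psiP [_ E] ji; rewrite -[in RHS]E updE.
by rewrite (negbTE ji).
Qed.

(** Moving [y0] by [D] moves its preimage by [D + k *: e], since the other coordinates are kept. The
    linearised equation D_i = dG(D) + k A, with A the derivative of [G] along [e], determines [k]
    and hence the formula. *)
Let psi_diff y0 : V y0 -> is_diff y0 (fun y => psi y 0 i)
  (fun w => w 0 i + (w 0 i - 'd G (psi y0) w) / 'D_e G (psi y0)).
Proof.
move=> Vy0; have [Ux0 E0] := psiP Vy0; set x0 := psi y0 in Ux0 E0 *.
set A := 'D_e G x0; have A0 : 0 < A by exact: G0.
have dG : differentiable G x0 by exact: (smooth_diff sG).
have linD : linear ('d G x0) by move=> a u v; rewrite linearP.
have linL : linear (fun w : 'rV[R]_n => w 0 i + (w 0 i - 'd G x0 w) / A).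
  move=> a u v; rewrite linD !mxE /GRing.scale /=; field; exact: lt0r_neq0.
have [C C0 HC] := linear_row_lipschitz linD.
apply: is_diff_eps => //; first exact: linear_row_continuous.
move=> eps eps0.
(* [K] bounds |k| / |D|: the error term is at most A/2 times (|D| + |k|), so half of A |k| can be
   absorbed. The second bound in [d] then turns the final error d (K + 1) |D| / A into at most eps
   |D|. *)
pose K := 2 * (1 + C + A / 2) / A + 1.
have K0 : 0 < K.
  by rewrite /K ltr_wpDl// divr_ge0 ?(ltW A0)// mulr_ge0// !addr_ge0// divr_ge0// ltW.
pose d := Num.min (A / 2) (eps * A / (K + 1)).
have d0 : 0 < d by rewrite lt_min !divr_gt0// ?mulr_gt0// ltr_wpDl// ltW.
have dA : d <= A / 2 by rewrite ge_min lexx.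
have dK : d * (K + 1) <= eps * A by rewrite -ler_pdivlMr ?ltr_wpDl// ?ge_min ?lexx ?orbT// ltW.
have [e1 /= e10 He1] : nbhs_ball x0 (fun x => U x /\ `|G x - G x0 - 'd G x0 (x - x0)| <= d * `|x - x0|).
  apply/nbhs_ballP; apply: filterI (differentiable_eps dG d0).
  exact: open_nbhs_nbhs.
have e12 : 0 < e1 / 2 by rewrite divr_gt0.
have := key Ux0 e12; rewrite E0; apply: filterS => y [x [Ux xx0 Ey]].
have Bx : ball x0 e1 x.
  rewrite -ball_normE /= distrC; apply: le_lt_trans xx0 _.
  by rewrite ltr_pdivrMr// mulr_natr mulr2n ltrDl.
have [_ H] := He1 x Bx.
have Exy : psi y = x by rewrite -Ey psiK.
rewrite Exy.
have Gx : G x = y 0 i by rewrite -Ey updE eqxx.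
have Gx0 : G x0 = y0 0 i by rewrite -E0 updE eqxx.
pose k := (x 0 i - x0 0 i) - (y 0 i - y0 0 i).
pose D := y - y0.
have Exx : x - x0 = D + k *: e.
  apply/rowP => j; rewrite !mxE eqxx /=; case: (eqVneq j i) => [->|ji].
    by rewrite /= mulr1 /k; ring.
  have -> : x 0 j = y 0 j by rewrite -Exy psij//; rewrite -Ey; exists x.
  have -> : x0 0 j = y0 0 j by rewrite /x0 psij.
  by rewrite mulr0 addr0.
have dE : 'd G x0 (x - x0) = 'd G x0 D + k * A.
  by rewrite Exx linearD linearZ /= /A (deriveE e dG).
have nD : `|x - x0| <= `|D| + `|k|.
  rewrite Exx; apply: (le_trans (ler_normD _ _)); rewrite lerD2l normrZ ler_piMr//.
  by apply: row_norm_le => // j; rewrite mxE; case: (_ && _); rewrite ?normr1 ?normr0.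
have HB := HC D.
have Di : `|D 0 i| <= `|D| by exact: coord_norm_le.
have DE : D 0 i = y 0 i - y0 0 i by rewrite !mxE.
pose B := D 0 i - 'd G x0 D.
have HkB : `|B - k * A| <= d * (`|D| + `|k|).
  apply: le_trans (ler_wpM2l (ltW d0) nD); move: H; rewrite dE Gx Gx0.
  by congr (`|_| <= _); rewrite /B DE; ring.
have HBn : `|B| <= (1 + C) * `|D|.
  by apply: (le_trans (ler_normB _ _)); rewrite mulrDl mul1r lerD.
have Hk : `|k| <= K * `|D|.
  have h1 : `|k * A| <= `|B| + d * (`|D| + `|k|).
    rewrite -[k * A](subKr B); apply: (le_trans (ler_normB _ _)).
    by rewrite lerD2l.
  rewrite normrM (gtr0_norm A0) in h1.
  have h2 : d * (`|D| + `|k|) <= A / 2 * (`|D| + `|k|) by rewrite ler_wpM2r// addr_ge0.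
  have h3 : `|k| * A <= K * `|D| * A.
    have -> : K * `|D| * A = 2 * (1 + C + A / 2) * `|D| + `|D| * A.
      by rewrite /K; field; exact: lt0r_neq0.
    have := normr_ge0 D; have := normr_ge0 k; move: h1 h2 HBn; move: `|k| `|D| `|B| => a b c.
    move=> *; have := mulr_ge0 (ltW A0) (normr_ge0 D); nra.
  by rewrite -(ler_pM2r A0).
have -> : x 0 i - x0 0 i - (D 0 i + (D 0 i - 'd G x0 D) / A) = (k * A - B) / A.
  by rewrite /B /k DE; field; exact: lt0r_neq0.
rewrite normrM normfV (gtr0_norm A0) ler_pdivrMr// distrC.
apply: (le_trans HkB).
apply: (@le_trans _ _ (d * ((K + 1) * `|D|))).
  by rewrite ler_pM2l// mulrDl mul1r addrC lerD2r.
by rewrite mulrA [leRHS]mulrAC ler_wpM2r.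
Qed.

Let smooth_psi : smoothv V psi.
Proof.
have psi_other k j : j != i -> sm k V (fun y => psi y 0 j).
  move=> ji; apply: (sm_ext oV _ (smooth_coord j oV k)) => y Vy.
  by rewrite psij.
suff H : smooth V (fun y => psi y 0 i).
  by move=> j; case: (eqVneq j i) => [->//|ji] k; exact: psi_other.
elim=> [|k IH].
  by split=> // y /psi_diff [].
have VU y : V y -> U (psi y) by move=> /psiP [].
have IHj j : sm k V (fun y => psi y 0 j) by case: (eqVneq j i) => [->//|]; exact: psi_other.
have sD v : sm k V ('D_v G \o psi).
  by apply: (sm_comp oV VU _ IHj); exact: (smooth_derive v sG).
apply: (@smSI _ _ V oV k _ (fun v y => v 0 i + (v 0 i - ('D_v G \o psi) y) * ((('D_e G \o psi) y)^-1))).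
- by move=> y /psi_diff [].
- move=> v y Vy; have [dpsi Epsi] := psi_diff Vy.
  rewrite deriveE// Epsi /=; congr (_ + (_ - _) / _).
  by rewrite deriveE//; apply: (smooth_diff sG); exact: VU.
- move=> v; apply: (smD oV); first exact: sm_cst.
  apply: (smM oV); last first.
    by apply: (smV oV) => [y Vy|]; [apply/lt0r_neq0/G0/VU|exact: sD].
  apply: (smD oV); first exact: sm_cst.
  apply: (@sm_ext _ _ V oV k (fun y => -1 * ('D_v G \o psi) y)).
    by move=> y _; rewrite mulN1r.
  by apply: (smM oV); [exact: sm_cst|exact: sD].
Qed.

Lemma smooth_replace_coord : smoothv U (replace_coord G).
Proof.
move=> j; have -> : (fun x => replace_coord G x 0 j) = if j == i then G else (fun x => x 0 j).
  by apply/funext => x; rewrite updE; case: eqP.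
by case: eqP => _ //; exact: smooth_coord.
Qed.

(* The inverse is continuous by the intermediate value theorem in coordinate i;
   its derivative is a smooth expression in the inverse itself, whence smoothness
   of every order. *)
Lemma replace_coord_diffeo : exists (V : set 'rV[R]_n) (psi : 'rV[R]_n -> 'rV[R]_n),
  open V /\
  [/\ smoothv U (replace_coord G), smoothv V psi,
      forall x, U x -> V (replace_coord G x) /\ psi (replace_coord G x) = x &
      forall y, V y -> U (psi y) /\ replace_coord G (psi y) = y].
Proof.
exists V, psi; split=> //; split=> //.
- exact: smooth_replace_coord.
- by move=> x Ux; split; [exists x|exact: psiK].
Qed.

End Elementary.

Section Diffeo.
Context {R : realType} (n : nat).
Implicit Types (U V W : set 'rV[R]_n) (phi psi : 'rV[R]_n -> 'rV[R]_n).

Definition diffeo U V phi psi := (open U /\ open V) /\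
  [/\ smoothv U phi, smoothv V psi,
      forall x, U x -> V (phi x) /\ psi (phi x) = x &
      forall y, V y -> U (psi y) /\ phi (psi y) = y].

Lemma diffeo_local U V phi psi p : diffeo U V phi psi -> U p -> local_diffeo_at phi p.
Proof.
move=> [[oU oV] [sp sq H1 H2]] Up; exists U, V, psi; split=> //; split=> //.
  exact: smoothv_smooth_on.
exact: smoothv_smooth_on.
Qed.

Lemma diffeo_sym U V phi psi : diffeo U V phi psi -> diffeo V U psi phi.
Proof. by move=> [[oU oV] [sp sq H1 H2]]. Qed.

Lemma open_smooth_preimage (Z : normedModType R) m (U : set Z) (W : set 'rV[R]_m) (f : Z -> 'rV[R]_m) :
  open U -> open W -> smoothv U f -> open (U `&` f @^-1` W).
Proof.
move=> oU oW sf; rewrite openE => x [Ux Wf]; apply: filterI.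
  exact: open_nbhs_nbhs.
apply: (differentiable_continuous (smoothv_diff sf Ux)).
exact: open_nbhs_nbhs.
Qed.

Lemma diffeo_comp U V phi psi U' V' phi' psi' :
  diffeo U V phi psi -> diffeo U' V' phi' psi' ->
  diffeo (U `&` phi @^-1` U') (V' `&` psi' @^-1` V) (phi' \o phi) (psi \o psi').
Proof.
move=> [[oU oV] [sp sq H1 H2]] [[oU' oV'] [sp' sq' H1' H2']].
have oA := open_smooth_preimage oU oU' sp.
have oB := open_smooth_preimage oV' oV sq'.
split; first by split.
split.
- apply: (smoothv_comp oA _ sp') => [x []//|j].
  by apply: smooth_sub (sp j) => x [].
- apply: (smoothv_comp oB _ sq) => [x []//|j].
  by apply: smooth_sub (sq' j) => x [].
- move=> x [Ux U'x] /=; have [Vp E] := H1 x Ux; have [V'p E'] := H1' _ U'x.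
  by split; [split=> //=; rewrite /preimage /= E'|rewrite E'].
- move=> y [V'y Vy] /=; have [U'q E'] := H2' y V'y; have [Uq E] := H2 _ Vy.
  by split; [split=> //=; rewrite /preimage /= E|rewrite E].
Qed.

Lemma local_replace_coord (i : 'I_n) W (p : 'rV[R]_n) (G : 'rV[R]_n -> R) (rho : R) :
  open W -> W p -> smooth W G -> 0 < 'D_(delta_mx 0 i) G p -> 0 < rho ->
  exists r V psi, [/\ 0 < r, r <= rho, ball p r `<=` W &
    diffeo (ball p r) V (replace_coord i G) psi].
Proof.
move=> oW Wp sG DG rho0.
have : nbhs p [set x | W x /\ 0 < 'D_(delta_mx 0 i) G x].
  apply: filterI; first exact: open_nbhs_nbhs.
  have : {for p, continuous ('D_(delta_mx 0 i) G)}.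
    by apply/differentiable_continuous/(smooth_diff (smooth_derive _ sG)).
  by move=> /cvgr_gt; apply.
move=> /nbhs_ballP [r1 /= r10 Hr1].
pose r := Num.min r1 rho.
have r0 : 0 < r by rewrite lt_min r10.
have HU : ball p r `<=` [set x | W x /\ 0 < 'D_(delta_mx 0 i) G x].
  by apply: subset_trans Hr1; apply: le_ball; rewrite ge_min lexx.
have sGU : smooth (ball p r) G by apply: smooth_sub sG => x /HU [].
have [V [psi [oV H]]] := @replace_coord_diffeo _ _ i p r r0 G sGU (fun x Ux => proj2 (HU x Ux)).
exists r, V, psi; split=> //.
- by rewrite ge_min lexx orbT.
- by move=> x /HU [].
- by split=> //; split=> //; exact: ball_open.
Qed.

Lemma diffeo_mulmx (M : 'M[R]_n) : M \in unitmx ->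
  diffeo setT setT (fun x => x *m M) (fun x => x *m invmx M).
Proof.
move=> uM.
have sM (N : 'M[R]_n) : smoothv setT (fun x : 'rV[R]_n => x *m N).
  move=> j; apply: (@smooth_ext R 'rV[R]_n setT openT (fun x : 'rV[R]_n => \sum_k x 0 k * N k j)).
    by move=> x _; rewrite mxE.
  apply: smooth_sum => [|k]; first exact: openT.
  apply: (smoothM openT); first exact: (smooth_coord _ openT).
  exact: (smooth_cst openT).
split; first by split; exact: openT.
split=> //.
- by move=> x _; rewrite mulmxK.
- by move=> x _; rewrite mulmxKV.
Qed.
End Diffeo.

(** * Averages over segments *)

Section Taylor.
Context {R : realType}.

Lemma mvt_lipschitz (f f1 : R -> R) (a b M : R) :
  {within `[a, b], continuous f} ->
  (forall x, a < x < b -> is_derive x 1 f (f1 x)) ->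
  (forall x, a < x < b -> `|f1 x| <= M) ->
  forall x y, a <= x <= b -> a <= y <= b -> `|f y - f x| <= M * `|y - x|.
Proof.
move=> cf df bf.
have H x y : a <= x <= b -> a <= y <= b -> x < y -> `|f y - f x| <= M * `|y - x|.
  move=> /andP[ax xb] /andP[ay yb] xy.
  have [||c] := @MVT R f f1 x y xy.
  - by move=> z; rewrite in_itv/= => /andP[xz zy]; apply: df; rewrite (le_lt_trans ax xz) (lt_le_trans zy yb).
  - by apply: continuous_subspaceW cf; apply: subset_itv; rewrite bnd_simp.
  - rewrite in_itv/= => /andP[xc cy] ->; rewrite normrM ler_wpM2r//.
    by apply: bf; rewrite (le_lt_trans ax xc) (lt_le_trans cy yb).
move=> x y xab yab; case: (ltgtP x y) => [xy|yx|->]; first exact: H.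
- by rewrite distrC [`|y - x|]distrC; exact: H.
- by rewrite !subrr normr0 mulr0.
Qed.

(** Differentiability is asked in the open interval and a Lipschitz bound on [f1] up to the ends.
    The estimate therefore reaches the end [0] for functions of [Num.sqrt z], whose derivatives are
    given only for z > 0. *)
Lemma taylor2 (f f1 : R -> R) (a b M : R) : 0 <= M ->
  {within `[a, b], continuous f} ->
  (forall x, a < x < b -> is_derive x 1 f (f1 x)) ->
  (forall x y, a <= x <= b -> a <= y <= b -> `|f1 y - f1 x| <= M * `|y - x|) ->
  forall x y, a <= x <= b -> a <= y <= b ->
    `|f y - f x - (y - x) * f1 x| <= M * `|y - x| ^+ 2.
Proof.
move=> M0 cf df lf.
have mvt x y : a <= x <= b -> a <= y <= b -> x < y -> exists2 c, x < c < y & f y - f x = f1 c * (y - x).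
  move=> /andP[ax xb] /andP[ay yb] xy.
  have [||c] := @MVT R f f1 x y xy.
  - by move=> z; rewrite in_itv/= => /andP[xz zy]; apply: df; rewrite (le_lt_trans ax xz) (lt_le_trans zy yb).
  - by apply: continuous_subspaceW cf; apply: subset_itv; rewrite bnd_simp.
  - by rewrite in_itv/= => xcy ->; exists c.
have fin x y c : a <= x <= b -> a <= c <= b -> `|c - x| <= `|y - x| -> f y - f x = f1 c * (y - x) ->
    `|f y - f x - (y - x) * f1 x| <= M * `|y - x| ^+ 2.
  move=> xab cab cx ->; have := lf x c xab cab => H.
  have -> : f1 c * (y - x) - (y - x) * f1 x = (f1 c - f1 x) * (y - x) by ring.
  rewrite normrM expr2 mulrA ler_wpM2r//; apply: (le_trans H).
  exact: ler_wpM2l.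
move=> x y xab yab; have /andP[ax xb] := xab; have /andP[ay yb] := yab.
case: (ltgtP x y) => [xy|yx|->].
- have [c /andP[xc cy] E] := mvt x y xab yab xy.
  apply: fin E => //; first by apply/andP; split; lra.
  by rewrite !gtr0_norm ?subr_gt0//; lra.
- have [c /andP[xc cy] E] := mvt y x yab xab yx.
  apply: (fin x y c) => //; first by apply/andP; split; lra.
    by rewrite !ltr0_norm ?subr_lt0//; lra.
  by rewrite -opprB E; ring.
- by rewrite !subrr mul0r subrr normr0 expr0n /= mulr0.
Qed.

Lemma segment_bounded (f : R -> R) (a b : R) : a <= b ->
  (forall x, a <= x <= b -> {for x, continuous f}) ->
  exists2 M, 0 <= M & forall x, a <= x <= b -> `|f x| <= M.
Proof.
move=> ab cf.
have [|c cab Hc] := @EVT_max R (fun x => `|f x|) a b ab.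
  apply: continuous_in_subspaceT => x; rewrite inE/= in_itv/= => xab.
  by apply: cvg_norm; exact: cf.
by exists `|f c| => // x xab; apply: Hc; rewrite in_itv.
Qed.

Lemma smooth_taylor2 (I : set R) (f : R -> R) (a b M : R) : 0 <= M ->
  (forall x, a <= x <= b -> I x) -> smooth I f ->
  (forall x, a <= x <= b -> `|'D_1 ('D_1 f) x| <= M) ->
  forall x y, a <= x <= b -> a <= y <= b ->
    `|f y - f x - (y - x) * 'D_1 f x| <= M * `|y - x| ^+ 2.
Proof.
move=> M0 abI sf HM; have sf1 := smooth_derive (1 : R) sf.
have cont g : smooth I g -> {within `[a, b], continuous g}.
  move=> sg; apply: continuous_in_subspaceT => x; rewrite inE/= in_itv/= => /abI Ix.
  exact/differentiable_continuous/(smooth_diff sg).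
have oc x : a < x < b -> a <= x <= b by move=> /andP[h1 h2]; rewrite !ltW.
apply: taylor2 => //.
- exact: cont.
- by move=> x /oc/abI; exact: smooth_derive_is.
- apply: (@mvt_lipschitz _ ('D_1 ('D_1 f))); first exact: cont.
    by move=> x /oc/abI; exact: smooth_derive_is.
  by move=> x /oc; exact: HM.
Qed.

End Taylor.

Section Int01.
Context {R : realType}.
Local Notation mu := (@lebesgue_measure R).

Definition int01 (f : R -> R) : R := \int[mu]_(s in `[0, 1]) f s.
Definition cont01 (f : R -> R) := forall s : R, 0 <= s <= 1 -> {for s, continuous f}.

Lemma cont01_integrable f : cont01 f -> mu.-integrable `[0, 1] (EFin \o f).
Proof.
move=> cf; apply: continuous_compact_integrable; first exact: segment_compact.
by apply: continuous_in_subspaceT => x; rewrite inE/= in_itv/=; exact: cf.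
Qed.

Lemma int01D f g : cont01 f -> cont01 g -> int01 (fun s => f s + g s) = int01 f + int01 g.
Proof. by move=> cf cg; apply: RintegralD => //; exact: cont01_integrable. Qed.

Lemma int01Z c f : cont01 f -> int01 (fun s => c * f s) = c * int01 f.
Proof. by move=> cf; apply: RintegralZl => //; exact: cont01_integrable. Qed.

Lemma cont01D f g : cont01 f -> cont01 g -> cont01 (fun s => f s + g s).
Proof. by move=> cf cg s s01; exact: (continuousD (cf s s01) (cg s s01)). Qed.

Lemma cont01M f g : cont01 f -> cont01 g -> cont01 (fun s => f s * g s).
Proof. by move=> cf cg s s01; exact: (continuousM (cf s s01) (cg s s01)). Qed.

Lemma cont01_cst c : cont01 (fun=> c).
Proof. by move=> s _; exact: cvg_cst. Qed.

Lemma int01_le f C : cont01 f -> (forall s, 0 <= s <= 1 -> `|f s| <= C) -> `|int01 f| <= C.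
Proof.
move=> cf fC.
have If := cont01_integrable cf.
apply: (le_trans (le_normr_Rintegral _ If)) => //.
have -> : C = \int[mu]_(s in `[0, 1]) C.
  by rewrite Rintegral_cst//= lebesgue_measure_itv/= lte_fin ltr01 oppr0 addr0 mulr1.
have I1 : mu.-integrable `[0, 1] (EFin \o (fun s => `|f s|)).
  by apply: cont01_integrable => s s01; apply: cvg_norm; exact: cf.
have I2 := cont01_integrable (@cont01_cst C).
by apply: (le_Rintegral _ I1 I2) => //= s; rewrite in_itv/=; exact: fC.
Qed.

Lemma int01_FTC (f F : R -> R) : cont01 f ->
  (forall s : R, 0 <= s <= 1 -> is_derive s 1 F (f s)) -> int01 f = F 1 - F 0.
Proof.
move=> cf dF; rewrite /int01 /Rintegral (@continuous_FTC2 _ f F)//.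
- by apply: continuous_in_subspaceT => x; rewrite inE/= in_itv/=; exact: cf.
- have cF s : 0 <= s <= 1 -> {for s, continuous F}.
    by move=> s01; apply/differentiable_continuous/derivable1_diffP; case: (dF s s01).
  split.
  + by move=> x; rewrite in_itv/= => /andP[x0 x1]; case: (dF x) => //; apply/andP; split; exact: ltW.
  + by apply: cvg_at_right_filter; apply: cF; rewrite lexx ler01.
  + by apply: cvg_at_left_filter; apply: cF; rewrite lexx ler01.
- move=> x; rewrite in_itv/= => /andP[x0 x1]; rewrite derive1E.
  have x01 : 0 <= x <= 1 by rewrite !ltW.
  by have [_ ->] := dF x x01.
Qed.
End Int01.

Section SegmentAverage.
Context {R : realType}.
Implicit Types (k : R -> R) (p q w : 'rV[R]_2).

Definition row2 (a b : R) : 'rV[R]_2 := \row_j [:: a; b]`_j.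

(** Hadamard's integral. A derivative in the second coordinate produces a factor [s], so the family
    over all [m] is closed under differentiation. *)
Definition seg_avg m k p : R := int01 (fun s => s ^+ m * k (p 0 0 + s * p 0 1)).

(** Constraining the endpoints gives an open set at once, and an interval [I] then contains the
    whole segment. *)
Definition seg_in (I : set R) : set 'rV[R]_2 := [set p | I (p 0 0) /\ I (p 0 0 + p 0 1)].

Lemma open_seg_in (I : set R) : open I -> open (seg_in I).
Proof.
move=> oI; apply: openI.
  apply: (@open_comp _ _ (fun p : 'rV[R]_2 => p 0 0)) => // p _; exact: coord_continuous.
apply: (@open_comp _ _ (fun p : 'rV[R]_2 => p 0 0 + p 0 1)) => // p _.
by apply: continuousD; exact: coord_continuous.
Qed.

Lemma seg_between (a b s : R) : 0 <= s <= 1 ->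
  Num.min a (a + b) <= a + s * b <= Num.max a (a + b).
Proof.
move=> /andP[s0 s1]; rewrite ge_min le_max.
case: (leP 0 b) => b0; apply/andP; split; apply/orP.
- by left; nra.
- by right; nra.
- by right; nra.
- by left; nra.
Qed.

Context (I : set R) (oI : open I) (iI : is_interval I).

Lemma seg_inP p s : seg_in I p -> 0 <= s <= 1 -> I (p 0 0 + s * p 0 1).
Proof.
move=> [I0 I1] /(seg_between (p 0 0) (p 0 1)).
move=> H; apply: (iI _ _ H); first by rewrite /Num.min; case: ifP.
by rewrite /Num.max; case: ifP.
Qed.

Let cont_k k x : smooth I k -> I x -> {for x, continuous k}.
Proof. by move=> sk Ix; apply/differentiable_continuous/(smooth_diff sk). Qed.

Lemma cont01_seg m k p : smooth I k -> seg_in I p ->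
  cont01 (fun s => s ^+ m * k (p 0 0 + s * p 0 1)).
Proof.
move=> sk Wp; apply: cont01M; first by move=> s _; exact: exprn_continuous.
move=> s s01.
have ck := cont_k sk (seg_inP Wp s01).
have cl : {for s, continuous (fun s : R => p 0 0 + s * p 0 1)}.
  by apply: cvgD; [exact: cvg_cst|apply: cvgM; [exact: cvg_id|exact: cvg_cst]].
exact: (continuous_comp cl ck).
Qed.

(** Differentiation under the integral sign: the Taylor remainder of [k] is uniform on a compact
    segment slightly longer than the given one, and integrating it keeps it quadratic. *)
Lemma seg_avg_diff m k p : smooth I k -> seg_in I p ->
  is_diff p (seg_avg m k)
    (fun w => w 0 0 * seg_avg m ('D_1 k) p + w 0 1 * seg_avg m.+1 ('D_1 k) p).
Proof.
move=> sk Wp; have sk1 := smooth_derive (1 : R) sk; have sk2 := smooth_derive (1 : R) sk1.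
pose a := Num.min (p 0 0) (p 0 0 + p 0 1); pose b := Num.max (p 0 0) (p 0 0 + p 0 1).
have Ia : I a by rewrite /a /Num.min; case: ifP => _; case: Wp.
have Ib : I b by rewrite /b /Num.max; case: ifP => _; case: Wp.
have ab : a <= b by rewrite ge_min !le_max lexx.
have [da /= da0 Hda] : nbhs_ball a I by apply/nbhs_ballP/open_nbhs_nbhs.
have [db /= db0 Hdb] : nbhs_ball b I by apply/nbhs_ballP/open_nbhs_nbhs.
pose d := Num.min da db / 2.
have d0 : 0 < d by rewrite divr_gt0// lt_min da0.
have dda : d < da.
  by rewrite ltr_pdivrMr// (le_lt_trans (y := da))// ?ge_min ?lexx// mulr_natr mulr2n ltrDl.
have ddb : d < db.
  by rewrite ltr_pdivrMr// (le_lt_trans (y := db))// ?ge_min ?lexx ?orbT// mulr_natr mulr2n ltrDl.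
have Iad : I (a - d) by apply: Hda; rewrite -ball_normE /= opprB addrC subrK gtr0_norm.
have Ibd : I (b + d) by apply: Hdb; rewrite -ball_normE /= opprD addrA subrr sub0r normrN gtr0_norm.
have HI x : a - d <= x <= b + d -> I x by move=> H; exact: (iI Iad Ibd H).
have adbd : a - d <= b + d by lra.
have [M M0 HM] := segment_bounded adbd (fun x H => cont_k sk2 (HI x H)).
have T := smooth_taylor2 M0 HI sk HM.
(* The factor 4 is the square of 2: each point of the segment moves by at most the sum of the two
   coordinates of the displacement. *)
apply: (@is_diff_quadratic _ _ _ _ _ _ (M * 4)).
- by move=> c u v; rewrite !mxE /GRing.scale /=; ring.
- by apply: linear_row_continuous => c u v; rewrite !mxE /GRing.scale /=; ring.
have Wn : \forall q \near p, seg_in I q by apply: open_nbhs_nbhs; split=> //; exact: open_seg_in.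
have Bn : \forall q \near p, `|q - p| <= d / 2.
  apply/nbhs_ballP; exists (d / 2); first by rewrite /= divr_gt0.
  by move=> q; rewrite -ball_normE /= distrC => /ltW.
near=> q.
have Wq : seg_in I q by near: q.
have Bq : `|q - p| <= d / 2 by near: q.
have c0 := cont01_seg (m:=m) sk Wp.
have cq := cont01_seg (m:=m) sk Wq.
have c1 := cont01_seg (m:=m) sk1 Wp.
have c2 := cont01_seg (m:=m.+1) sk1 Wp.
pose w := q - p.
have w0 : q 0 0 = p 0 0 + w 0 0 by rewrite /w !mxE; ring.
have w1 : q 0 1 = p 0 1 + w 0 1 by rewrite /w !mxE; ring.
have cN c f : cont01 f -> cont01 (fun s : R => c * f s) by apply: cont01M; exact: cont01_cst.
have c12 := cont01D (cN (w 0 0) _ c1) (cN (w 0 1) _ c2).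
have -> : seg_avg m k q - seg_avg m k p
    - (w 0 0 * seg_avg m ('D_1 k) p + w 0 1 * seg_avg m.+1 ('D_1 k) p)
  = int01 (fun s => s ^+ m * k (q 0 0 + s * q 0 1) + (-1) * (s ^+ m * k (p 0 0 + s * p 0 1)
      + (w 0 0 * (s ^+ m * 'D_1 k (p 0 0 + s * p 0 1)) +
         w 0 1 * (s ^+ m.+1 * 'D_1 k (p 0 0 + s * p 0 1))))).
  rewrite (int01D cq (cN _ _ (cont01D c0 c12))).
  rewrite (int01Z _ (cont01D c0 c12)) (int01D c0 c12).
  rewrite (int01D (cN (w 0 0) _ c1) (cN (w 0 1) _ c2)) !int01Z//.
  by rewrite /seg_avg; ring.
apply: int01_le; first by apply: cont01D => //; apply/cN/cont01D.
move=> s s01.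
set x := p 0 0 + s * p 0 1; set y := q 0 0 + s * q 0 1.
have yx : y - x = w 0 0 + s * w 0 1 by rewrite /y /x w0 w1; ring.
have -> : s ^+ m * k y + -1 * (s ^+ m * k x + (w 0 0 * (s ^+ m * 'D_1 k x) + w 0 1 * (s ^+ m.+1 * 'D_1 k x)))
  = s ^+ m * (k y - k x - (y - x) * 'D_1 k x).
  by rewrite yx exprS; ring.
have /andP[s0 s1] := s01.
have sm1 : `|s ^+ m| <= 1 by rewrite ger0_norm ?exprn_ge0// exprn_ile1.
have n0 := coord_norm_le w 0; have n1 := coord_norm_le w 1.
have nyx : `|y - x| <= 2 * `|w|.
  rewrite yx (le_trans (ler_normD _ _))// mulr2n mulrDl mul1r lerD//.
  by rewrite normrM (ger0_norm s0) (le_trans _ n1)// ler_piMl.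
have xab : a <= x <= b by exact: seg_between.
have /andP[ax xb] := xab.
have nyxd : `|y - x| <= d by apply: (le_trans nyx); rewrite mulrC -ler_pdivlMr.
have H := T x y; rewrite normrM.
apply: (@le_trans _ _ (1 * (M * `|y - x| ^+ 2))).
  apply: ler_pM => //; apply: H; first by apply/andP; split; lra.
  by move: nyxd; rewrite ler_norml => /andP[h1 h2]; apply/andP; split; lra.
rewrite mul1r -mulrA ler_wpM2l//.
have -> : 4 * `|w| ^+ 2 = (2 * `|w|) ^+ 2 by rewrite exprMn; congr (_ * _); rewrite expr2; lra.
by rewrite ler_pXn2r ?nnegrE// mulr_ge0.
Unshelve. all: by end_near. Qed.

Lemma smooth_seg_avg m k : smooth I k -> smooth (seg_in I) (seg_avg m k).
Proof.
move=> sk j; elim: j m k sk => [|j IH] m k sk.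
  by split=> // p Wp; have [] := seg_avg_diff m sk Wp.
have oW := open_seg_in oI; have sk1 := smooth_derive (1 : R) sk.
apply: (@smSI R 'rV[R]_2 (seg_in I) oW j _
  (fun w p => w 0 0 * seg_avg m ('D_1 k) p + w 0 1 * seg_avg m.+1 ('D_1 k) p)).
- by move=> p Wp; have [] := seg_avg_diff m sk Wp.
- by move=> w p Wp; have [dJ E] := seg_avg_diff m sk Wp; rewrite deriveE// E.
- move=> w; apply: (smD oW); apply: (smM oW).
  + exact: (sm_cst oW).
  + exact: IH.
  + exact: (sm_cst oW).
  + exact: IH.
Qed.

(** Hadamard's lemma, by the fundamental theorem of calculus along the segment: the difference
    quotient extends smoothly to segments of length zero. *)
Lemma seg_avg_derive k p : smooth I k -> seg_in I p ->
  p 0 1 * seg_avg 0 ('D_1 k) p = k (p 0 0 + p 0 1) - k (p 0 0).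
Proof.
move=> sk Wp; have sk1 := smooth_derive (1 : R) sk.
have c1 := cont01_seg (m:=0) sk1 Wp.
rewrite /seg_avg -int01Z//.
have cN := cont01M (@cont01_cst _ (p 0 1)) c1.
have dF (s : R) : 0 <= s <= 1 -> is_derive s 1 (fun s : R => k (p 0 0 + s * p 0 1))
    (p 0 1 * (s ^+ 0 * 'D_1 k (p 0 0 + s * p 0 1))); last first.
  by have -> := int01_FTC cN dF; rewrite mul1r mul0r addr0.
move=> s01; have Is := seg_inP Wp s01.
rewrite expr0 mul1r.
have E : (fun s : R => p 0 0 + s * p 0 1) = cst (p 0 0) + (p 0 1 \*: id).
  by apply/funext => t; rewrite !fctE /= mulrC.
have da : is_derive s 1 (fun s : R => p 0 0 + s * p 0 1) (p 0 1).
  by rewrite E; apply: is_derive_eq; rewrite add0r [_ *: _]mulr1.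
have dk : is_derive (p 0 0 + s * p 0 1) 1 k ('D_1 k (p 0 0 + s * p 0 1)).
  exact: smooth_derive_is.
have := @is_derive1_comp R k (fun s : R => p 0 0 + s * p 0 1) s _ _ dk da.
by rewrite mulrC.
Qed.

End SegmentAverage.

(** * Extension of even functions *)

Section GeometricSums.
Context {R : realType}.
Implicit Types (u v : nat -> R) (C D c : R).

Definition gsum u : R := limn (series u).
Definition gdom (C : R) u := forall j, `|u j| <= C * 2^-1 ^+ j.

Let half1 : `|2^-1 : R| < 1.
Proof. by rewrite ger0_norm ?invr_ge0// invf_lt1 ?ltr1n. Qed.

Lemma gdom_cvg_norm C u : gdom C u -> cvgn [normed series u].
Proof.
move=> Cu; apply: (series_le_cvg _ _ Cu) => //.
- by move=> n; apply: le_trans (Cu n).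
- exact: is_cvg_geometric_series.
Qed.

Lemma gdom_cvg C u : gdom C u -> cvgn (series u).
Proof. by move=> /gdom_cvg_norm; apply: normed_cvg. Qed.

Lemma gsum_le C u : gdom C u -> `|gsum u| <= 2 * C.
Proof.
move=> Cu; have cu := gdom_cvg_norm Cu.
apply: (le_trans (lim_series_norm cu)).
have -> : 2 * C = limn (series (geometric C (2^-1 : R))).
  rewrite (cvg_lim _ (@cvg_geometric_series R C _ half1))//.
  have -> : (1 : R) - 2^-1 = 2^-1 by rewrite {1}[1]splitr mul1r addrK.
  by rewrite invrK mulrC.
by apply: lim_series_le => //; exact: is_cvg_geometric_series.
Qed.

Lemma gsumD C D u v : gdom C u -> gdom D v -> gsum (fun j => u j + v j) = gsum u + gsum v.
Proof. by move=> /gdom_cvg cu /gdom_cvg cv; exact: lim_seriesD. Qed.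

Lemma gsumZ C c u : gdom C u -> gsum (fun j => c * u j) = c * gsum u.
Proof. by move=> /gdom_cvg cu; exact: lim_seriesZ. Qed.

Lemma gdomD C D u v : gdom C u -> gdom D v -> gdom (C + D) (fun j => u j + v j).
Proof. by move=> cu cv j; apply: (le_trans (ler_normD _ _)); rewrite mulrDl lerD. Qed.

Lemma gdomZ C c u : gdom C u -> gdom (`|c| * C) (fun j => c * u j).
Proof. by move=> cu j; rewrite normrM -mulrA ler_wpM2l. Qed.

Lemma gdom_shift C u : gdom C u -> gdom C (fun j => u j.+1).
Proof.
move=> cu j; have C0 : 0 <= C by have := le_trans (normr_ge0 _) (cu 0%N); rewrite mulr1.
apply: (le_trans (cu _)); rewrite exprS mulrCA ler_piMl ?mulr_ge0// ?exprn_ge0// ?invr_ge0//.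
by rewrite invf_le1 ?ler1n.
Qed.

Lemma gsum_recl C u : gdom C u -> gsum u = u 0%N + gsum (fun j => u j.+1).
Proof.
move=> cu; have cs := gdom_cvg (gdom_shift cu).
have H : series u @ \oo --> u 0%N + gsum (fun j => u j.+1).
  rewrite -(cvg_shiftS (series u)).
  have -> : [sequence series u n.+1]_n = (fun n => u 0%N + series (fun j => u j.+1) n).
    by apply/funext => n; rewrite /series /= big_nat_recl.
  by apply: cvgD; [exact: cvg_cst|exact: cs].
exact: (cvg_lim _ H).
Qed.

Lemma gsum_ext u v : u =1 v -> gsum u = gsum v.
Proof. by move=> /funext ->. Qed.

(* [wgt] is the sequence of weights of the identity
   sum_(k in Z) (-1)^k 16^(- k (k - 1) / 2) (16^k)^n = 0,
   in which the terms of index k and 2 n + 1 - k cancel; the terms of index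
   k = j + 1 and k = - j carry the weights [wgt j] and [- wgt j]. *)
Definition wgt (j : nat) : R := (-1) ^+ j.+1 * 16^-1 ^+ 'C(j.+1, 2).

Let up n j := wgt j * 16 ^+ (j.+1 * n).
Let dn n j := - wgt j * 16^-1 ^+ (j * n).

Let i16 : (16 : R) * 16^-1 = 1. Proof. by rewrite mulfV. Qed.

Let expi (m n : nat) : (n <= m)%N -> 16^-1 ^+ m * 16 ^+ n = (16^-1 : R) ^+ (m - n).
Proof.
by move=> nm; rewrite -{1}(subnK nm) exprD -mulrA -exprMn mulVf// expr1n mulr1.
Qed.

Lemma wgtS j : wgt j.+1 = - 16^-1 ^+ j.+1 * wgt j.
Proof. by rewrite /wgt binS bin1 exprS exprD; ring. Qed.

Lemma norm_wgt j : `|wgt j| = 16^-1 ^+ 'C(j.+1, 2).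
Proof. by rewrite normrM normrX normrN1 expr1n mul1r ger0_norm// exprn_ge0// invr_ge0. Qed.

Let le_half n : (16^-1 : R) ^+ n <= 2^-1 ^+ n.
Proof. by apply: lerXn2r; rewrite ?nnegrE ?invr_ge0// lef_pV2 ?posrE// ler_nat. Qed.

(** The weights decay like 16 to a quadratic power of [j], which beats the growth 16^((j + 1) n)
    once j >= 2 n + 2; the finitely many earlier terms are covered by the large constant. *)
Let up_dom n : exists C, gdom C (up n).
Proof.
exists (16 ^+ ((2 * n + 3) * n.+1)) => j; rewrite normrM norm_wgt (ger0_norm (x := 16 ^+ _)) ?exprn_ge0//.
apply: (@le_trans _ _ (16 ^+ ((2 * n + 3) * n.+1) * 16^-1 ^+ j)); last first.
  by rewrite ler_wpM2l ?exprn_ge0//.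
have [H|H] := leqP (2 * n + 2) j.
  have H2 : (j.+1 * n + j <= 'C(j.+1, 2))%N.
    have : (2 * 'C(j.+1, 2) = j.+1 * j)%N.
      by have := mul_bin_diag j.+1 1; rewrite bin1.
    nia.
  rewrite expi; last by apply: leq_trans H2; rewrite leq_addr.
  apply: (@le_trans _ _ (16^-1 ^+ j)).
    by apply: ler_wiXn2l; rewrite ?invr_ge0 ?invf_le1 ?ler1n//; lia.
  by rewrite ler_peMl ?exprn_ge0 ?invr_ge0// exprn_ege1// ler1n.
apply: (@le_trans _ _ (1 * 16 ^+ (j.+1 * n))).
  by rewrite ler_wpM2r ?exprn_ge0// exprn_ile1 ?invr_ge0 ?invf_le1 ?ler1n.
rewrite mul1r.
have E : (16:R) ^+ ((2 * n + 3) * n.+1) * 16^-1 ^+ j = 16 ^+ ((2 * n + 3) * n.+1 - j).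
  have jl : (j <= (2 * n + 3) * n.+1)%N by nia.
  by rewrite -{1}(subnK jl) exprD -mulrA -exprMn mulfV// expr1n mulr1.
rewrite E ler_weXn2l ?ler1n//; nia.
Qed.

Let wgt_le j : `|wgt j| <= 16^-1 ^+ j.
Proof.
rewrite norm_wgt; apply: ler_wiXn2l; rewrite ?invr_ge0 ?invf_le1 ?ler1n//.
have : (2 * 'C(j.+1, 2) = j.+1 * j)%N by have := mul_bin_diag j.+1 1; rewrite bin1.
by case: j => // j; nia.
Qed.

Let dn_dom n : gdom 1 (dn n).
Proof.
move=> j; rewrite mul1r normrM normrN (ger0_norm (x := _ ^+ (j * n))) ?exprn_ge0 ?invr_ge0//.
apply: (@le_trans _ _ (`|wgt j| * 1)).
  by rewrite ler_wpM2l// exprn_ile1 ?invr_ge0 ?invf_le1 ?ler1n.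
by rewrite mulr1 (le_trans (wgt_le j)).
Qed.

(** Shifting the index of the two-sided sum by one turns exponent n into n + 1 up to the factor
    [- 16 ^+ n.+1], and carries the term [dn n 0] over to [up n.+1 0]. So every sum is a multiple of
    the one of exponent 0, in which the two halves cancel term by term. *)
Let total n : gsum (up n) + gsum (dn n) = 0.
Proof.
elim: n => [|n IH].
  have [C uC] := up_dom 0; rewrite -(gsumD uC (dn_dom 0)).
  rewrite (@gsum_ext _ (fun j => 0 * dn 0 j)); last first.
    by move=> j; rewrite /up /dn !muln0 !expr0; ring.
  by rewrite (gsumZ _ (dn_dom 0)) mul0r.
have [C uC] := up_dom n; have [C' uC'] := up_dom n.+1.
rewrite (gsum_recl uC').
have -> : gsum (fun j => up n.+1 j.+1) = - 16 ^+ n.+1 * gsum (up n).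
  rewrite -(gsumZ _ uC); apply: gsum_ext => j; rewrite /up wgtS.
  have -> : (j.+2 * n.+1 = j.+1 + (n.+1 + j.+1 * n))%N by lia.
  rewrite (exprD _ j.+1) (exprD _ n.+1); set x := 16 ^+ (j.+1 * n).
  transitivity (- ((16 * 16^-1) ^+ j.+1 * 16 ^+ n.+1 * (wgt j * x))).
    by rewrite exprMn; ring.
  by rewrite i16 expr1n; ring.
have -> : gsum (dn n.+1) = - 16 ^+ n.+1 * gsum (fun j => dn n j.+1).
  rewrite -(gsumZ _ (gdom_shift (dn_dom n))); apply: gsum_ext => j; rewrite /dn wgtS.
  have E : (n.+1 + j * n.+1 = j.+1 + j.+1 * n)%N by lia.
  transitivity (- wgt j * ((16 * 16^-1) ^+ n.+1 * 16^-1 ^+ (j * n.+1))).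
    by rewrite i16 expr1n mul1r.
  rewrite exprMn -mulrA -(exprD _ n.+1) E (exprD _ j.+1); ring.
have -> : up n.+1 0 = - 16 ^+ n.+1 * dn n 0.
  by rewrite /up /dn /wgt bin_small// !mul1n !mul0n !expr0; ring.
transitivity (- 16 ^+ n.+1 * (gsum (up n) + gsum (dn n))); last by rewrite IH mulr0.
by rewrite (gsum_recl (dn_dom n)); ring.
Qed.

Let gdom_div C u (c : nat -> R) : gdom C u -> (forall j, 0 <= c j) ->
  gdom C (fun j => u j / (c j + 1)).
Proof.
move=> uC c0 j; apply: le_trans (uC j); rewrite normrM ler_piMr//.
by rewrite ger0_norm ?invr_ge0 ?addr_ge0// invf_le1 ?lerDr// ltr_wpDl.
Qed.

Let S n := gsum (fun j => up n j / (16 ^+ j.+1 + 1)) + gsum (fun j => dn n j / (16^-1 ^+ j + 1)).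

Let p16 j : (0 : R) <= 16 ^+ j.+1. Proof. by rewrite exprn_ge0. Qed.
Let p16V j : (0 : R) <= 16^-1 ^+ j. Proof. by rewrite exprn_ge0// invr_ge0. Qed.

Let SS n : S n.+1 = - S n.
Proof.
apply/eqP; rewrite -addr_eq0; apply/eqP; rewrite -[RHS](total n).
have [C uC] := up_dom n; have [C' uC'] := up_dom n.+1.
rewrite addrACA; congr (_ + _).
  rewrite -(gsumD (gdom_div uC' p16) (gdom_div uC p16)); apply: gsum_ext => j.
  have : (16 : R) ^+ j.+1 + 1 != 0 by rewrite lt0r_neq0// ltr_wpDl.
  rewrite /up mulnS (exprD _ j.+1); set x := 16 ^+ j.+1; set y := 16 ^+ _ => x0.
  by field.
rewrite -(gsumD (gdom_div (dn_dom n.+1) p16V) (gdom_div (dn_dom n) p16V)); apply: gsum_ext => j.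
have : (16^-1 : R) ^+ j + 1 != 0 by rewrite lt0r_neq0// ltr_wpDl.
rewrite /dn mulnS (exprD _ j); set x := 16^-1 ^+ j; set y := 16^-1 ^+ _ => x0.
by field.
Qed.

(** The base 16 makes the leading terms dominate: they add up to 1/2 - 1/17 = 15/34, while the tail
    is at most 2/16. *)
Let S0 : S 0 != 0.
Proof.
have [C uC] := up_dom 0.
have d1 := gdom_div uC p16; have d2 := gdom_div (dn_dom 0) p16V.
rewrite /S (gsum_recl d1) (gsum_recl d2) addrACA.
rewrite -(gsumD (gdom_shift d1) (gdom_shift d2)).
set r := gsum _.
have r8 : `|r| <= 2 * (16^-1).
  apply: gsum_le => j; rewrite /up /dn !muln0 !expr0 !mulr1 mulNr -mulrBr normrM.
  apply: (@le_trans _ _ (`|wgt j.+1| * 1)).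
    rewrite ler_wpM2l// ler_norml.
    have h1 : 0 <= ((16 : R) ^+ j.+2 + 1)^-1 <= 1.
      by rewrite invr_ge0 addr_ge0//= invf_le1 ?lerDr// ltr_wpDl.
    have h2 : 0 <= ((16^-1 : R) ^+ j.+1 + 1)^-1 <= 1.
      by rewrite invr_ge0 addr_ge0//= invf_le1 ?lerDr// ltr_wpDl.
    by move: h1 h2 => /andP[a1 a2] /andP[b1 b2]; apply/andP; split; lra.
  rewrite mulr1 (le_trans (wgt_le _))// exprS ler_wpM2l ?invr_ge0//.
have -> : up 0 0 / (16 ^+ 1 + 1) + dn 0 0 / (16^-1 ^+ 0 + 1) = 15 / 34.
  by rewrite /up /dn /wgt bin_small// !muln0 !expr0 !expr1; field.
apply/lt0r_neq0; move: r8; rewrite ler_norml => /andP[h _]; lra.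
Qed.

(* Dividing the weights of the vanishing sums by 16^k + 1 gives moments S n with
   S (n + 1) + S n = 0, hence S n = (-1)^n S 0. *)
Lemma reflection_weights : exists a l a' l' : nat -> R,
  [/\ forall j, 0 <= l j, forall j, 0 <= l' j,
      forall n, exists C, gdom C (fun j => a j * (- l j) ^+ n),
      forall n, exists C, gdom C (fun j => a' j * (- l' j) ^+ n) &
      forall n, gsum (fun j => a j * (- l j) ^+ n) + gsum (fun j => a' j * (- l' j) ^+ n) = 1].
Proof.
pose a j := (S 0)^-1 * (wgt j / (16 ^+ j.+1 + 1)).
pose a' j := (S 0)^-1 * (- wgt j / (16^-1 ^+ j + 1)).
have Ea n j : a j * (- 16 ^+ j.+1) ^+ n = ((-1) ^+ n / S 0) * (up n j / (16 ^+ j.+1 + 1)).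
  rewrite /a /up [(- (16 ^+ j.+1)) ^+ n]exprNn exprM; ring.
have Ea' n j : a' j * (- 16^-1 ^+ j) ^+ n = ((-1) ^+ n / S 0) * (dn n j / (16^-1 ^+ j + 1)).
  rewrite /a' /dn [(- (16^-1 ^+ j)) ^+ n]exprNn exprM; ring.
exists a, (fun j => 16 ^+ j.+1), a', (fun j => 16^-1 ^+ j); split=> //.
- move=> n; have [C uC] := up_dom n; exists (`|(-1) ^+ n / S 0| * C).
  by move=> j; rewrite Ea; exact: gdomZ (gdom_div uC p16) j.
- move=> n; exists (`|(-1) ^+ n / S 0| * 1).
  by move=> j; rewrite Ea'; exact: gdomZ (gdom_div (dn_dom n) p16V) j.
move=> n; have [C uC] := up_dom n.
rewrite (gsum_ext (Ea n)) (gsum_ext (Ea' n)) (gsumZ _ (gdom_div uC p16)).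
rewrite (gsumZ _ (gdom_div (dn_dom n) p16V)) -mulrDr -/(S n).
have -> : S n = (-1) ^+ n * S 0.
  elim: n {C uC} => [|n IH]; first by rewrite expr0 mul1r.
  by rewrite SS IH exprS; ring.
rewrite mulrACA mulrA -exprMn mulrNN mulr1 expr1n mul1r mulVf//.
Qed.
End GeometricSums.

(** * Smooth extension from a half-line by reflection *)

Section Chains.
Context {R : realType}.

Lemma is_derive_quadratic (f : R -> R) (x c C : R) :
  (\forall y \near x, `|f y - f x - (y - x) * c| <= C * `|y - x| ^+ 2) ->
  is_derive x 1 f c.
Proof.
move=> H.
have [df E] : is_diff x f (fun w : R => w * c).
  apply: (is_diff_quadratic (C := C)) => //.
    by move=> a u v; rewrite /GRing.scale /=; ring.
  by move=> w; apply: cvgM; [exact: cvg_id|exact: cvg_cst].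
split; first exact: diff_derivable.
by rewrite deriveE// E mul1r.
Qed.

Lemma is_derive_real (f : R -> R) (x c v : R) : is_derive x 1 f c ->
  differentiable f x /\ 'D_v f x = v * c.
Proof.
move=> [df <-]; have df' : differentiable f x by apply/derivable1_diffP.
by split=> //; rewrite deriveE// diff_real.
Qed.

Lemma smooth_chain (I : set R) (f : nat -> R -> R) : open I ->
  (forall n x, I x -> is_derive x 1 (f n) (f n.+1 x)) -> forall n, smooth I (f n).
Proof.
move=> oI H n k; elim: k n => [|k IH] n.
  by split=> // x /(H n)/(is_derive_real 1) [].
apply: (@smSI R R I oI k _ (fun v x => v * f n.+1 x)).
- by move=> x /(H n)/(is_derive_real 1) [].
- by move=> v x /(H n)/(is_derive_real v) [].
- by move=> v; apply: (smM oI) => //; exact: (sm_cst oI).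
Qed.

Section OneSided.
Context (g : nat -> R -> R).
Context (bg : forall n, exists M, forall y : R, 0 <= y -> `|g n y| <= M).
Context (dg : forall n (y : R), 0 < y -> is_derive y 1 (g n) (g n.+1 y)).
Context (cg : forall n : nat, continuous (g n)).

Let bg0 n : exists2 M, 0 <= M & forall y, 0 <= y -> `|g n y| <= M.
Proof.
by have [M HM] := bg n; exists M => //; apply: le_trans (HM 0 (lexx 0)).
Qed.

(** Derivatives are given only on the open half-line; continuity at [0] and the mean value theorem
    extend the estimate to the closed one, where it contains the right derivative at [0]. *)
Let T n : exists2 M, 0 <= M & forall x y, 0 <= x -> 0 <= y ->
  `|g n y - g n x - (y - x) * g n.+1 x| <= M * `|y - x| ^+ 2.
Proof.
have [M M0 HM] := bg0 n.+2; exists M => // x y x0 y0.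
have xA : 0 <= x <= Num.max x y by rewrite x0 le_max lexx.
have yA : 0 <= y <= Num.max x y by rewrite y0 le_max lexx orbT.
apply: (@taylor2 R (g n) (g n.+1) 0 (Num.max x y) M) => //.
- exact: continuous_subspaceT.
- by move=> z /andP[z0 _]; exact: dg.
apply: (@mvt_lipschitz _ _ (g n.+2)).
- exact: continuous_subspaceT.
- by move=> z /andP[z0 _]; exact: dg.
- by move=> z /andP[z0 _]; apply: HM; exact: ltW.
Qed.

Section Side.
Context (a l : nat -> R) (l0 : forall j, 0 <= l j).
Context (al : forall n, exists C, gdom C (fun j => a j * (- l j) ^+ n)).

(** The n-th derivative of the reflected series, taken term by term. *)
Let F n z := gsum (fun j => a j * (- l j) ^+ n * g n (l j * - z)).

Let y0 j z : z <= 0 -> 0 <= l j * - z.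
Proof. by move=> z0; rewrite mulr_ge0// oppr_ge0. Qed.

Let domF n m : exists C, forall z, z <= 0 -> gdom C (fun j => a j * (- l j) ^+ n * g m (l j * - z)).
Proof.
have [C aC] := al n; have [M M0 HM] := bg0 m.
exists (C * M) => z z0 j; rewrite normrM mulrAC.
by apply: ler_pM => //; apply: HM; exact: y0.
Qed.

(** Taylor's estimate for each term, summed. Rescaling by [l j] brings a factor (l j)^2 into the
    quadratic remainder; it is absorbed by the domination of the weights at exponent [n.+2]. *)
Lemma reflected_taylor n : exists K, forall z w, z <= 0 -> w <= 0 ->
  `|F n w - F n z - (w - z) * F n.+1 z| <= K * `|w - z| ^+ 2.
Proof.
have [C0 dom0] := domF n n; have [C1 dom1] := domF n.+1 n.+1.
have [C aC] := al n.+2; have [M M0 HM] := T n.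
exists (2 * (M * C)) => z w z0 w0.
have -> : F n w - F n z - (w - z) * F n.+1 z =
  gsum (fun j => a j * (- l j) ^+ n * g n (l j * - w) +
    ((-1) * (a j * (- l j) ^+ n * g n (l j * - z)) +
     - (w - z) * (a j * (- l j) ^+ n.+1 * g n.+1 (l j * - z)))).
  rewrite (gsumD (dom0 w w0) (gdomD (gdomZ _ (dom0 z z0)) (gdomZ _ (dom1 z z0)))).
  rewrite (gsumD (gdomZ _ (dom0 z z0)) (gdomZ _ (dom1 z z0))).
  rewrite (gsumZ _ (dom0 z z0)) (gsumZ _ (dom1 z z0)) /F; ring.
rewrite -mulrA; apply: gsum_le => j.
set x := l j * - z; set y := l j * - w.
have -> : a j * (- l j) ^+ n * g n y + (-1 * (a j * (- l j) ^+ n * g n x) +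
    - (w - z) * (a j * (- l j) ^+ n.+1 * g n.+1 x))
  = a j * (- l j) ^+ n * (g n y - g n x - (y - x) * g n.+1 x).
  by rewrite exprS /x /y; ring.
have H := HM x y (y0 _ z0) (y0 _ w0).
rewrite normrM; apply: (le_trans (ler_wpM2l (normr_ge0 _) H)).
have -> : `|y - x| ^+ 2 = `|(- l j) ^+ 2| * `|w - z| ^+ 2.
  by rewrite normrX -exprMn -normrM; congr (`|_| ^+ 2); rewrite /x /y; ring.
have := aC j; rewrite -[n.+2]addn2 exprD mulrA normrM => H2.
have -> : `|a j * (- l j) ^+ n| * (M * (`|(- l j) ^+ 2| * `|w - z| ^+ 2))
  = M * `|w - z| ^+ 2 * (`|a j * (- l j) ^+ n| * `|(- l j) ^+ 2|) by ring.
have -> : M * C * `|w - z| ^+ 2 * 2^-1 ^+ j = M * `|w - z| ^+ 2 * (C * 2^-1 ^+ j) by ring.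
by rewrite ler_wpM2l// mulr_ge0// exprn_ge0.
Qed.

Lemma reflected0 n : F n 0 = gsum (fun j => a j * (- l j) ^+ n) * g n 0.
Proof.
have [C aC] := al n; rewrite mulrC -(gsumZ _ aC); apply: gsum_ext => j.
by rewrite oppr0 mulr0 mulrC.
Qed.
End Side.

(** All moments of the weights are 1, so the two sides agree at [0] at every order. Each side has a
    quadratic Taylor estimate up to [0], so the glued functions are successive derivatives of one
    another on the whole line. *)
Lemma onesided_extension : exists2 E : R -> R, smooth setT E & forall z, 0 <= z -> E z = g 0 z.
Proof.
have [a [l [a' [l' [l0 l0' al al' mom]]]]] := reflection_weights (R := R).
pose F n z := gsum (fun j => a j * (- l j) ^+ n * g n (l j * - z)).
pose F' n z := gsum (fun j => a' j * (- l' j) ^+ n * g n (l' j * - z)).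
pose E n z := if 0 <= z then g n z else F n z + F' n z.
exists (E 0%N); last by move=> z z0; rewrite /E z0.
apply: (@smooth_chain setT E openT) => n z _.
have Epos m x : 0 <= x -> E m x = g m x by rewrite /E => ->.
have Eneg m x : x <= 0 -> E m x = F m x + F' m x.
  rewrite /E; case: ifP => // x0 x0'.
  have -> : x = 0 by apply/le_anti; rewrite x0 x0'.
  by rewrite /F /F' (reflected0 al) (reflected0 al') -mulrDl mom mul1r.
have [M M0 HM] := T n.
have [K HK] := reflected_taylor l0 al n; have [K' HK'] := reflected_taylor l0' al' n.
have pos x y : 0 <= x -> 0 <= y -> `|E n y - E n x - (y - x) * E n.+1 x| <= (M + `|K + K'|) * `|y - x| ^+ 2.
  move=> x0 y0; rewrite !Epos//; apply: (le_trans (HM x y x0 y0)).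
  by rewrite ler_wpM2r ?exprn_ge0// lerDl.
have neg x y : x <= 0 -> y <= 0 -> `|E n y - E n x - (y - x) * E n.+1 x| <= (M + `|K + K'|) * `|y - x| ^+ 2.
  move=> x0 y0; rewrite !Eneg//.
  have -> : F n y + F' n y - (F n x + F' n x) - (y - x) * (F n.+1 x + F' n.+1 x)
    = (F n y - F n x - (y - x) * F n.+1 x) + (F' n y - F' n x - (y - x) * F' n.+1 x) by ring.
  apply: (le_trans (ler_normD _ _)); apply: (le_trans (lerD (HK x y x0 y0) (HK' x y x0 y0))).
  rewrite -mulrDl ler_wpM2r ?exprn_ge0//.
  by rewrite (le_trans (ler_norm _))// lerDr.
apply: (@is_derive_quadratic _ _ _ (M + `|K + K'|)).
case: (ltgtP z 0) => [z0|z0|->].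
- near=> y; apply: neg; first exact: ltW.
  by apply: ltW; near: y; exact: lt_nbhsl.
- near=> y; apply: pos; first exact: ltW.
  by apply: ltW; near: y; exact: lt_nbhsr.
- near=> y; have [y0|y0] := boolP (0 <= y); first exact: pos.
  by apply: neg => //; apply/ltW; rewrite ltNge.
Unshelve. all: by end_near. Qed.
End OneSided.

End Chains.

(** * Functions on the line with bounded derivatives *)

Section BoundedSmooth.
Context {R : realType}.
Implicit Types f g h : R -> R.

(* All derivatives of order at most [k] are bounded on the whole line, as the
   reflection series samples its argument at unboundedly large points. *)
Fixpoint bsm k f : Prop :=
  [/\ exists M, forall x, `|f x| <= M, forall x : R, derivable f x 1 &
    if k is k'.+1 then bsm k' ('D_1 f) else True].

Lemma bsmI k f (f' : R -> R) : (exists M, forall x, `|f x| <= M) ->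
  (forall x : R, is_derive x 1 f (f' x)) -> bsm k f' -> bsm k.+1 f.
Proof.
move=> bf df bf'; split; [by []|by move=> x; case: (df x)|].
by have -> : 'D_1 f = f' by apply/funext => x; case: (df x).
Qed.

Lemma bsmS k f : bsm k.+1 f -> bsm k f.
Proof.
elim: k f => [|k IH] f [b d H]; first by split.
by split=> //; exact: IH.
Qed.

Lemma bsm_is_derive k f (x : R) : bsm k f -> is_derive x 1 f ('D_1 f x).
Proof. by case: k => [|k] [_ d _]; exact: derivableP. Qed.

Lemma bsm_smooth f : (forall k, bsm k f) -> smooth setT f.
Proof.
move=> bf k; have := bf k; elim: k f {bf} => [|k IH] f bf.
  by split=> // x _; have [] := is_derive_real 1 (bsm_is_derive x bf).
apply: (@smSI R R setT openT k _ (fun v x => v * 'D_1 f x)).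
- by move=> x _; have [] := is_derive_real 1 (bsm_is_derive x bf).
- by move=> v x _; have [] := is_derive_real v (bsm_is_derive x bf).
- by move=> v; apply: (smM openT); [exact: (sm_cst openT)|apply: IH; case: bf].
Qed.

Lemma bsmD k f g : bsm k f -> bsm k g -> bsm k (fun x => f x + g x).
Proof.
have bd f1 g1 : (exists M, forall x, `|f1 x| <= M) -> (exists M, forall x, `|g1 x| <= M) ->
    exists M, forall x : R, `|f1 x + g1 x| <= M.
  move=> [M HM] [N HN]; exists (M + N) => x.
  by apply: (le_trans (ler_normD _ _)); exact: lerD.
elim: k f g => [|k IH] f g bf bg; have [b1 d1 D1] := bf; have [b2 d2 D2] := bg.
  by split=> [||//]; [exact: bd|move=> x; exact: derivableD].
apply: (bsmI (bd _ _ b1 b2) _ (IH _ _ D1 D2)) => x.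
exact: (is_deriveD (bsm_is_derive x bf) (bsm_is_derive x bg)).
Qed.

Lemma bsmM k f g : bsm k f -> bsm k g -> bsm k (fun x => f x * g x).
Proof.
have bd f1 g1 : (exists M, forall x, `|f1 x| <= M) -> (exists M, forall x, `|g1 x| <= M) ->
    exists M, forall x : R, `|f1 x * g1 x| <= M.
  move=> [M HM] [N HN]; exists (M * N) => x.
  by rewrite normrM; apply: ler_pM.
elim: k f g => [|k IH] f g bf bg; have [b1 d1 D1] := bf; have [b2 d2 D2] := bg.
  by split=> [||//]; [exact: bd|move=> x; exact: derivableM].
apply: (bsmI (bd _ _ b1 b2) _ (bsmD (IH _ _ (bsmS bf) D2) (IH _ _ (bsmS bg) D1))) => x.
exact: (is_deriveM (bsm_is_derive x bf) (bsm_is_derive x bg)).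
Qed.

Lemma bsm_cst k (c : R) : bsm k (fun=> c).
Proof.
have b (d : R) : exists M, forall x : R, `|(fun=> d) x| <= M by exists `|d|.
elim: k c => [|k IH] c; first by split=> // x; exact: derivable_cst.
by apply: (bsmI (b c) _ (IH 0)) => x; exact: is_derive_cst.
Qed.

Definition squash (v : R) := v / Num.sqrt (1 + v ^+ 2).
Definition isqrt1 (v : R) := (Num.sqrt (1 + v ^+ 2))^-1.

Lemma sqrt1_gt0 (v : R) : 0 < Num.sqrt (1 + v ^+ 2).
Proof. by rewrite sqrtr_gt0 ltr_wpDr// sqr_ge0. Qed.

Lemma sqr_sqrt1 (v : R) : Num.sqrt (1 + v ^+ 2) ^+ 2 = 1 + v ^+ 2.
Proof. by rewrite sqr_sqrtr// addr_ge0// sqr_ge0. Qed.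

Lemma is_derive_sqrt1 (v : R) : is_derive v 1 (fun x : R => Num.sqrt (1 + x ^+ 2)) (squash v).
Proof.
have p : 0 < 1 + v ^+ 2 by rewrite ltr_wpDr// sqr_ge0.
have d1 : is_derive v 1 (fun x : R => 1 + x ^+ 2) (2 * v).
  apply: (@is_derive_quadratic _ _ _ _ 1); near=> y; rewrite mul1r real_normK ?num_real//.
  have -> : 1 + y ^+ 2 - (1 + v ^+ 2) - (y - v) * (2 * v) = (y - v) ^+ 2 by ring.
  by rewrite ger0_norm// sqr_ge0.
have H := is_derive1_comp (f := Num.sqrt) (g := fun x : R => 1 + x ^+ 2) (is_derive1_sqrt p) d1.
suff E : (2 * Num.sqrt (1 + v ^+ 2))^-1 * (2 * v) = squash v by rewrite -E; exact: H.
rewrite /squash; have := lt0r_neq0 (sqrt1_gt0 v) => ?; by field.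
Unshelve. all: by end_near. Qed.

Lemma is_derive_inv f (x c : R) : f x != 0 -> is_derive x 1 f c ->
  is_derive x 1 (fun y => (f y)^-1) (- c / f x ^+ 2).
Proof.
move=> fx0 [df <-]; split; first exact: derivableV.
by rewrite (deriveV fx0 df) /GRing.scale /= mulNr mulrC mulNr.
Qed.

Lemma is_derive_isqrt1 (v : R) : is_derive v 1 isqrt1 (- (squash v * (isqrt1 v * isqrt1 v))).
Proof.
have s0 := lt0r_neq0 (sqrt1_gt0 v).
have H := is_derive_inv (f := fun x : R => Num.sqrt (1 + x ^+ 2)) s0 (is_derive_sqrt1 v).
suff E : - squash v / Num.sqrt (1 + v ^+ 2) ^+ 2 = - (squash v * (isqrt1 v * isqrt1 v)) by rewrite -E; exact: H.
by rewrite /isqrt1; move: (squash v) => q; move: (Num.sqrt _) s0 {H} => s s0; field.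
Qed.

Lemma is_derive_squash (v : R) : is_derive v 1 squash (isqrt1 v * (isqrt1 v * isqrt1 v)).
Proof.
have s0 := lt0r_neq0 (sqrt1_gt0 v).
have H := is_deriveM (is_derive_id v (1 : R)) (is_derive_isqrt1 v).
suff E : v *: (- (squash v * (isqrt1 v * isqrt1 v))) + isqrt1 v *: (1 : R) =
    isqrt1 v * (isqrt1 v * isqrt1 v) by rewrite -E; exact: H.
rewrite /GRing.scale /= /squash /isqrt1 {H}.
have := sqr_sqrt1 v; move: s0; move: (Num.sqrt _) => s s0 E.
have -> : s^-1 * (s^-1 * s^-1) = s^-1 ^+ 3 by ring.
apply: (@mulfI _ (s ^+ 3)); first by rewrite expf_neq0.
rewrite -exprMn mulfV// expr1n.
transitivity (s ^+ 2 - v ^+ 2); last by rewrite E; ring.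
by field.
Qed.

Lemma squash_lt1 v : `|squash v| < 1.
Proof.
rewrite normrM (ger0_norm (x := _^-1)) ?invr_ge0 ?sqrtr_ge0//.
rewrite ltr_pdivrMr ?sqrt1_gt0// mul1r -(@ltr_pXn2r _ 2) ?nnegrE ?sqrtr_ge0//.
by rewrite sqr_sqrt1 real_normK ?num_real// ltrDr.
Qed.

(** The derivatives of [squash] and [isqrt1] are polynomials in these two bounded functions, so
    boundedness passes to all orders by a joint induction. *)
Lemma bsm_squash k : bsm k squash /\ bsm k isqrt1.
Proof.
have b1 : exists M, forall x, `|squash x| <= M by exists 1 => x; exact/ltW/squash_lt1.
have b2 : exists M, forall x, `|isqrt1 x| <= M.
  exists 1 => x; rewrite ger0_norm ?invr_ge0 ?sqrtr_ge0//.
  rewrite invf_le1 ?sqrt1_gt0// -(@ler_pXn2r _ 2) ?nnegrE ?sqrtr_ge0//.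
  by rewrite sqr_sqrt1 expr1n lerDl sqr_ge0.
elim: k => [|k [IH1 IH2]].
  by split; split=> // x; [case: (is_derive_squash x)|case: (is_derive_isqrt1 x)].
split.
  by apply: (bsmI b1 is_derive_squash); apply: bsmM => //; exact: bsmM.
apply: (bsmI b2 is_derive_isqrt1).
have -> : (fun v => - (squash v * (isqrt1 v * isqrt1 v)))
   = (fun v => -1 * (squash v * (isqrt1 v * isqrt1 v))) by apply/funext => v; rewrite mulN1r.
by apply: bsmM; [exact: bsm_cst|apply: bsmM => //; exact: bsmM].
Qed.

(** The composite samples [h] and its derivatives only on the compact segment from - d to d, which
    lies inside the ball of radius [e]. *)
Lemma bsm_comp_squash (h : R -> R) (e d : R) : 0 <= d -> d < e -> smooth (ball 0 e) h ->
  forall k, bsm k (fun v => h (d * squash v)).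
Proof.
move=> d0 de.
have cb x : - d <= x <= d -> ball (0 : R) e x.
  by move=> H; rewrite -ball_normE /= sub0r normrN; apply: le_lt_trans de; rewrite ler_norml.
have dm : - d <= d by rewrite (le_trans _ d0)// oppr_le0.
have ins v : - d <= d * squash v <= d.
  by rewrite -ler_norml normrM (ger0_norm d0) ler_piMr// ltW ?squash_lt1.
have b g : smooth (ball 0 e) g -> exists M, forall v, `|g (d * squash v)| <= M.
  move=> sg; have [M _ HM] := segment_bounded dm (fun x Hx => differentiable_continuous (smooth_diff sg (cb x Hx))).
  by exists M => v; exact: HM.
have dd (v : R) : is_derive v 1 (fun v => d * squash v) (d * (isqrt1 v * (isqrt1 v * isqrt1 v))).
  exact: (is_deriveZ d (is_derive_squash v)).
have dh g (v : R) : smooth (ball 0 e) g -> is_derive v 1 (fun v => g (d * squash v))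
    ('D_1 g (d * squash v) * (d * (isqrt1 v * (isqrt1 v * isqrt1 v)))).
  move=> sg.
  have dg : is_derive (d * squash v) 1 g ('D_1 g (d * squash v)).
    by apply: smooth_derive_is sg _; exact/cb/ins.
  exact: (@is_derive1_comp R g (fun v : R => d * squash v) v _ _ dg (dd v)).
move=> sh k; elim: k h sh => [|k IH] h sh.
  by split; [exact: b|move=> x; case: (dh h x sh)|].
apply: (bsmI (b h sh) (dh h ^~ sh)); apply: bsmM; first exact: IH (smooth_derive (1 : R) sh).
have [_ bi] := bsm_squash k.
apply: bsmM; first exact: bsm_cst.
by apply: bsmM => //; exact: bsmM.
Qed.

Lemma row2_line v : row2 0 v = 0 + v *: delta_mx 0 1 :> 'rV[R]_2.
Proof.
apply/rowP => j; rewrite !mxE /=; case: j => -[|[|//]] /= i; first by rewrite mulr0 addr0.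
by rewrite mulr1 add0r.
Qed.

Lemma row2_0 (a b : R) : row2 a b 0 0 = a. Proof. by rewrite mxE. Qed.
Lemma row2_1 (a b : R) : row2 a b 0 1 = b. Proof. by rewrite mxE. Qed.

Lemma bsm_seg_avg f : (forall k, bsm k f) -> forall m k, bsm k (fun v => seg_avg m f (row2 0 v)).
Proof.
have iT : is_interval [set: R] by [].
have b m g : (forall k, bsm k g) -> exists M, forall v, `|seg_avg m g (row2 0 v)| <= M.
  move=> bg; have sg := bsm_smooth bg; have [[M HM] _ _] := bg 0%N; exists M => v.
  have cs := cont01_seg iT (m := m) sg (conj I I : seg_in setT (row2 0 v)).
  apply: (int01_le cs).
  move=> s /andP[s0 s1]; rewrite normrM.
  apply: (@le_trans _ _ (1 * `|g (row2 0 v 0 0 + s * row2 0 v 0 1)|)); last by rewrite mul1r.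
  by rewrite ler_wpM2r// ger0_norm ?exprn_ge0// exprn_ile1.
have dv m g (v : R) : (forall k, bsm k g) ->
    is_derive v 1 (fun v => seg_avg m g (row2 0 v)) (seg_avg m.+1 ('D_1 g) (row2 0 v)).
  move=> bg; have [dJ EJ] := seg_avg_diff openT iT m (bsm_smooth bg) (conj I I : seg_in setT (row2 0 v)).
  have -> : seg_avg m.+1 ('D_1 g) (row2 0 v) = 'D_(delta_mx 0 1) (seg_avg m g) (row2 0 v).
    by rewrite deriveE// EJ !mxE /= mul0r add0r mul1r.
  rewrite row2_line.
  have -> : (fun v => seg_avg m g (row2 0 v)) = (fun v => seg_avg m g (0 + v *: delta_mx 0 1)).
    by apply/funext => u; rewrite row2_line.
  apply: derivable_line; rewrite -row2_line; exact: diff_derivable.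
move=> bf m k; elim: k m f bf => [|k IH] m f bf.
  by split; [exact: b|move=> v; case: (dv m f v bf)|].
apply: (bsmI (b m f bf) (dv m f ^~ bf)); apply: IH => j; by have [_ _] := bf j.+1.
Qed.

End BoundedSmooth.

(** * Even functions as smooth functions of the square *)

Section EvenExtension.
Context {R : realType}.
Implicit Types f g h : R -> R.

Lemma is_derive_opp_arg f (x c : R) : is_derive (- x) 1 f c -> is_derive x 1 (fun y => f (- y)) (- c).
Proof.
move=> df; have dN : is_derive x (1 : R) (-%R : R -> R) (-1) by exact: is_deriveNid.
have := @is_derive1_comp R f (-%R) x _ _ df dN.
by rewrite mulrN1.
Qed.

Lemma derive_even h : (forall x, derivable h x 1) -> (forall x, h (- x) = h x) ->
  forall x, 'D_1 h (- x) = - 'D_1 h x.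
Proof.
move=> dh eh x.
have [_] := is_derive_opp_arg (derivableP (dh (- x))).
have -> : (fun y => h (- y)) = h by apply/funext => y; rewrite eh.
by move=> ->; rewrite opprK.
Qed.

Lemma derive_odd h : (forall x, derivable h x 1) -> (forall x, h (- x) = - h x) ->
  forall x, 'D_1 h (- x) = 'D_1 h x.
Proof.
move=> dh eh x.
have [_] := is_derive_opp_arg (derivableP (dh (- x))).
have -> : (fun y => h (- y)) = - h by apply/funext => y; rewrite eh.
by rewrite deriveN// => /oppr_inj.
Qed.

Lemma seg_avg_even m f (v : R) : (forall x, f (- x) = f x) ->
  seg_avg m f (row2 0 (- v)) = seg_avg m f (row2 0 v).
Proof.
move=> ef; rewrite /seg_avg; apply: eq_Rintegral => s _.
by rewrite !row2_0 !row2_1 !add0r mulrN ef.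
Qed.

(** The derivative with respect to v^2, namely h'(v) / (2 v), written as an average so that it makes
    sense at [0]; for even [h] the derivative vanishes there. *)
Definition even_quot h (v : R) := 2^-1 * seg_avg 0 ('D_1 ('D_1 h)) (row2 0 v).

Let bsm_even h := (forall k, bsm k h) /\ forall x, h (- x) = h x.

Let bsm_derivable h k x : bsm k h -> derivable h x 1.
Proof. by move=> /(bsm_is_derive x) []. Qed.

Let bsm_D h : (forall k, bsm k h) -> forall k, bsm k ('D_1 h).
Proof. by move=> bh k; have [] := bh k.+1. Qed.

Lemma even_quotP h : bsm_even h -> bsm_even (even_quot h) /\
  forall v, 'D_1 h v = 2 * v * even_quot h v.
Proof.
move=> [bh eh]; have b1 := bsm_D bh; have b2 := bsm_D b1.
have o1 := derive_even (fun x => bsm_derivable (x := x) (bh 0%N)) eh.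
have e2 := derive_odd (fun x => bsm_derivable (x := x) (b1 0%N)) o1.
have iT : is_interval [set: R] by [].
split; first split.
- move=> k; apply: bsmM; first exact: bsm_cst.
  exact: bsm_seg_avg.
- by move=> v; rewrite /even_quot (seg_avg_even 0 v e2).
move=> v; have := seg_avg_derive iT (bsm_smooth b1) (conj I I : seg_in setT (row2 0 v)).
have D0 : 'D_1 h 0 = 0.
  by have := o1 0; rewrite oppr0 => /eqP; rewrite -addr_eq0 -mulr2n mulrn_eq0 /= => /eqP.
rewrite row2_0 row2_1 add0r D0 subr0 => <-.
by rewrite /even_quot mulrACA mulfV ?mul1r.
Qed.

(** The iterates of [even_quot], evaluated at [Num.sqrt z], are the successive derivatives in z > 0:
    the factor 2 sqrt z of [even_quotP] cancels the derivative of the square root. They are bounded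
    and continuous up to [0], as the extension theorem requires. *)
Lemma even_extension_bounded h : (forall k, bsm k h) -> (forall x, h (- x) = h x) ->
  exists2 E : R -> R, smooth setT E & forall z, 0 <= z -> E z = h (Num.sqrt z).
Proof.
move=> bh eh.
pose hh n := iter n even_quot h.
have P n : bsm_even (hh n) by elim: n => [|n IH]; [split|exact: (even_quotP IH).1].
pose g n z := hh n (Num.sqrt z).
have [|||E sE HE] := @onesided_extension R g; last by exists E.
- move=> n; have [bn _] := P n; have [[M HM] _ _] := bn 0%N.
  by exists M => y _; exact: HM.
- move=> n y y0; have [bn _] := P n.
  have := @is_derive1_comp R (hh n) Num.sqrt y _ _ (bsm_is_derive (Num.sqrt y) (bn 0%N)) (is_derive1_sqrt y0).
  rewrite (even_quotP (P n)).2 -[even_quot _ _]/(g n.+1 y).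
  have s0 : Num.sqrt y != 0 by rewrite lt0r_neq0// sqrtr_gt0.
  by have -> : 2 * Num.sqrt y * g n.+1 y * (2 * Num.sqrt y)^-1 = g n.+1 y by field.
- move=> n y; have [bn _] := P n.
  apply: (@continuous_comp _ _ _ Num.sqrt (hh n)); first exact: sqrt_continuous.
  by apply/differentiable_continuous/derivable1_diffP; exact: (bsm_derivable (bn 0%N)).
Qed.

(* [d * squash v] maps the line into ]-d, d[ and its square is a rational
   function of v^2, so that it can be undone on the variable z = v^2. *)
Lemma even_extension h (e : R) : 0 < e -> smooth (ball 0 e) h ->
  (forall v, ball 0 e v -> h (- v) = h v) ->
  exists (H : R -> R) (d : R), [/\ 0 < d, d <= e, smooth (ball 0 (d ^+ 2)) H &
    forall v, `|v| < d -> H (v ^+ 2) = h v].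
Proof.
move=> e0 sh eh; pose d := e / 2.
have d0 : 0 < d by rewrite divr_gt0.
have de : d < e by rewrite ltr_pdivrMr// mulr_natr mulr2n ltrDl.
have d20 : 0 < d ^+ 2 by rewrite exprn_gt0.
have bk := bsm_comp_squash (ltW d0) de sh.
have sqN v : squash (- v) = - squash v by rewrite /squash sqrrN mulNr.
have inb v : ball 0 e (d * squash v).
  rewrite -ball_normE /= sub0r normrN normrM (gtr0_norm d0); apply: le_lt_trans de.
  by rewrite ler_piMr// ?ltW// squash_lt1.
have ek v : h (d * squash (- v)) = h (d * squash v) by rewrite sqN mulrN eh.
have [E sE HE] := even_extension_bounded bk ek.
have bP x : ball 0 (d ^+ 2) x -> 0 < d ^+ 2 - x.
  by rewrite -ball_normE /= sub0r normrN => /ltr_normlW; rewrite subr_gt0.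
have ob : open (ball (0:R) (d ^+ 2)) by exact: ball_open.
exists (E \o (fun z => z / (d ^+ 2 - z))), d; split=> //; first exact: ltW.
  apply: (smooth_comp1 ob (I := setT)) => //.
  apply: (smoothM ob); first exact: smooth_id.
  apply: (smoothV ob) => [x /bP|]; first exact: lt0r_neq0.
  by apply: (smoothB ob); [exact: (smooth_cst ob)|exact: smooth_id].
move=> v vd /=.
have q : 0 < d ^+ 2 - v ^+ 2.
  by rewrite subr_gt0 -[v ^+ 2]real_normK ?num_real// ltr_pXn2r// ?nnegrE ?ltW.
set t := v ^+ 2 / _; have t0 : 0 <= t by rewrite divr_ge0 ?sqr_ge0// ltW.
rewrite HE// /squash sqr_sqrtr//.
have E1 : 1 + t = d ^+ 2 / (d ^+ 2 - v ^+ 2) by rewrite /t; field; exact: lt0r_neq0.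
have -> : d * (Num.sqrt t / Num.sqrt (1 + t)) = `|v|.
  rewrite E1 /t (sqrtrM _ (sqr_ge0 v)) (sqrtrM _ (sqr_ge0 d)) !sqrtr_sqr (gtr0_norm d0).
  have := sqrtr_gt0 (d ^+ 2 - v ^+ 2)^-1; rewrite invr_gt0 q => /lt0r_neq0 s0.
  by field; rewrite s0 (lt0r_neq0 d0).
case: (ler0P v) => // v0.
by rewrite eh// -ball_normE /= sub0r normrN; apply: lt_trans de.
Qed.
End EvenExtension.

(** * Normal form of a ruled cross cap *)

Section Jets.
Context {R : realType}.
Implicit Types f g u : R -> R.

(** A relation instead of equations for ['D_1], so that the rules below carry the existence of the
    derivatives along with their values. *)
Definition jet2 f (a b c : R) := exists f' : R -> R,
  [/\ \forall x \near (0 : R), is_derive (x : R) 1 f (f' x), is_derive (0 : R) 1 f' c, f 0 = a & f' 0 = b].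

Lemma jet2_smooth e f : 0 < e -> smooth (ball 0 e) f -> jet2 f (f 0) ('D_1 f 0) ('D_1 ('D_1 f) 0).
Proof.
move=> e0 sf; exists ('D_1 f); split=> //.
  by near=> x; apply: smooth_derive_is sf _; near: x; exact: nbhsx_ballx.
by apply: smooth_derive_is (smooth_derive (1 : R) sf) _; exact: ballxx.
Unshelve. all: by end_near. Qed.

Lemma jet2_derive f a b c : jet2 f a b c -> f 0 = a /\ is_derive (0 : R) 1 f b.
Proof. by move=> [f' [df _ <- <-]]; split=> //; exact: nbhs_singleton df. Qed.

Lemma jet2_uniq f a b c a' b' c' : jet2 f a b c -> jet2 f a' b' c' -> [/\ a = a', b = b' & c = c'].
Proof.
move=> [f1 [df1 d1 <- <-]] [f2 [df2 d2 <- <-]].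
have E : \forall x \near (0 : R), f1 x = f2 x.
  by apply: filterS2 df1 df2 => x [_ <-] [_ <-].
split=> //; first exact: nbhs_singleton E.
have [_ <-] := d1; have [_ <-] := d2; exact: near_eq_derive.
Qed.

Lemma jet2_ext f g a b c : (\forall x \near (0 : R), f x = g x) -> jet2 f a b c -> jet2 g a b c.
Proof.
move=> fg [f' [df d <- <-]]; exists f'; split=> //; last by rewrite (nbhs_singleton fg).
apply: filterS2 (near_join fg) df => x Hx df.
exact: near_eq_is_derive df.
Qed.

Lemma jet2_cst (c : R) : jet2 (fun=> c) c 0 0.
Proof.
exists (fun=> 0); split=> //; last exact: is_derive_cst.
by near=> x; exact: is_derive_cst.
Unshelve. all: by end_near. Qed.

Lemma jet2_id : jet2 (fun x => x) 0 1 0.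
Proof.
exists (fun=> 1); split=> //; last exact: is_derive_cst.
by near=> x; exact: is_derive_id.
Unshelve. all: by end_near. Qed.

Lemma jet2D f g a b c a' b' c' : jet2 f a b c -> jet2 g a' b' c' ->
  jet2 (fun x => f x + g x) (a + a') (b + b') (c + c').
Proof.
move=> [f1 [df d1 <- <-]] [g1 [dg d2 <- <-]]; exists (fun x => f1 x + g1 x); split=> //.
  by apply: filterS2 df dg => x df dg; exact: is_deriveD.
exact: is_deriveD.
Qed.

Lemma is_derive_mul f g (x a b : R) : is_derive x 1 f a -> is_derive x 1 g b ->
  is_derive x 1 (fun x => f x * g x) (a * g x + f x * b).
Proof.
move=> df dg; have := is_deriveM df dg.
by rewrite /GRing.scale /= addrC [g x * a]mulrC.
Qed.

Lemma jet2M f g a b c a' b' c' : jet2 f a b c -> jet2 g a' b' c' ->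
  jet2 (fun x => f x * g x) (a * a') (b * a' + a * b') (c * a' + 2 * b * b' + a * c').
Proof.
move=> [f1 [df d1 <- <-]] [g1 [dg d2 <- <-]]; exists (fun x => f1 x * g x + f x * g1 x); split=> //.
  by apply: filterS2 df dg => x df dg; exact: is_derive_mul.
have H1 := is_derive_mul d1 (nbhs_singleton dg); have H2 := is_derive_mul (nbhs_singleton df) d2.
have -> : c * g 0 + 2 * f1 0 * g1 0 + f 0 * c' = (c * g 0 + f1 0 * g1 0) + (f1 0 * g1 0 + f 0 * c') by ring.
exact: (is_deriveD H1 H2).
Qed.

Lemma is_derive_comp f u (x a b : R) : is_derive (u x) 1 f a -> is_derive x 1 u b ->
  is_derive x 1 (fun x => f (u x)) (a * b).
Proof. by move=> df du; exact: (@is_derive1_comp R f u x a b). Qed.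

Lemma jet2_comp f u a b c b' c' : jet2 f a b c -> jet2 u 0 b' c' ->
  jet2 (fun x => f (u x)) a (b * b') (c * b' ^+ 2 + b * c').
Proof.
move=> [f1 [df d1 <- <-]] [u1 [du d2 u0 <-]]; exists (fun x => f1 (u x) * u1 x); split=> //; rewrite ?u0//.
  have cu : {for 0, continuous u}.
    by apply/differentiable_continuous/derivable1_diffP; case: (nbhs_singleton du).
  have dfu : \forall x \near (0 : R), is_derive (u x) 1 f (f1 (u x)).
    by move: df; rewrite -{1}u0 => /cu.
  by apply: filterS2 dfu du => x h1 h2; exact: is_derive_comp.
have d1' : is_derive (u 0) 1 f1 c by rewrite u0.
have := is_derive_mul (is_derive_comp d1' (nbhs_singleton du)) d2.
by rewrite u0 expr2 mulrA.
Qed.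

Lemma jet2V f a b c : a != 0 -> jet2 f a b c ->
  jet2 (fun x => (f x)^-1) a^-1 (- b / a ^+ 2) (2 * b ^+ 2 / a ^+ 3 - c / a ^+ 2).
Proof.
move=> a0 [f1 [df d1 fa <-]]; exists (fun x => - f1 x * ((f x)^-1 * (f x)^-1)).
have f0 : f 0 != 0 by rewrite fa.
have cf : {for 0, continuous f}.
  by apply/differentiable_continuous/derivable1_diffP; case: (nbhs_singleton df).
have nf : \forall x \near (0 : R), f x != 0 by exact: (cvgr_neq0 _ cf).
have inv (x : R) : f x != 0 -> is_derive x 1 f (f1 x) ->
    is_derive x 1 (fun x => (f x)^-1) (- f1 x * ((f x)^-1 * (f x)^-1)).
  move=> fx0 dfx; have := is_derive_inv fx0 dfx.
  by have -> : - f1 x / f x ^+ 2 = - f1 x * ((f x)^-1 * (f x)^-1) by field.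
split; rewrite ?fa//.
- by apply: filterS2 nf df => x; exact: inv.
- have di := inv 0 f0 (nbhs_singleton df).
  have := is_derive_mul (is_deriveN d1) (is_derive_mul di di).
  rewrite !fctE fa.
  by have -> : - c * (a^-1 * a^-1) + - f1 0 * (- f1 0 * (a^-1 * a^-1) / a + a^-1 * (- f1 0 * (a^-1 * a^-1)))
    = 2 * f1 0 ^+ 2 / a ^+ 3 - c / a ^+ 2 by field.
- by field.
Qed.

End Jets.

(** * Symmetric divided differences and an implicit function *)

Section DividedDifference.
Context {R : realType}.
Implicit Types (k : R -> R) (x : 'rV[R]_2) (e : R).

(* Locked, since unification would otherwise unfold the integrals. *)
Fact divdiff_key : unit. Proof. exact: tt. Qed.

(** At (t, v) this is (k(t + v) - k(t - v)) / (2 v), in the integral form that includes v = 0. *)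
Definition divdiff : (R -> R) -> 'rV[R]_2 -> R := locked_with divdiff_key
  (fun k x => seg_avg 0 ('D_1 k) (row2 (x 0 0 - x 0 1) (2 * x 0 1))).

Lemma divdiff_seg_avg k x :
  divdiff k x = seg_avg 0 ('D_1 k) (row2 (x 0 0 - x 0 1) (2 * x 0 1)).
Proof. by rewrite /divdiff unlock. Qed.

Lemma ball0P e (v : R) : ball 0 e v <-> `|v| < e.
Proof. by rewrite -ball_normE /= sub0r normrN. Qed.

Lemma ball0_interval e : is_interval (ball (0 : R) e).
Proof.
move=> x y /ball0P; rewrite ltr_norml => /andP[x1 x2] /ball0P; rewrite ltr_norml => /andP[y1 y2].
by move=> z /andP[xz zy]; apply/ball0P; rewrite ltr_norml; apply/andP; split; lra.
Qed.

Lemma ball0_rowP n e (y : 'rV[R]_n) : 0 < e -> ball 0 e y <-> forall j, `|y 0 j| < e.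
Proof.
by move=> e0; rewrite ball_rowP//; split=> H j; have := H j; rewrite mxE subr0.
Qed.

Lemma row2E x : x = row2 (x 0 0) (x 0 1).
Proof. by apply/rowP => j; rewrite mxE; case: j => -[|[|//]] i /=; congr (x 0 _); apply: val_inj. Qed.

Lemma ball0_row2 e (a b : R) : `|a| < e -> `|b| < e -> ball 0 e (row2 a b).
Proof.
move=> ha hb; apply/ball0_rowP; first exact: le_lt_trans ha.
by move=> j; rewrite mxE; case: j => -[|[|//]].
Qed.


Section Fixed.
Context (e : R) (e0 : 0 < e).
Let e20 : 0 < e / 2. Proof. by rewrite divr_gt0. Qed.

Lemma half_ball_seg x : ball 0 (e / 2) x ->
  seg_in (ball 0 e) (row2 (x 0 0 - x 0 1) (2 * x 0 1)).
Proof.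
move=> /(ball0_rowP _ e20) H; have := H 0; have := H 1; rewrite !ltr_norml => /andP[a1 a2] /andP[b1 b2].
by rewrite /seg_in /= row2_0 row2_1; split; apply/ball0P; rewrite ltr_norml; apply/andP; split; lra.
Qed.

Lemma smooth_divdiff k : smooth (ball 0 e) k -> smooth (ball 0 (e / 2)) (divdiff k).
Proof.
move=> sk; have ob : open (ball (0 : 'rV[R]_2) (e / 2)) by exact: ball_open.
have oe : open (ball (0 : R) e) by exact: ball_open.
apply: (smooth_ext ob (fun x _ => esym (divdiff_seg_avg k x))).
apply: (smooth_comp ob half_ball_seg).
  exact: (smooth_seg_avg oe (@ball0_interval e) 0 (smooth_derive (1 : R) sk)).
have s0 := smooth_coord (0 : 'I_2) ob; have s1 := smooth_coord (1 : 'I_2) ob.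
move=> j; case: j => -[|[|//]] i.
  by apply: (smooth_ext ob _ (smoothB ob s0 s1)) => x _; rewrite mxE.
by apply: (smooth_ext ob _ (smoothM ob (smooth_cst ob 2) s1)) => x _; rewrite mxE.
Qed.

Lemma divdiffE k x : smooth (ball 0 e) k -> ball 0 (e / 2) x ->
  k (x 0 0 + x 0 1) - k (x 0 0 - x 0 1) = 2 * x 0 1 * divdiff k x.
Proof.
move=> sk /half_ball_seg Hx; have := seg_avg_derive (@ball0_interval e) sk Hx.
by rewrite row2_0 row2_1 divdiff_seg_avg => ->; congr (k _ - _); ring.
Qed.

Lemma divdiff_even k (t v : R) : smooth (ball 0 e) k -> ball 0 (e / 2) (row2 t v) ->
  divdiff k (row2 t (- v)) = divdiff k (row2 t v).
Proof.
move=> sk Hx.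
have Hx' : ball 0 (e / 2) (row2 t (- v)).
  by move: Hx => /(ball0_rowP _ e20) H; apply: ball0_row2; rewrite ?normrN;
    [have := H 0; rewrite row2_0|have := H 1; rewrite row2_1].
have := divdiffE sk Hx; have := divdiffE sk Hx'; rewrite !row2_0 !row2_1 opprK.
have [->|v0] := eqVneq v 0; first by rewrite oppr0.
move=> E1 E2.
apply: (@mulfI _ (2 * v)); first by rewrite mulf_neq0.
move: (divdiff k _) E1 => A E1; move: (divdiff k _) E2 => B E2.
rewrite -E2; have -> : 2 * v * A = - (2 * - v * A) by ring.
by rewrite -E1; ring.
Qed.

Lemma int01_cst (c : R) : int01 (fun=> c) = c.
Proof.
have -> : int01 (fun=> c) = c * 1 - c * 0; last by rewrite mulr1 mulr0 subr0.
apply: (@int01_FTC R (fun=> c) (fun s => c * s)) => [|s _]; first exact: cont01_cst.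
have := is_deriveZ c (is_derive_id s (1 : R)).
by rewrite [_ *: _]mulr1.
Qed.

Lemma divdiff_diag k (t : R) : divdiff k (row2 t 0) = 'D_1 k t.
Proof.
rewrite divdiff_seg_avg /seg_avg !row2_0 !row2_1 subr0 mulr0 -[RHS]int01_cst.
by apply: eq_Rintegral => s _; rewrite expr0 mul1r mulr0 addr0.
Qed.

End Fixed.

Lemma line_coord0 (t : R) : 0 + t *: delta_mx 0 0 = row2 t 0 :> 'rV[R]_2.
Proof.
apply/rowP => j; rewrite !mxE; case: j => -[|[|//]] i /=; first by rewrite mulr1 add0r.
by rewrite mulr0 addr0.
Qed.

(** The solution [tau v] is read off from the inverse of [replace_coord 0 F] at (0, v). Evenness is
    uniqueness: since [F] is even in v, the point (tau(- v), v) is also a zero, in the same ball on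
    which that map is injective. *)
Lemma even_implicit (F : 'rV[R]_2 -> R) (rho : R) : 0 < rho ->
  smooth (ball 0 rho) F -> F 0 = 0 -> 0 < 'D_(delta_mx 0 0) F 0 ->
  (forall t v, ball 0 rho (row2 t v) -> F (row2 t (- v)) = F (row2 t v)) ->
  exists (e : R) (tau : R -> R), [/\ 0 < e, e <= rho & smooth (ball 0 e) tau] /\
    [/\ tau 0 = 0, forall v, ball 0 e v -> tau (- v) = tau v &
      forall v, ball 0 e v -> ball 0 rho (row2 (tau v) v) /\ F (row2 (tau v) v) = 0].
Proof.
move=> rho0 sF F0 DF evF.
have ob : open (ball (0 : 'rV[R]_2) rho) by exact: ball_open.
have [r [V [psi [r0 rrho rsub D]]]] := local_replace_coord ob (ballxx _ rho0) sF DF rho0.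
have [[oU oV] [s1 s2 H1 H2]] := D.
have T0 : replace_coord 0 F 0 = 0.
  by apply/rowP => j; rewrite updE F0 !mxE; case: eqP.
have [V0 psi0] := H1 0 (ballxx _ r0); rewrite T0 in V0 psi0.
have [e1 /= e10 He1] : nbhs_ball (0 : 'rV[R]_2) V by apply/nbhs_ballP/open_nbhs_nbhs.
pose e := Num.min e1 rho.
have e0 : 0 < e by rewrite lt_min e10.
have HV v : ball 0 e v -> V (row2 0 v).
  move=> /ball0P ve; apply/He1/ball0_row2; first by rewrite normr0.
  by apply: lt_le_trans ve _; rewrite ge_min lexx.
pose tau v := psi (row2 0 v) 0 0.
have Hpsi v : ball 0 e v -> psi (row2 0 v) = row2 (tau v) v /\ F (row2 (tau v) v) = 0.
  move=> /HV/H2 [_ E].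
  have E1 : psi (row2 0 v) 0 1 = v.
    have := congr1 (fun x : 'rV[R]_2 => x 0 1) E.
    by rewrite /= updE /= row2_1.
  have E0 : psi (row2 0 v) = row2 (tau v) v by rewrite [LHS]row2E E1.
  split=> //; rewrite -E0.
  have := congr1 (fun x : 'rV[R]_2 => x 0 0) E.
  by rewrite /= updE eqxx row2_0.
have obe : open (ball (0 : R) e) by exact: ball_open.
exists e, tau; split; split=> //.
- by rewrite ge_min lexx orbT.
- apply: (@smooth_comp R R 2 (ball 0 e) V (fun x => psi x 0 0) (row2 0)) => //.
  move=> j; case: j => -[|[|//]] i.
    by apply: (smooth_ext obe _ (smooth_cst obe 0)) => v _; rewrite mxE.
  by apply: (smooth_ext obe _ (smooth_id obe)) => v _; rewrite mxE.
- rewrite /tau; have -> : row2 0 0 = 0 :> 'rV[R]_2 by rewrite -line_coord0 scale0r addr0.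
  by rewrite psi0 mxE.
- move=> v Bv.
  have Bv' : ball 0 e (- v) by move: Bv => /ball0P H; apply/ball0P; rewrite normrN.
  have [E1 F1] := Hpsi v Bv; have [E2 F2] := Hpsi _ Bv'.
  have [U2 _] := H2 _ (HV _ Bv'); rewrite E2 in U2.
  have U3 : ball 0 r (row2 (tau (- v)) v).
    move: U2 => /(ball0_rowP _ r0) H; apply: ball0_row2; first by have := H 0; rewrite row2_0.
    by have := H 1; rewrite row2_1 normrN.
  have [_ E3] := H1 _ U3.
  have E4 : replace_coord 0 F (row2 (tau (- v)) v) = row2 0 v.
    apply/rowP => j; rewrite updE -evF ?F2; last exact: rsub.
    by rewrite !mxE; case: j => -[|[|//]].
  have := congr1 (fun x : 'rV[R]_2 => x 0 0) E3.
  by rewrite /= E4 row2_0.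
- move=> v Bv; have [E1 F1] := Hpsi v Bv; split=> //.
  by apply: rsub; rewrite -E1; have [] := H2 _ (HV _ Bv).
Qed.

End DividedDifference.

(** * The double curve and parity about it *)

Section Parity.
Context {R : realType}.
Implicit Types (k : R -> R) (x : 'rV[R]_2).

Lemma partial_line n (i : 'I_n) (G : 'rV[R]_n -> R) (c : R) : differentiable G 0 ->
  is_derive (0 : R) 1 (fun t : R => G (t *: delta_mx 0 i)) c -> 'D_(delta_mx 0 i) G 0 = c.
Proof.
move=> dG.
have -> : (fun t : R => G (t *: delta_mx 0 i)) = (fun t : R => G (0 + t *: delta_mx 0 i)).
  by apply/funext => t; rewrite add0r.
move=> [_ <-].
have z0 : 0 + (0 : R) *: delta_mx 0 i = 0 :> 'rV[R]_n by rewrite scale0r addr0.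
have [|_ ->] := @derivable_line R 'rV[R]_n G 0 (delta_mx 0 i) 0.
  by rewrite z0; exact: diff_derivable.
by rewrite z0.
Qed.

Lemma jet2_sqr : jet2 (fun v : R => v ^+ 2) 0 0 2.
Proof.
have := jet2M (@jet2_id R) (@jet2_id R).
by rewrite !(mul0r, mulr0, mulr1, add0r, addr0).
Qed.

Section Data.
Context (e : R) (e0 : 0 < e) (g h eta zeta : R -> R).
Context (sg : smooth (ball 0 e) g) (sh : smooth (ball 0 e) h)
  (se : smooth (ball 0 e) eta) (sz : smooth (ball 0 e) zeta).
Context (g2 h2 eta1 eta2 zeta2 : R).
Context (Jg : jet2 g 0 0 g2) (Jh : jet2 h 0 0 h2)
  (Je : jet2 eta 0 eta1 eta2) (Jz : jet2 zeta 0 0 zeta2) (h20 : 0 < h2) (eta10 : 0 < eta1).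

Let e20 : 0 < e / 2. Proof. by rewrite divr_gt0. Qed.

Let row200 : row2 0 0 = 0 :> 'rV[R]_2.
Proof. by rewrite -line_coord0 scale0r addr0. Qed.

Let derJ k a b c : smooth (ball 0 e) k -> jet2 k a b c ->
  'D_1 k 0 = b /\ is_derive (0 : R) 1 ('D_1 k) c.
Proof.
move=> sk Jk; have [_ <- <-] := jet2_uniq (jet2_smooth e0 sk) Jk; split=> //.
by apply: smooth_derive_is (smooth_derive (1 : R) sk) _; exact: ballxx.
Qed.

Let dd0 k a b c : smooth (ball 0 e) k -> jet2 k a b c -> divdiff k 0 = b.
Proof. by move=> sk Jk; rewrite -row200 divdiff_diag; have [] := derJ sk Jk. Qed.

(* Eliminating U from the equality of the images of (U, tau + v) and (U, tau - v)
   leaves the last equation. *)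
Lemma double_curve : exists (e1 rho : R) (tau : R -> R),
  [/\ 0 < e1, e1 <= rho, rho <= e / 2 & smooth (ball 0 e1) tau] /\
  [/\ tau 0 = 0, forall v, ball 0 e1 v -> tau (- v) = tau v &
   forall v, ball 0 e1 v -> [/\ ball 0 rho (row2 (tau v) v), 0 < divdiff eta (row2 (tau v) v) &
     divdiff h (row2 (tau v) v) * divdiff eta (row2 (tau v) v) =
     divdiff g (row2 (tau v) v) * divdiff zeta (row2 (tau v) v)]].
Proof.
have ob : open (ball (0 : 'rV[R]_2) (e / 2)) by exact: ball_open.
have dg := smooth_divdiff e0 sg; have dh := smooth_divdiff e0 sh.
have de := smooth_divdiff e0 se; have dz := smooth_divdiff e0 sz.
have : nbhs (0 : 'rV[R]_2) [set x | ball 0 (e / 2) x /\ 0 < divdiff eta x].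
  apply: filterI; first exact: nbhsx_ballx.
  have : {for 0, continuous (divdiff eta)}.
    by apply/differentiable_continuous/(smooth_diff de); exact: ballxx.
  by move=> /cvgr_gt; apply; rewrite (dd0 se Je).
move=> /nbhs_ballP [r1 /= r10 Hr1].
pose rho := Num.min r1 (e / 2).
have rho0 : 0 < rho by rewrite lt_min r10.
have rhoe : rho <= e / 2 by rewrite ge_min lexx orbT.
have sub1 : ball (0 : 'rV[R]_2) rho `<=` ball 0 (e / 2) by exact: le_ball.
have pe x : ball 0 rho x -> 0 < divdiff eta x.
  have rr : rho <= r1 by rewrite ge_min lexx.
  by move=> Bx; have [] := Hr1 x (le_ball rr Bx).
pose F x := divdiff h x * divdiff eta x - divdiff g x * divdiff zeta x.
have sF : smooth (ball 0 rho) F.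
  exact: (smooth_sub sub1 (smoothB ob (smoothM ob dh de) (smoothM ob dg dz))).
have F0 : F 0 = 0 by rewrite /F (dd0 sh Jh) (dd0 sg Jg) !mul0r subr0.
(* On the axis v = 0 divided differences are derivatives, so F(t, 0) = h' eta' - g' zeta'. As h', g'
   and zeta' vanish at 0, differentiation leaves h''(0) eta'(0) = h2 eta1. *)
have DF : 0 < 'D_(delta_mx 0 0) F 0.
  suff H : is_derive (0 : R) 1 (fun t : R => F (t *: delta_mx 0 0)) (h2 * eta1).
    rewrite (partial_line _ H); first exact: mulr_gt0.
    by apply: (smooth_diff sF); exact: ballxx.
  have -> : (fun t : R => F (t *: delta_mx 0 0)) =
      (fun t => 'D_1 h t * 'D_1 eta t - 'D_1 g t * 'D_1 zeta t).
    by apply/funext => t; rewrite -[_ *: _]add0r line_coord0 /F !divdiff_diag.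
  have [Eh Dh] := derJ sh Jh; have [Ee De] := derJ se Je.
  have [Eg Dg] := derJ sg Jg; have [Ez Dz] := derJ sz Jz.
  have := is_deriveB (is_derive_mul Dh De) (is_derive_mul Dg Dz).
  by rewrite Eh Ee Eg Ez !(mul0r, mulr0, addr0, subr0).
have evF t v : ball 0 rho (row2 t v) -> F (row2 t (- v)) = F (row2 t v).
  by move=> /sub1 H; rewrite /F !(divdiff_even e0).
have [e1 [tau [[e10 e1rho st] [t0 te tP]]]] := even_implicit rho0 sF F0 DF evF.
exists e1, rho, tau; split; split=> // v /tP [H1 H2]; split=> //; first exact: pe.
by apply/eqP; rewrite -subr_eq0; apply/eqP.
Qed.
End Data.

Section Splitting.
Context (e e1 rho : R) (e0 : 0 < e) (e10 : 0 < e1) (e1rho : e1 <= rho) (rhoe : rho <= e / 2).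
Context (tau : R -> R) (stau : smooth (ball 0 e1) tau) (tau0 : tau 0 = 0).
Context (tauN : forall v, ball 0 e1 v -> tau (- v) = tau v).
Context (tauB : forall v, ball 0 e1 v -> ball (0 : 'rV[R]_2) rho (row2 (tau v) v)).

(** Parity is taken about the moving centre [tau v]. Since [tau] is even, both the even part and the
    quotient of the odd part by v are even functions of v. *)
Definition even_part k v : R := 2^-1 * (k (tau v + v) + k (tau v - v)).
Definition odd_quot k v : R := divdiff k (row2 (tau v) v).

Let ob : open (ball (0 : R) e1). Proof. exact: ball_open. Qed.

Lemma tau_ball (v : R) : ball 0 e1 v -> ball 0 e (tau v + v) /\ ball 0 e (tau v - v).
Proof.
have rho0 : 0 < rho by exact: lt_le_trans e1rho.
have r2 : rho + rho <= e by rewrite [e]splitr lerD.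
move=> /tauB/(ball0_rowP _ rho0) H; have := H 0; have := H 1; rewrite row2_0 row2_1 => h1 h0.
split; apply/ball0P; apply: lt_le_trans r2; first by rewrite (le_lt_trans (ler_normD _ _))// ltrD.
by rewrite (le_lt_trans (ler_normB _ _))// ltrD.
Qed.

Let half v : ball 0 e1 v -> ball (0 : 'rV[R]_2) (e / 2) (row2 (tau v) v).
Proof. by move=> /tauB; exact: le_ball. Qed.

Lemma split_parity k v : smooth (ball 0 e) k -> ball 0 e1 v ->
  k (tau v + v) = even_part k v + v * odd_quot k v.
Proof.
move=> sk /half Bv; have := divdiffE e0 sk Bv; rewrite row2_0 row2_1 /even_part /odd_quot.
by move: (divdiff k _) => A E; lra.
Qed.

Lemma even_partN k (v : R) : ball 0 e1 v -> even_part k (- v) = even_part k v.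
Proof. by move=> Bv; rewrite /even_part tauN// opprK [X in _ * X]addrC. Qed.

Lemma odd_quotN k v : smooth (ball 0 e) k -> ball 0 e1 v -> odd_quot k (- v) = odd_quot k v.
Proof. by move=> sk Bv; rewrite /odd_quot tauN// (divdiff_even e0 sk)//; exact: half. Qed.

Lemma smooth_even_part k : smooth (ball 0 e) k -> smooth (ball 0 e1) (even_part k).
Proof.
move=> sk; apply: (smoothM ob); first exact: (smooth_cst ob).
have sid := smooth_id ob.
apply: (smoothD ob).
  apply: (smooth_comp1 ob (f := fun v => tau v + v) _ sk); first by move=> v /tau_ball [].
  exact: (smoothD ob).
apply: (smooth_comp1 ob (f := fun v => tau v - v) _ sk); first by move=> v /tau_ball [].
exact: (smoothB ob).
Qed.

Lemma smooth_odd_quot k : smooth (ball 0 e) k -> smooth (ball 0 e1) (odd_quot k).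
Proof.
move=> sk.
apply: (@smooth_comp R R 2 (ball 0 e1) _ (divdiff k) (fun v => row2 (tau v) v) ob half).
  exact: smooth_divdiff.
move=> j; case: j => -[|[|//]] i.
  by apply: (smooth_ext ob _ stau) => v _; rewrite mxE.
by apply: (smooth_ext ob _ (smooth_id ob)) => v _; rewrite mxE.
Qed.

Lemma even_part0 k : even_part k 0 = k 0.
Proof. by rewrite /even_part tau0 addr0 subr0; lra. Qed.

Lemma odd_quot0 k : odd_quot k 0 = 'D_1 k 0.
Proof. by rewrite /odd_quot tau0 divdiff_diag. Qed.

Lemma tau_jet : exists t2, jet2 tau 0 0 t2.
Proof.
have J := jet2_smooth e10 stau; rewrite tau0 in J.
have d0 : is_derive (0 : R) 1 tau ('D_1 tau 0) by have [] := jet2_derive J.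
have d1 := @is_derive_opp_arg R tau 0 ('D_1 tau 0).
rewrite oppr0 in d1; have {d1}[_ E1] := d1 d0.
have E2 : 'D_1 (fun v => tau (- v)) 0 = 'D_1 tau 0.
  by apply: near_eq_derive; near=> v; apply: tauN; near: v; exact: nbhsx_ballx.
have D0 : 'D_1 tau 0 = 0.
  by move: E1; rewrite E2; move: ('D_1 tau 0) => d E; lra.
by exists ('D_1 ('D_1 tau) 0); rewrite D0 in J.
Unshelve. all: by end_near. Qed.

(** The moving centre enters the second coefficient only through [b]; the jets of [h] and [zeta],
    which have b = 0, are left unchanged. *)
Lemma even_part_jet k a b c : jet2 k a b c -> exists t2, jet2 (even_part k) a 0 (c + b * t2).
Proof.
move=> Jk; have [t2 Jt] := tau_jet; exists t2.
have Jp := jet2D Jt (@jet2_id R).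
have Jm := jet2D Jt (jet2M (jet2_cst (-1)) (@jet2_id R)).
rewrite !(addr0, add0r, mulr0, mul0r, mulr1) in Jp Jm.
have J := jet2M (jet2_cst 2^-1) (jet2D (jet2_comp Jk Jp) (jet2_comp Jk Jm)).
have E : 2^-1 * (a + a) = a by lra.
rewrite E !(mul0r, mulr0, add0r, addr0) in J.
have E1 : 2^-1 * (b * 1 + b * -1) = 0 by ring.
have E2 : 2^-1 * (c * 1 ^+ 2 + b * t2 + (c * (-1) ^+ 2 + b * t2)) = c + b * t2 by field.
move: J; rewrite ?mulr1 in E1 *; rewrite E1 E2.
apply: jet2_ext; near=> v; by rewrite /even_part mulN1r.
Unshelve. all: by end_near. Qed.

End Splitting.
End Parity.

(** * Reduction to the standard cross cap *)

Section NormalForm.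
Context {R : realType}.

Definition even_ext (f H : R -> R) (d : R) :=
  smooth (ball 0 (d ^+ 2)) H /\ forall v, `|v| < d -> H (v ^+ 2) = f v.

Lemma even_ext_le f H d d' : 0 <= d' -> d' <= d -> even_ext f H d -> even_ext f H d'.
Proof.
move=> d0 dd [sH HH]; split.
  apply: smooth_sub sH; apply: le_ball; rewrite ler_pXn2r ?nnegrE//.
  exact: le_trans dd.
by move=> v vd; apply: HH; exact: lt_le_trans dd.
Qed.

(** The radius may be shrunk afterwards, which lets the seven extensions used in the normal form
    share a common one. *)
Lemma even_ext_exists f (e : R) : 0 < e -> smooth (ball 0 e) f ->
  (forall v, ball 0 e v -> f (- v) = f v) ->
  exists (H : R -> R) (d : R), 0 < d /\ forall d', 0 <= d' -> d' <= d -> even_ext f H d'.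
Proof.
move=> e0 sf ef; have [H [d [d0 _ sH HH]]] := even_extension e0 sf ef.
by exists H, d; split=> // d' d'0 dd; apply: even_ext_le dd _.
Qed.

Definition srf (g h eta zeta : R -> R) (y : 'rV[R]_2) : 'rV[R]_3 :=
  vec3 (y 0 0) (g (y 0 1) + y 0 0 * eta (y 0 1)) (h (y 0 1) + y 0 0 * zeta (y 0 1)).

Lemma vec3_0 (a b c : R) : vec3 a b c 0 0 = a. Proof. by rewrite mxE. Qed.
Lemma vec3_1 (a b c : R) : vec3 a b c 0 1 = b. Proof. by rewrite mxE. Qed.
Lemma vec3_2 (a b c : R) : vec3 a b c 0 2 = c. Proof. by rewrite mxE. Qed.

Lemma vec3P (x y : 'rV[R]_3) : x 0 0 = y 0 0 -> x 0 1 = y 0 1 -> x 0 2 = y 0 2 -> x = y.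
Proof.
move=> h0 h1 h2; apply/rowP => j.
case: j => -[|[|[|//]]] i.
- by have -> : Ordinal i = 0 by apply: val_inj.
- by have -> : Ordinal i = 1 by apply: val_inj.
- by have -> : Ordinal i = 2 by apply: val_inj.
Qed.

Definition germ_diffeo n (phi psi : 'rV[R]_n -> 'rV[R]_n) :=
  exists U V, [/\ diffeo U V phi psi, U 0 & phi 0 = 0].

Lemma germ_diffeo_comp n (phi psi phi' psi' : 'rV[R]_n -> 'rV[R]_n) :
  germ_diffeo phi psi -> germ_diffeo phi' psi' -> germ_diffeo (phi' \o phi) (psi \o psi').
Proof.
move=> [U [V [D U0 p0]]] [U' [V' [D' U'0 p'0]]].
exists (U `&` phi @^-1` U'), (V' `&` psi' @^-1` V); split; first exact: diffeo_comp.
  by split=> //; rewrite /preimage /= p0.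
by rewrite /= p0.
Qed.

Lemma germ_diffeo_sym n (phi psi : 'rV[R]_n -> 'rV[R]_n) : germ_diffeo phi psi -> germ_diffeo psi phi.
Proof.
move=> [U [V [D U0 p0]]]; exists V, U; have [_ [_ _ H1 _]] := D.
have [V0 E] := H1 0 U0; rewrite p0 in V0 E.
by split=> //; exact: diffeo_sym.
Qed.

Lemma germ_replace_coord n (i : 'I_n) (W : set 'rV[R]_n) (G : 'rV[R]_n -> R) (c : R) :
  open W -> W 0 -> smooth W G -> G 0 = 0 -> 0 < c ->
  is_derive (0 : R) 1 (fun t : R => G (t *: delta_mx 0 i)) c ->
  exists psi, germ_diffeo (replace_coord i G) psi.
Proof.
move=> oW W0 sG G0 c0 dG.
have DG : 0 < 'D_(delta_mx 0 i) G 0.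
  by rewrite (partial_line _ dG)//; exact: (smooth_diff sG).
have [r [V [psi [r0 _ _ D]]]] := local_replace_coord oW W0 sG DG ltr01.
exists psi, (ball 0 r), V; split=> //; first exact: ballxx.
by apply/rowP => j; rewrite updE G0 !mxE; case: eqP.
Qed.

Section Main.
Context (e : R) (e0 : 0 < e) (g h eta zeta : R -> R).
Context (sg : smooth (ball 0 e) g) (sh : smooth (ball 0 e) h)
  (se : smooth (ball 0 e) eta) (sz : smooth (ball 0 e) zeta).
Context (g2 h2 eta1 eta2 zeta2 : R).
Context (Jg : jet2 g 0 0 g2) (Jh : jet2 h 0 0 h2)
  (Je : jet2 eta 0 eta1 eta2) (Jz : jet2 zeta 0 0 zeta2) (h20 : 0 < h2) (eta10 : 0 < eta1).

Lemma ruled_normal_form : exists (theta theta' : 'rV[R]_2 -> 'rV[R]_2) (Psi Psi' : 'rV[R]_3 -> 'rV[R]_3),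
  [/\ germ_diffeo theta theta', germ_diffeo Psi Psi' &
    \forall x \near (0 : 'rV[R]_2), srf g h eta zeta (theta x) = Psi (fstd x)].
Proof.
have [e1 [rho [tau [[e10 e1rho rhoe st] [t0 tN tP]]]]] := double_curve e0 sg sh se sz Jg Jh Je Jz h20 eta10.
have tB v : ball 0 e1 v -> ball (0 : 'rV[R]_2) rho (row2 (tau v) v) by move=> /tP [].
have ob : open (ball (0 : R) e1) by exact: ball_open.
pose E := even_part tau; pose O := odd_quot tau.
have sE k : smooth (ball 0 e) k -> smooth (ball 0 e1) (E k).
  exact: (smooth_even_part e10 e1rho rhoe st tB).
have sO k : smooth (ball 0 e) k -> smooth (ball 0 e1) (O k).
  exact: (smooth_odd_quot e0 rhoe st tB).
have EN k v : ball 0 e1 v -> E k (- v) = E k v by exact: (even_partN tN).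
have ON k v : smooth (ball 0 e) k -> ball 0 e1 v -> O k (- v) = O k v.
  exact: (odd_quotN e0 rhoe tN tB).
have spl k v : smooth (ball 0 e) k -> ball 0 e1 v -> k (tau v + v) = E k v + v * O k v.
  exact: (split_parity e0 rhoe tB).
have Oe0 v : ball 0 e1 v -> 0 < O eta v by move=> /tP [].
have Oen v : ball 0 e1 v -> O eta v != 0 by move=> /Oe0/lt0r_neq0.
have OO v : ball 0 e1 v -> O h v * O eta v = O g v * O zeta v by move=> /tP [].
(* At U = q v the points with parameters tau v + v and tau v - v have the same image: the second
   coordinates agree by the choice of [q], the third ones by the equation that defines [tau]. *)
pose q v := - (O g v * (O eta v)^-1).
have sq : smooth (ball 0 e1) q.
  exact: (smoothN ob (smoothM ob (sO g sg) (smoothV ob Oen (sO eta se)))).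
have qN v : ball 0 e1 v -> q (- v) = q v by move=> Bv; rewrite /q !ON.
have qg v : ball 0 e1 v -> O g v + q v * O eta v = 0.
  by move=> /Oen H; rewrite /q mulNr -mulrA mulVf// mulr1 subrr.
have qh v : ball 0 e1 v -> O h v + q v * O zeta v = 0.
  move=> Bv; apply: (mulIf (Oen v Bv)); rewrite mul0r mulrDl OO//.
  rewrite /q; have := Oen v Bv; move: (O eta v) (O g v) (O zeta v) => a b c a0; by field.
pose a2 v := E g v + q v * E eta v.
pose a3 v := E h v + q v * E zeta v.
have sa2 : smooth (ball 0 e1) a2 by exact: (smoothD ob (sE g sg) (smoothM ob sq (sE eta se))).
have sa3 : smooth (ball 0 e1) a3 by exact: (smoothD ob (sE h sh) (smoothM ob sq (sE zeta sz))).
have a2N v : ball 0 e1 v -> a2 (- v) = a2 v by move=> Bv; rewrite /a2 !EN// qN.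
have a3N v : ball 0 e1 v -> a3 (- v) = a3 v by move=> Bv; rewrite /a3 !EN// qN.
have [Q [dQ [dQ0 HQ]]] := even_ext_exists e10 sq qN.
have [A2 [dA2 [dA20 HA2]]] := even_ext_exists e10 sa2 a2N.
have [A3 [dA3 [dA30 HA3]]] := even_ext_exists e10 sa3 a3N.
have [Ee [dEe [dEe0 HEe]]] := even_ext_exists e10 (sE eta se) (EN eta).
have [Ez [dEz [dEz0 HEz]]] := even_ext_exists e10 (sE zeta sz) (EN zeta).
have [Oe [dOe [dOe0 HOe]]] := even_ext_exists e10 (sO eta se) (fun v => ON eta v se).
have [Oz [dOz [dOz0 HOz]]] := even_ext_exists e10 (sO zeta sz) (fun v => ON zeta v sz).
have [d [d0 de1 dle]] : exists d : R, [/\ 0 < d, d <= e1 & [/\ d <= dQ, d <= dA2, d <= dA3, d <= dEe &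
    [/\ d <= dEz, d <= dOe & d <= dOz]]].
  exists (Num.min e1 (Num.min dQ (Num.min dA2 (Num.min dA3 (Num.min dEe (Num.min dEz (Num.min dOe dOz))))))).
  by do !split; rewrite ?lt_min ?e10 ?dQ0 ?dA20 ?dA30 ?dEe0 ?dEz0 ?dOe0 ?dOz0 ?ge_min ?lexx ?orbT.
have [le1 le2 le3 le4 [le5 le6 le7]] := dle.
have [sQ EQ] := HQ d (ltW d0) le1; have [sA2 EA2] := HA2 d (ltW d0) le2.
have [sA3 EA3] := HA3 d (ltW d0) le3; have [sEe EEe] := HEe d (ltW d0) le4.
have [sEz EEz] := HEz d (ltW d0) le5; have [sOe EOe] := HOe d (ltW d0) le6.
have [sOz EOz] := HOz d (ltW d0) le7.
have d2 : 0 < d ^+ 2 by rewrite exprn_gt0.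
have derJ k a b c : smooth (ball 0 e) k -> jet2 k a b c -> k 0 = a /\ 'D_1 k 0 = b.
  by move=> sk Jk; have [<- <- _] := jet2_uniq (jet2_smooth e0 sk) Jk.
have [g0 Dg0] := derJ _ _ _ _ sg Jg; have [h0 Dh0] := derJ _ _ _ _ sh Jh.
have [ee0 De0] := derJ _ _ _ _ se Je; have [z0 Dz0] := derJ _ _ _ _ sz Jz.
have E0 k : E k 0 = k 0 by exact: even_part0.
have O0 k : O k 0 = 'D_1 k 0 by exact: odd_quot0.
have q0 : q 0 = 0 by rewrite /q O0 Dg0 mul0r oppr0.
have nn : `|0 : R| < d by rewrite normr0.
have at0 (H f : R -> R) : (forall v : R, `|v| < d -> H (v ^+ 2) = f v) -> H 0 = f 0.
  by move=> /(_ 0 nn); rewrite expr0n.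
have Q0 : Q 0 = 0 by rewrite (at0 _ _ EQ).
have A20 : A2 0 = 0 by rewrite (at0 _ _ EA2) /a2 E0 g0 q0 mul0r addr0.
have A30 : A3 0 = 0 by rewrite (at0 _ _ EA3) /a3 E0 h0 q0 mul0r addr0.
have Ee00 : Ee 0 = 0 by rewrite (at0 _ _ EEe) E0.
have Ez00 : Ez 0 = 0 by rewrite (at0 _ _ EEz) E0.
have Oe00 : Oe 0 = eta1 by rewrite (at0 _ _ EOe) O0.
have Oz00 : Oz 0 = 0 by rewrite (at0 _ _ EOz) O0.
(* Compares second derivatives at 0 of A3(v^2) and of a3. The term with [q] contributes nothing,
   since [q] and the even part of [zeta] vanish at 0, the latter to first order as well. The result
   makes v^2 an admissible third coordinate of the target. *)
have J3 : 2 * 'D_1 A3 0 = h2.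
  have JA := jet2_comp (jet2_smooth d2 sA3) (@jet2_sqr R).
  have [th Jth] := even_part_jet e10 st t0 tN Jh; have [tz Jtz] := even_part_jet e10 st t0 tN Jz.
  have Ja3 := jet2D Jth (jet2M (jet2_smooth e10 sq) Jtz).
  rewrite q0 in Ja3.
  have JA' : jet2 (fun v => A3 (v ^+ 2)) (0 + 0 * 0) (0 + ('D_1 q 0 * 0 + 0 * 0))
     (h2 + 0 * th + ('D_1 ('D_1 q) 0 * 0 + 2 * 'D_1 q 0 * 0 + 0 * (zeta2 + 0 * tz))).
    apply: jet2_ext Ja3.
    have : \forall v \near (0 : R), ball 0 d v by exact: nbhsx_ballx.
    by apply: filterS => v /ball0P vd; rewrite EA3.
  have [_ _] := jet2_uniq JA JA'.
  move: ('D_1 A3 0) ('D_1 ('D_1 A3) 0) ('D_1 q 0) ('D_1 ('D_1 q) 0) => a b c f E3.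
  transitivity (b * 0 ^+ 2 + a * 2); first by ring.
  by rewrite E3; ring.
have pos_near : \forall z \near (0 : R), 0 < Oe z.
  have : {for 0, continuous Oe}.
    by apply/differentiable_continuous/(smooth_diff sOe); exact: ballxx.
  by move=> /cvgr_gt; apply; rewrite Oe00.
have [r /= r0 Hr] : nbhs_ball (0 : R) [set z | 0 < Oe z] by apply/nbhs_ballP.
(* The third coordinate of the target stands for v^2, whence the radius d^2 of the extensions; [r]
   keeps [Oe] away from zero. *)
pose w := Num.min (d ^+ 2) r.
have w0 : 0 < w by rewrite lt_min d2.
have wd : ball (0 : R) w `<=` ball 0 (d ^+ 2) by apply: le_ball; rewrite ge_min lexx.
have wr z : ball (0 : R) w z -> Oe z != 0.
  move=> Bz; apply/lt0r_neq0/Hr; apply: le_ball Bz; by rewrite ge_min lexx orbT.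
pose W := ball (0 : 'rV[R]_3) w.
have oW : open W by exact: ball_open.
have W0 : W 0 by exact: ballxx.
have Wz y : W y -> ball 0 w (y 0 2).
  by move=> /(ball0_rowP _ w0) H; apply/ball0P.
have sc i : smooth W (fun y : 'rV[R]_3 => y 0 i) by exact: smooth_coord.
have sz3 H : smooth (ball 0 (d ^+ 2)) H -> smooth W (fun y : 'rV[R]_3 => H (y 0 2)).
  move=> sH; exact: (smooth_comp1 oW Wz (smooth_sub wd sH) (sc 2)).
(* From (X, X V, V^2) the three coordinates of the surface are produced one after the other, so each
   map has to recover what earlier ones overwrote: [X] undoes [G1], and (y_1 - N) / Oe recovers X V
   after [G2], where [N] is the part of the second coordinate without X V. *)
pose G1 (y : 'rV[R]_3) := y 0 0 + Q (y 0 2).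
pose X (y : 'rV[R]_3) := y 0 0 - Q (y 0 2).
pose N (y : 'rV[R]_3) := A2 (y 0 2) + X y * Ee (y 0 2).
pose G2 (y : 'rV[R]_3) := N y + y 0 1 * Oe (y 0 2).
pose G3 (y : 'rV[R]_3) := A3 (y 0 2) + X y * Ez (y 0 2) + (y 0 1 - N y) * (Oe (y 0 2))^-1 * Oz (y 0 2).
have sG1 : smooth W G1 by exact: (smoothD oW (sc 0) (sz3 _ sQ)).
have sX : smooth W X by exact: (smoothB oW (sc 0) (sz3 _ sQ)).
have sN : smooth W N by exact: (smoothD oW (sz3 _ sA2) (smoothM oW sX (sz3 _ sEe))).
have sG2 : smooth W G2 by exact: (smoothD oW sN (smoothM oW (sc 1) (sz3 _ sOe))).
have sOi : smooth W (fun y => (Oe (y 0 2))^-1).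
  by apply: (smoothV oW _ (sz3 _ sOe)) => y /Wz/wr.
have sG3 : smooth W G3.
  exact: (smoothD oW (smoothD oW (sz3 _ sA3) (smoothM oW sX (sz3 _ sEz)))
    (smoothM oW (smoothM oW (smoothB oW (sc 1) sN) sOi) (sz3 _ sOz))).
have zc j : (0 : 'rV[R]_3) 0 j = 0 by rewrite mxE.
have G10 : G1 0 = 0 by rewrite /G1 !zc Q0 addr0.
have X0 : X 0 = 0 by rewrite /X !zc Q0 subr0.
have N0 : N 0 = 0 by rewrite /N X0 !zc A20 mul0r addr0.
have G20 : G2 0 = 0 by rewrite /G2 N0 !zc mul0r addr0.
have G30 : G3 0 = 0 by rewrite /G3 N0 X0 !zc A30 !mul0r subr0 !mul0r !addr0.
have ln (t : R) (i j : 'I_3) : (t *: delta_mx 0 i : 'rV[R]_3) 0 j = if j == i then t else 0.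
  by rewrite !mxE /=; case: eqP; rewrite ?mulr1 ?mulr0.
have dG1 : is_derive (0 : R) 1 (fun t : R => G1 (t *: delta_mx 0 0)) 1.
  have -> : (fun t : R => G1 (t *: delta_mx 0 0)) = (fun t => t).
    by apply/funext => t; rewrite /G1 !ln /= Q0 addr0.
  exact: is_derive_id.
have dG2 : is_derive (0 : R) 1 (fun t : R => G2 (t *: delta_mx 0 1)) eta1.
  have -> : (fun t : R => G2 (t *: delta_mx 0 1)) = (fun t => eta1 * t).
    by apply/funext => t; rewrite /G2 /N /X !ln /= Q0 A20 Oe00 subr0 mul0r !add0r mulrC.
  have := is_deriveZ eta1 (is_derive_id (0 : R) (1 : R)).
  by rewrite [_ *: _]mulr1.
(* Apart from [A3], each summand on the third axis contains two factors that vanish at 0: [Q] and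
   [Ez], or [A2 - Q * Ee] and [Oz]. Only the derivative of [A3] survives. *)
have dG3 : is_derive (0 : R) 1 (fun t : R => G3 (t *: delta_mx 0 2)) ('D_1 A3 0).
  have js H : smooth (ball 0 (d ^+ 2)) H -> jet2 H (H 0) ('D_1 H 0) ('D_1 ('D_1 H) 0) by exact: jet2_smooth.
  have -> : (fun t : R => G3 (t *: delta_mx 0 2)) = (fun t => A3 t + (-1) * Q t * Ez t +
      (-1) * (A2 t + (-1) * Q t * Ee t) * (Oe t)^-1 * Oz t).
    apply/funext => t; rewrite /G3 /N /X !ln /=.
    move: (Q t) (A2 t) (A3 t) (Ee t) (Ez t) ((Oe t)^-1) (Oz t) => *; ring.
  have JQ := jet2M (jet2_cst (-1)) (js _ sQ).
  have JOi := jet2V (lt0r_neq0 (eq_ind_r (fun x => 0 < x) eta10 Oe00)) (js _ sOe).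
  have := jet2_derive (jet2D (jet2D (js _ sA3) (jet2M JQ (js _ sEz)))
    (jet2M (jet2M (jet2M (jet2_cst (-1)) (jet2D (js _ sA2) (jet2M JQ (js _ sEe)))) JOi) (js _ sOz))).
  move=> [_]; rewrite Q0 A20 Ee00 Ez00 Oz00.
  by rewrite !(mul0r, mulr0, addr0, add0r).
have D30 : 0 < 'D_1 A3 0 by rewrite -(pmulr_rgt0 _ (ltr0Sn _ 1)) J3.
have [P1' D1] := germ_replace_coord oW W0 sG1 G10 ltr01 dG1.
have [P2' D2] := germ_replace_coord oW W0 sG2 G20 eta10 dG2.
have [P3' D3] := germ_replace_coord oW W0 sG3 G30 D30 dG3.
have ob2 : open (ball (0 : 'rV[R]_2) e1) by exact: ball_open.
have b20 : ball (0 : 'rV[R]_2) e1 0 by exact: ballxx.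
have b21 (x : 'rV[R]_2) : ball 0 e1 x -> ball 0 e1 (x 0 1).
  by move=> /(ball0_rowP _ e10) H; apply/ball0P.
have sc2 i : smooth (ball 0 e1) (fun y : 'rV[R]_2 => y 0 i) by exact: smooth_coord.
(* The change of parameters is (X, V) |-> (X + q V, V + tau V). [T1] has to act first, because [q]
   is evaluated at V before the shift by [tau]. *)
pose T1 (x : 'rV[R]_2) := x 0 0 + q (x 0 1).
pose T2 (x : 'rV[R]_2) := x 0 1 + tau (x 0 1).
have sT1 : smooth (ball 0 e1) T1 by exact: (smoothD ob2 (sc2 0) (smooth_comp1 ob2 b21 sq (sc2 1))).
have sT2 : smooth (ball 0 e1) T2 by exact: (smoothD ob2 (sc2 1) (smooth_comp1 ob2 b21 st (sc2 1))).
have zc2 j : (0 : 'rV[R]_2) 0 j = 0 by rewrite mxE.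
have T10 : T1 0 = 0 by rewrite /T1 !zc2 q0 addr0.
have T20 : T2 0 = 0 by rewrite /T2 !zc2 t0 addr0.
have ln2 (t : R) (i j : 'I_2) : (t *: delta_mx 0 i : 'rV[R]_2) 0 j = if j == i then t else 0.
  by rewrite !mxE /=; case: eqP; rewrite ?mulr1 ?mulr0.
have dT1 : is_derive (0 : R) 1 (fun t : R => T1 (t *: delta_mx 0 0)) 1.
  have -> : (fun t : R => T1 (t *: delta_mx 0 0)) = (fun t => t).
    by apply/funext => t; rewrite /T1 !ln2 /= q0 addr0.
  exact: is_derive_id.
have dT2 : is_derive (0 : R) 1 (fun t : R => T2 (t *: delta_mx 0 1)) 1.
  have -> : (fun t : R => T2 (t *: delta_mx 0 1)) = (fun t => t + tau t).
    by apply/funext => t; rewrite /T2 !ln2 /=.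
  have [t2 Jt] := tau_jet e10 st t0 tN.
  by have [_] := jet2_derive (jet2D (@jet2_id R) Jt); rewrite addr0.
have [T1' DT1] := germ_replace_coord ob2 b20 sT1 T10 ltr01 dT1.
have [T2' DT2] := germ_replace_coord ob2 b20 sT2 T20 ltr01 dT2.
exists (replace_coord 1 T2 \o replace_coord 0 T1), (T1' \o T2'),
  (replace_coord 2 G3 \o (replace_coord 1 G2 \o replace_coord 0 G1)), ((P1' \o P2') \o P3').
split.
- exact: germ_diffeo_comp DT1 DT2.
- exact: germ_diffeo_comp (germ_diffeo_comp D1 D2) D3.
apply/nbhs_ballP; exists d => // x /(ball0_rowP _ d0) Bx.
set U := x 0 0; set v := x 0 1.
have vd : `|v| < d by exact: Bx.
have Bv : ball 0 e1 v by apply/ball0P; exact: lt_le_trans de1.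
have th0 : (replace_coord 1 T2 \o replace_coord 0 T1) x 0 0 = U + q v.
  by rewrite /= updE /= updE /=.
have th1 : (replace_coord 1 T2 \o replace_coord 0 T1) x 0 1 = tau v + v.
  by rewrite /= updE /= /T2 !updE /= addrC.
rewrite /srf th0 th1 !spl//.
set y := fstd x.
have y0 : y 0 0 = U by rewrite /y vec3_0.
have y1 : y 0 1 = U * v by rewrite /y vec3_1.
have y2 : y 0 2 = v ^+ 2 by rewrite /y vec3_2.
set r1 := replace_coord 0 G1 y; set r2 := replace_coord 1 G2 r1.
have r10 : r1 0 0 = U + q v by rewrite updE /= /G1 y0 y2 EQ.
have r11 : r1 0 1 = U * v by rewrite updE /=.
have r12 : r1 0 2 = v ^+ 2 by rewrite updE /=.
have Xr1 : X r1 = U by rewrite /X r10 r12 EQ// addrK.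
have Nr1 : N r1 = a2 v + U * E eta v by rewrite /N Xr1 r12 EA2// EEe.
have r20 : r2 0 0 = U + q v by rewrite updE /=.
have r21 : r2 0 1 = a2 v + U * E eta v + U * v * O eta v by rewrite updE /= /G2 Nr1 r11 r12 EOe.
have r22 : r2 0 2 = v ^+ 2 by rewrite updE /=.
have Xr2 : X r2 = U by rewrite /X r20 r22 EQ// addrK.
have Nr2 : N r2 = a2 v + U * E eta v by rewrite /N Xr2 r22 EA2// EEe.
apply: vec3P; rewrite ?vec3_0 ?vec3_1 ?vec3_2 /= -/r1 -/r2 updE /=.
- by rewrite r20.
- rewrite r21 /a2; have := qg v Bv; move: (O g v) (q v) (O eta v) (E g v) (E eta v) => og qq oe eg ee H.
  transitivity (eg + qq * ee + U * ee + U * v * oe + v * (og + qq * oe)); first by ring.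
  by rewrite H mulr0 addr0.
- rewrite /G3 Xr2 Nr2 r21 r22 EA3// EEz// EOe// EOz//.
  have -> : (a2 v + U * E eta v + U * v * O eta v - (a2 v + U * E eta v)) * (O eta v)^-1 * O zeta v = U * v * O zeta v.
    have := Oen v Bv; move: (O eta v) => oe H; by field.
  rewrite /a3; have := qh v Bv; move: (O h v) (q v) (O zeta v) (E h v) (E zeta v) => og qq oe eg ee H.
  transitivity (eg + qq * ee + U * ee + U * v * oe + v * (og + qq * oe)); first by ring.
  by rewrite H mulr0 addr0.
Qed.
End Main.
End NormalForm.

(** * A cross cap criterion for ruled surfaces *)

Section RuledCrossCap.
Context {R : realType}.

Lemma germ_diffeo_local n (phi psi : 'rV[R]_n -> 'rV[R]_n) :
  germ_diffeo phi psi -> local_diffeo_at phi 0.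
Proof. by move=> [U [V [D U0 _]]]; exact: diffeo_local D U0. Qed.

Lemma germ_diffeoK n (phi psi : 'rV[R]_n -> 'rV[R]_n) :
  germ_diffeo phi psi -> \forall x \near (0 : 'rV[R]_n), psi (phi x) = x.
Proof.
move=> [U [V [[[oU _] [_ _ H _]] U0 _]]].
by apply: filterS (open_nbhs_nbhs (conj oU U0)) => x /H [].
Qed.

Lemma germ_diffeo_near n (phi psi : 'rV[R]_n -> 'rV[R]_n) (P : set 'rV[R]_n) :
  germ_diffeo phi psi -> nbhs (0 : 'rV[R]_n) P -> \forall x \near (0 : 'rV[R]_n), P (phi x).
Proof.
move=> [U [V [[[oU _] [s _ _ _]] U0 p0]]] nP.
have c : {for 0, continuous phi} by apply/differentiable_continuous/(smoothv_diff s U0).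
by move: nP; rewrite -{1}p0 => /c.
Qed.

Lemma germ_diffeo_mulmx n (M : 'M[R]_n) : M \in unitmx ->
  germ_diffeo (fun x : 'rV[R]_n => x *m M) (fun x => x *m invmx M).
Proof.
by move=> uM; exists setT, setT; split=> //; [exact: diffeo_mulmx|rewrite mul0mx].
Qed.

(** Since x1(0) = 1, the first coordinate U = c1 + u x1 can replace the parameter u. Solving for u
    gives a surface [srf] with slopes x2 / x1 and x3 / x1, and the prescribed jets become h2 = 1 and
    eta1 = 1. *)
Lemma normalized_ruled_germ (e : R) (c1 c2 c3 x1 x2 x3 : R -> R) (k1 k2 l1 l2 l3 : R) : 0 < e ->
  smooth (ball 0 e) c1 -> smooth (ball 0 e) c2 -> smooth (ball 0 e) c3 ->
  smooth (ball 0 e) x1 -> smooth (ball 0 e) x2 -> smooth (ball 0 e) x3 ->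
  jet2 c1 0 0 k1 -> jet2 c2 0 0 k2 -> jet2 c3 0 0 1 ->
  jet2 x1 1 0 l1 -> jet2 x2 0 1 l2 -> jet2 x3 0 0 l3 ->
  exists (phi phi' : 'rV[R]_2 -> 'rV[R]_2) (Psi Psi' : 'rV[R]_3 -> 'rV[R]_3),
  [/\ germ_diffeo phi phi', germ_diffeo Psi Psi' &
    \forall x \near (0 : 'rV[R]_2),
      Psi (vec3 (c1 ((x : 'rV[R]_2) 0 1) + x 0 0 * x1 (x 0 1)) (c2 (x 0 1) + x 0 0 * x2 (x 0 1))
        (c3 (x 0 1) + x 0 0 * x3 (x 0 1))) = fstd (phi x)].
Proof.
move=> e0 sc1 sc2 sc3 sx1 sx2 sx3 Jc1 Jc2 Jc3 Jx1 Jx2 Jx3.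
have x10 : x1 0 = 1 by have [] := jet2_derive Jx1.
have c10 : c1 0 = 0 by have [] := jet2_derive Jc1.
have pos_near : \forall v \near (0 : R), 0 < x1 v.
  have : {for 0, continuous x1}.
    by apply/differentiable_continuous/(smooth_diff sx1); exact: ballxx.
  by move=> /cvgr_gt; apply; rewrite x10.
have [r /= r0 Hr] : nbhs_ball (0 : R) [set v | 0 < x1 v] by apply/nbhs_ballP.
pose d := Num.min e r.
have d0 : 0 < d by rewrite lt_min e0.
have de : ball (0 : R) d `<=` ball 0 e by apply: le_ball; rewrite ge_min lexx.
have x1n v : ball 0 d v -> x1 v != 0.
  move=> Bv; apply/lt0r_neq0/Hr; apply: le_ball Bv; by rewrite ge_min lexx orbT.
have ob : open (ball (0 : R) d) by exact: ball_open.
have sm (k : R -> R) : smooth (ball 0 e) k -> smooth (ball 0 d) k by exact: (smooth_sub de).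
have sV : smooth (ball 0 d) (fun v => (x1 v)^-1) by exact: (smoothV ob x1n (sm x1 sx1)).
pose eta v := x2 v * (x1 v)^-1; pose zeta v := x3 v * (x1 v)^-1.
pose g v := c2 v + (-1) * (c1 v * eta v); pose h v := c3 v + (-1) * (c1 v * zeta v).
have seta : smooth (ball 0 d) eta by exact: (smoothM ob (sm _ sx2) sV).
have szeta : smooth (ball 0 d) zeta by exact: (smoothM ob (sm _ sx3) sV).
have sN := smooth_cst ob (-1).
have sg : smooth (ball 0 d) g by exact: (smoothD ob (sm _ sc2) (smoothM ob sN (smoothM ob (sm _ sc1) seta))).
have sh : smooth (ball 0 d) h by exact: (smoothD ob (sm _ sc3) (smoothM ob sN (smoothM ob (sm _ sc1) szeta))).
have JV := jet2V (oner_neq0 R) Jx1.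
have Je := jet2M Jx2 JV; have Jz := jet2M Jx3 JV.
have Jg := jet2D Jc2 (jet2M (jet2_cst (-1)) (jet2M Jc1 Je)).
have Jh := jet2D Jc3 (jet2M (jet2_cst (-1)) (jet2M Jc1 Jz)).
rewrite !(mul0r, mulr0, addr0, add0r, oppr0) invr1 !mulr1 in Je Jz Jg Jh.
have [th [th' [Psi [Psi' [Dth DPsi E]]]]] :=
  ruled_normal_form d0 sg sh seta szeta Jg Jh Je Jz ltr01 ltr01.
pose T (x : 'rV[R]_2) := c1 (x 0 1) + x 0 0 * x1 (x 0 1).
have ob2 : open (ball (0 : 'rV[R]_2) d) by exact: ball_open.
have b21 (x : 'rV[R]_2) : ball 0 d x -> ball 0 d (x 0 1).
  by move=> /(ball0_rowP _ d0) H; apply/ball0P.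
have sc i : smooth (ball 0 d) (fun y : 'rV[R]_2 => y 0 i) by exact: smooth_coord.
have sT : smooth (ball 0 d) T.
  exact: (smoothD ob2 (smooth_comp1 ob2 b21 (sm _ sc1) (sc 1))
    (smoothM ob2 (sc 0) (smooth_comp1 ob2 b21 (sm _ sx1) (sc 1)))).
have T0 : T 0 = 0 by rewrite /T !mxE c10 mul0r addr0.
have dT : is_derive (0 : R) 1 (fun t : R => T (t *: delta_mx 0 0)) 1.
  have -> : (fun t : R => T (t *: delta_mx 0 0)) = (fun t => t).
    by apply/funext => t; rewrite /T !mxE /= mulr0 c10 x10 !mulr1 add0r.
  exact: is_derive_id.
have [P' DP] := germ_replace_coord ob2 (ballxx _ d0) sT T0 ltr01 dT.
have Dphi := germ_diffeo_comp DP (germ_diffeo_sym Dth).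
(* The normal form expresses the surface through [fstd], while a cross cap asks for a map applied to
   the surface; hence the inverses of both of its diffeomorphisms. *)
exists (th' \o replace_coord 0 T), (P' \o th), Psi', Psi; split=> //; first exact: germ_diffeo_sym.
have K1 := germ_diffeo_near DP (germ_diffeoK (germ_diffeo_sym Dth)).
have K2 := germ_diffeo_near Dphi E.
have K3 : \forall x \near (0 : 'rV[R]_2), Psi' (Psi (fstd ((th' \o replace_coord 0 T) x))) = fstd ((th' \o replace_coord 0 T) x).
  apply: (germ_diffeo_near Dphi (P := fun y => Psi' (Psi (fstd y)) = fstd y)).
  have cf : {for 0, continuous (@fstd R)}.
    apply/differentiable_continuous/(@smoothv_diff _ _ _ setT) => // j.
    have s0 := smooth_coord (0 : 'I_2) (@openT 'rV[R]_2).
    have s1 := smooth_coord (1 : 'I_2) (@openT 'rV[R]_2).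
    case: j => -[|[|[|//]]] i.
    - by apply: (smooth_ext openT _ s0) => x _; rewrite mxE.
    - by apply: (smooth_ext openT _ (smoothM openT s0 s1)) => x _; rewrite mxE.
    - by apply: (smooth_ext openT _ (smoothM openT s1 s1)) => x _; rewrite mxE /= expr2.
  have f0 : fstd 0 = 0 :> 'rV[R]_3.
    by apply: vec3P; rewrite ?vec3_0 ?vec3_1 ?vec3_2 !mxE ?mul0r ?expr0n.
  by have := germ_diffeoK DPsi; rewrite -{1}f0 => /cf.
have K4 : \forall x \near (0 : 'rV[R]_2), ball 0 d x by exact: nbhsx_ballx.
near=> x.
have q1 : th (th' (replace_coord 0 T x)) = replace_coord 0 T x by near: x.
have q2 : srf g h eta zeta (th ((th' \o replace_coord 0 T) x)) = Psi (fstd ((th' \o replace_coord 0 T) x)) by near: x.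
have q3 : Psi' (Psi (fstd ((th' \o replace_coord 0 T) x))) = fstd ((th' \o replace_coord 0 T) x) by near: x.
have q4 : ball 0 d x by near: x.
rewrite -q3 -q2 /= q1; congr Psi'.
have r0' : replace_coord 0 T x 0 0 = T x by rewrite updE.
have r1' : replace_coord 0 T x 0 1 = x 0 1 by rewrite updE.
rewrite /srf r0' r1' /T; have := x1n _ (b21 _ q4).
rewrite /g /h /eta /zeta.
move: (x1 _) (x2 _) (x3 _) (c1 _) (c2 _) (c3 _) (x 0 0) => a1 a2 a3 b1 b2 b3 u a1n.
by congr vec3; field.
Unshelve. all: by end_near. Qed.

Definition ruled (gam xi : R -> 'rV[R]_3) (x : 'rV[R]_2) : 'rV[R]_3 :=
  gam (x 0 1) + x 0 0 *: xi (x 0 1).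

Context (gam xi : R -> 'rV[R]_3) (sgam : smoothv setT gam) (sxi : smoothv setT xi).

Let oT2 : open [set: 'rV[R]_2] := openT.

Lemma smooth_ruled : smoothv setT (ruled gam xi).
Proof.
move=> j; have s0 := smooth_coord (0 : 'I_2) oT2; have s1 := smooth_coord (1 : 'I_2) oT2.
have c k : smooth setT k -> smooth setT (fun x : 'rV[R]_2 => k (x 0 1)).
  by move=> sk; apply: (@smooth_comp1 _ _ _ oT2 setT k (fun x : 'rV[R]_2 => x 0 1)).
apply: (smooth_ext oT2 _ (smoothD oT2 (c _ (sgam j)) (smoothM oT2 s0 (c _ (sxi j))))).
by move=> x _; rewrite !mxE.
Qed.

Lemma partial_ruled0 x : partial 0 (ruled gam xi) x = xi (x 0 1).
Proof.
have dr := smoothv_diff smooth_ruled (I : setT x).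
apply/rowP => j; rewrite /partial derive_row; last exact: diff_derivable.
have dj : derivable (fun y => ruled gam xi y 0 j) (x + (0 : R) *: delta_mx 0 0) (delta_mx 0 0).
  by rewrite scale0r addr0; apply/diff_derivable/(smooth_diff (smooth_ruled j)).
have [_] := derivable_line dj; rewrite scale0r addr0 => <-.
have -> : (fun t : R => ruled gam xi (x + t *: delta_mx 0 0) 0 j) =
   (fun t => ruled gam xi x 0 j + xi (x 0 1) 0 j * t).
  by apply/funext => t; rewrite /ruled !mxE /= mulr0 addr0 mulr1; ring.
have H := is_deriveD (is_derive_cst (ruled gam xi x 0 j) (0 : R) (1 : R)) (is_deriveZ (xi (x 0 1) 0 j) (is_derive_id (0 : R) (1 : R))).
by have [_ ->] := H; rewrite add0r [_ *: _]mulr1.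
Qed.

Lemma partial_ruled1 x : partial 1 (ruled gam xi) x = 'D_1 gam (x 0 1) + x 0 0 *: 'D_1 xi (x 0 1).
Proof.
have dr := smoothv_diff smooth_ruled (I : setT x).
have dg v : differentiable gam v by exact: (smoothv_diff sgam).
have dx v : differentiable xi v by exact: (smoothv_diff sxi).
apply/rowP => j; rewrite /partial derive_row; last exact: diff_derivable.
have dj : derivable (fun y => ruled gam xi y 0 j) (x + (0 : R) *: delta_mx 0 1) (delta_mx 0 1).
  by rewrite scale0r addr0; apply/diff_derivable/(smooth_diff (smooth_ruled j)).
have [_] := derivable_line dj; rewrite scale0r addr0 => <-.
have -> : (fun t : R => ruled gam xi (x + t *: delta_mx 0 1) 0 j) =
   (fun t => gam (x 0 1 + t) 0 j + x 0 0 * xi (x 0 1 + t) 0 j).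
  by apply/funext => t; rewrite /ruled !mxE /= mulr0 mulr1 addr0.
rewrite !mxE !derive_row; [|exact: diff_derivable|exact: diff_derivable].
have sh (k : R -> R) : smooth setT k -> is_derive (0 : R) 1 (fun t => k (x 0 1 + t)) ('D_1 k (x 0 1)).
  move=> sk; have dk : is_derive (x 0 1 + 0) 1 k ('D_1 k (x 0 1)).
    by rewrite addr0; exact: smooth_derive_is.
  have da : is_derive (0 : R) 1 (fun t : R => x 0 1 + t) 1.
    have := is_deriveD (is_derive_cst (x 0 1) (0 : R) (1 : R)) (is_derive_id (0 : R) (1 : R)).
    by rewrite add0r.
  by have := is_derive_comp dk da; rewrite mulr1.
by have [_ ->] := is_deriveD (sh _ (sgam j)) (is_deriveZ (x 0 0) (sh _ (sxi j))).
Qed.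

Context (gam0 : gam 0 = 0) (dgam0 : 'D_1 gam 0 = 0).

Lemma ruled_singular : singular_point (ruled gam xi) 0.
Proof.
have dr := smoothv_diff smooth_ruled (I : setT (0 : 'rV[R]_2)).
rewrite /singular_point /jacobian.
set A := lin1_mx _.
have A1 : row 1 A = 0.
  rewrite rowE /A mul_rV_lin1 /= -deriveE// -/(partial 1 (ruled gam xi) 0).
  by rewrite partial_ruled1 !mxE dgam0 scale0r addr0.
(* With its second row zero, the matrix is a column times its first row, so its rank is at most
   1. *)
have -> : A = (delta_mx 0 0 : 'M[R]_(2, 1)) *m row 0 A.
  apply/row_matrixP => i; rewrite row_mul; case: i => -[|[|//]] i.
  - have -> : Ordinal i = 0 by apply: val_inj.
    rewrite (_ : row 0 (delta_mx 0 0) = 1%:M) ?mul1mx//.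
    by apply/matrixP => a b; rewrite !ord1 !mxE.
  - have -> : Ordinal i = 1 by apply: val_inj.
    rewrite A1 (_ : row 1 (delta_mx 0 0) = 0) ?mul0mx//.
    by apply/matrixP => a b; rewrite !ord1 !mxE.
exact: leq_ltn_trans (mulmx_max_rank _ _) _.
Qed.

(** Whitney's criterion in the ruled case: the rows of [M] are f_u, f_uv and f_vv at the origin, and
    f_v vanishes there. Multiplication by the inverse of [M] sends this frame to the standard basis,
    which gives the jets required by [normalized_ruled_germ]. *)
Lemma ruled_cross_cap (M : 'M[R]_3) : M \in unitmx ->
  row 0 M = xi 0 -> row 1 M = 'D_1 xi 0 -> row 2 M = 'D_1 ('D_1 gam) 0 ->
  cross_cap setT (ruled gam xi) 0.
Proof.
move=> uM M0 M1 M2; split=> //.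
- exact: smoothv_smooth_on smooth_ruled.
- exact: ruled_singular.
have oT : open [set: R] := openT.
pose N := invmx M.
have sv (f : R -> 'rV[R]_3) : smoothv setT f -> smoothv setT (fun v => f v *m N).
  move=> sf j; apply: (smooth_ext oT (f := fun v => \sum_k f v 0 k * N k j)) => [v _|].
    by rewrite mxE.
  by apply: (smooth_sum oT) => k; apply: (smoothM oT); [exact: sf|exact: (smooth_cst oT)].
have dN (f : R -> 'rV[R]_3) v : smoothv setT f -> 'D_1 (fun v => f v *m N) v = 'D_1 f v *m N.
  move=> sf; have df := smoothv_diff sf (I : setT v).
  have df' := smoothv_diff (sv f sf) (I : setT v).
  apply/rowP => j; rewrite derive_row; last exact: diff_derivable.
  have -> : (fun v => (f v *m N) 0 j) = \sum_k (fun v => N k j *: f v 0 k).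
    by apply/funext => u; rewrite fct_sumE mxE; apply: eq_bigr => k _; rewrite mulrC.
  rewrite derive_sum => [|k]; last first.
    by apply: derivableZ; apply/diff_derivable/(smooth_diff (sf k)).
  rewrite mxE; apply: eq_bigr => k _.
  rewrite deriveZ; last by apply/diff_derivable/(smooth_diff (sf k)).
  by rewrite derive_row ?[_ *: _]mulrC//; exact: diff_derivable.
have sub (k : R -> R) : smooth setT k -> smooth (ball 0 1) k by exact: smooth_sub.
have sDg : smoothv setT ('D_1 gam) by exact: (smoothv_derive (1 : R) oT sgam).
have sDx : smoothv setT ('D_1 xi) by exact: (smoothv_derive (1 : R) oT sxi).
have jet (f : R -> 'rV[R]_3) j : smoothv setT f -> smoothv setT ('D_1 f) ->
    jet2 (fun v => (f v *m N) 0 j) ((f 0 *m N) 0 j) (('D_1 f 0 *m N) 0 j) (('D_1 ('D_1 f) 0 *m N) 0 j).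
  move=> sf sDf; have := jet2_smooth ltr01 (sub _ (sv f sf j)).
  have E1 : 'D_1 (fun v => (f v *m N) 0 j) = (fun v => ('D_1 f v *m N) 0 j).
    apply/funext => v; rewrite -dN// derive_row//; apply/diff_derivable/(smoothv_diff (sv f sf)).
    exact: I.
  have E2 : 'D_1 (fun v => ('D_1 f v *m N) 0 j) 0 = ('D_1 ('D_1 f) 0 *m N) 0 j.
    rewrite -dN// derive_row//; apply/diff_derivable/(smoothv_diff (sv _ sDf)).
    exact: I.
  have E0 : 'D_1 (fun v => (f v *m N) 0 j) 0 = ('D_1 f 0 *m N) 0 j by have := congr1 (fun F : R -> R => F 0) E1.
  by move=> J; rewrite E1 E2 E0 in J; exact: J.
have rowN i : row i M *m N = delta_mx 0 i by rewrite -row_mul mulmxV// row1.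
have Jg j : jet2 (fun v => (gam v *m N) 0 j) 0 0 (j == 2)%:R.
  have := jet gam j sgam sDg; rewrite gam0 dgam0 mul0mx -M2 rowN.
  by rewrite [X in jet2 _ X]mxE [X in jet2 _ _ X]mxE [X in jet2 _ _ _ X]mxE.
have Jx j : jet2 (fun v => (xi v *m N) 0 j) (j == 0)%:R (j == 1)%:R (('D_1 ('D_1 xi) 0 *m N) 0 j).
  have := jet xi j sxi sDx; rewrite -M0 -M1 !rowN.
  by rewrite [X in jet2 _ X]mxE [X in jet2 _ _ X]mxE.
have [phi [phi' [Psi [Psi' [Dphi DPsi E]]]]] := normalized_ruled_germ ltr01
  (sub _ (sv gam sgam 0)) (sub _ (sv gam sgam 1)) (sub _ (sv gam sgam 2))
  (sub _ (sv xi sxi 0)) (sub _ (sv xi sxi 1)) (sub _ (sv xi sxi 2))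
  (Jg 0) (Jg 1) (Jg 2) (Jx 0) (Jx 1) (Jx 2).
have DN : germ_diffeo (fun x : 'rV[R]_3 => x *m N) (fun x => x *m invmx N).
  by apply: germ_diffeo_mulmx; rewrite unitmx_inv.
have f0 : ruled gam xi 0 = 0 by rewrite /ruled !mxE gam0 scale0r addr0.
have DP := germ_diffeo_comp DN DPsi.
exists phi, (Psi \o (fun x : 'rV[R]_3 => x *m N)); rewrite f0; split.
- exact: germ_diffeo_local Dphi.
- by have [? [? []]] := Dphi.
- exact: germ_diffeo_local DP.
- by have [? [? []]] := DP.
- apply: filterS E => x <- /=; congr Psi.
  by apply: vec3P; rewrite ?vec3_0 ?vec3_1 ?vec3_2 /ruled mulmxDl -scalemxAl !mxE.
Qed.
End RuledCrossCap.

(** * Euclidean three-space *)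

Section Vectors.
Context {R : realType}.
Implicit Types (x y z : 'rV[R]_3) (A : 'M[R]_3).

Lemma sum3 (f : 'I_3 -> R) : \sum_i f i = f 0 + f 1 + f 2.
Proof.
rewrite !big_ord_recl big_ord0 addr0 addrA.
by congr (_ + f _ + f _); apply: val_inj.
Qed.

Lemma dot3E x y : dot x y = x 0 0 * y 0 0 + x 0 1 * y 0 1 + x 0 2 * y 0 2.
Proof. by rewrite /dot sum3. Qed.

Lemma crossE x y : [/\ cross x y 0 0 = x 0 1 * y 0 2 - x 0 2 * y 0 1,
  cross x y 0 1 = x 0 2 * y 0 0 - x 0 0 * y 0 2 &
  cross x y 0 2 = x 0 0 * y 0 1 - x 0 1 * y 0 0].
Proof. by rewrite /cross vec3_0 vec3_1 vec3_2. Qed.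

Lemma dotC n (x y : 'rV[R]_n) : dot x y = dot y x.
Proof. by apply: eq_bigr => i _; rewrite mulrC. Qed.

Lemma dotDl n (x y z : 'rV[R]_n) : dot (x + y) z = dot x z + dot y z.
Proof. by rewrite /dot -big_split; apply: eq_bigr => i _; rewrite mxE mulrDl. Qed.

Lemma dotDr n (x y z : 'rV[R]_n) : dot z (x + y) = dot z x + dot z y.
Proof. by rewrite dotC dotDl !(dotC z). Qed.

Lemma dotZl n (c : R) (x z : 'rV[R]_n) : dot (c *: x) z = c * dot x z.
Proof. by rewrite /dot mulr_sumr; apply: eq_bigr => i _; rewrite mxE mulrA. Qed.

Lemma dotZr n (c : R) (x z : 'rV[R]_n) : dot z (c *: x) = c * dot z x.
Proof. by rewrite dotC dotZl dotC. Qed.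

Lemma dotNl n (x z : 'rV[R]_n) : dot (- x) z = - dot x z.
Proof. by rewrite -scaleN1r dotZl mulN1r. Qed.

Lemma dotNr n (x z : 'rV[R]_n) : dot z (- x) = - dot z x.
Proof. by rewrite dotC dotNl dotC. Qed.

Lemma dot_mx n (x y : 'rV[R]_n) : dot x y = (x *m y^T) 0 0.
Proof. by rewrite mxE; apply: eq_bigr => i _; rewrite mxE. Qed.

Lemma dot_ge0 n (x : 'rV[R]_n) : 0 <= dot x x.
Proof. by apply: sumr_ge0 => i _; rewrite -expr2 sqr_ge0. Qed.

Lemma dot_eq0 n (x : 'rV[R]_n) : dot x x = 0 -> x = 0.
Proof.
move=> /eqP; rewrite psumr_eq0 => [/allP H|i _]; last by rewrite -expr2 sqr_ge0.
apply/rowP => i; have := H i (mem_index_enum i); rewrite -expr2 sqrf_eq0 => /eqP ->.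
by rewrite mxE.
Qed.

Lemma enorm_dot n (x : 'rV[R]_n) : enorm x ^+ 2 = dot x x.
Proof. by rewrite sqr_sqrtr// dot_ge0. Qed.

Lemma enorm1 n (x : 'rV[R]_n) : enorm x = 1 -> dot x x = 1.
Proof. by rewrite -enorm_dot => ->; rewrite expr1n. Qed.

Lemma dot_cross_l x y : dot x (cross x y) = 0.
Proof. have [c0 c1 c2] := crossE x y; rewrite dot3E c0 c1 c2; ring. Qed.

Lemma dot_cross_r x y : dot y (cross x y) = 0.
Proof. have [c0 c1 c2] := crossE x y; rewrite dot3E c0 c1 c2; ring. Qed.

Lemma dot_cross_cross x y : dot (cross x y) (cross x y) = dot x x * dot y y - dot x y ^+ 2.
Proof. have [c0 c1 c2] := crossE x y; rewrite !dot3E c0 c1 c2; ring. Qed.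

Definition rows3 x y z : 'M[R]_3 := \matrix_i [:: x; y; z]`_i.

Lemma rows3_0 x y z : row 0 (rows3 x y z) = x. Proof. exact: rowK. Qed.
Lemma rows3_1 x y z : row 1 (rows3 x y z) = y. Proof. exact: rowK. Qed.
Lemma rows3_2 x y z : row 2 (rows3 x y z) = z. Proof. exact: rowK. Qed.

Lemma matrix3P A A' : row 0 A = row 0 A' -> row 1 A = row 1 A' -> row 2 A = row 2 A' -> A = A'.
Proof.
move=> h0 h1 h2; apply/row_matrixP => j; case: j => -[|[|[|//]]] i.
- by have -> : Ordinal i = 0 by apply: val_inj.
- by have -> : Ordinal i = 1 by apply: val_inj.
- by have -> : Ordinal i = 2 by apply: val_inj.
Qed.

Lemma rows3_mulmx x y z A : rows3 x y z *m A = rows3 (x *m A) (y *m A) (z *m A).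
Proof. by apply: matrix3P; rewrite row_mul ?rows3_0 ?rows3_1 ?rows3_2. Qed.

Lemma mulmx_trE A A' i j : (A *m A'^T) i j = dot (row i A) (row j A').
Proof. by rewrite mxE; apply: eq_bigr => k _; rewrite !mxE. Qed.

Lemma det_rows3 x y z : \det (rows3 x y z) = dot (cross x y) z.
Proof.
have [c0 c1 c2] := crossE x y; rewrite dot3E c0 c1 c2.
rewrite (expand_det_row _ 0) sum3 /cofactor.
rewrite !(expand_det_row _ 0) !big_ord_recl !big_ord0 /cofactor !det_mx11 !mxE /=.
have e1 : (0 + 1 %% 3 = 1)%N by [].
have e2 : (0 + (1 %% 3 + 1 %% 3) %% 3 = 2)%N by [].
have e3 : (0 + bump 0 0 = 1)%N by [].
have l1 : lift 0 ord0 = 1 :> 'I_3 by apply: val_inj.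
have l2 : lift 0 (lift ord0 ord0) = 2 :> 'I_3 by apply: val_inj.
have l3 : lift 1 ord0 = 0 :> 'I_3 by apply: val_inj.
have l4 : lift 1 (lift ord0 ord0) = 2 :> 'I_3 by apply: val_inj.
have l5 : lift 2 ord0 = 0 :> 'I_3 by apply: val_inj.
have l6 : lift 2 (lift ord0 ord0) = 1 :> 'I_3 by apply: val_inj.
have m1 : lift 0 (lift ord0 0) = 2 :> 'I_3 by apply: val_inj.
have m2 : lift 0 (lift (lift ord0 ord0) 0) = 1 :> 'I_3 by apply: val_inj.
have m3 : lift 1 (lift ord0 0) = 2 :> 'I_3 by apply: val_inj.
have m4 : lift 1 (lift (lift ord0 ord0) 0) = 0 :> 'I_3 by apply: val_inj.
have m5 : lift 2 (lift ord0 0) = 1 :> 'I_3 by apply: val_inj.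
have m6 : lift 2 (lift (lift ord0 ord0) 0) = 0 :> 'I_3 by apply: val_inj.
rewrite ?e1 ?e2 ?e3 ?l1 ?l2 ?l3 ?l4 ?l5 ?l6 ?m1 ?m2 ?m3 ?m4 ?m5 ?m6; ring.
Qed.

Section SpecialOrthogonal.
Context (A : 'M[R]_3) (SA : SO3 A).

Let AAT : A *m A^T = 1%:M. Proof. by case: SA. Qed.
Let ATA : A^T *m A = 1%:M. Proof. exact: mulmx1C. Qed.

Lemma dot_SO3 x y : dot (x *m A) (y *m A) = dot x y.
Proof. by rewrite !dot_mx trmx_mul mulmxA -(mulmxA x) AAT mulmx1. Qed.

(** A vector is determined by its inner products with all z A, and the inner product of a vector
    product with a third vector is a determinant, which a rotation preserves. *)
Lemma cross_SO3 x y : cross (x *m A) (y *m A) = cross x y *m A.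
Proof.
have H z : dot (cross (x *m A) (y *m A)) (z *m A) = dot (cross x y *m A) (z *m A).
  rewrite dot_SO3 -!det_rows3 -rows3_mulmx det_mulmx.
  by case: SA => _ ->; rewrite mulr1.
apply/eqP; rewrite -subr_eq0; apply/eqP/dot_eq0.
set d := _ - _; have := H (d *m A^T); rewrite -mulmxA ATA mulmx1 => E.
by rewrite {1}/d dotDl dotNl E subrr.
Qed.

Lemma enorm_SO3 x : enorm (x *m A) = enorm x.
Proof. by rewrite /enorm dot_SO3. Qed.

Lemma SO3_tr : SO3 A^T.
Proof. by split; [rewrite trmxK|rewrite det_tr; case: SA]. Qed.

End SpecialOrthogonal.

Lemma SO3_mul A A' : SO3 A -> SO3 A' -> SO3 (A *m A').
Proof.
move=> [a1 a2] [b1 b2]; split; last by rewrite det_mulmx a2 b2 mulr1.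
by rewrite trmx_mul mulmxA -(mulmxA A) b1 mulmx1.
Qed.

Lemma frame_SO3 x y : dot x x = 1 -> dot y y = 1 -> dot x y = 0 -> SO3 (rows3 x y (cross x y)).
Proof.
move=> xx yy xy; have cc := dot_cross_cross x y; rewrite xx yy xy expr0n mulr1 subr0 in cc.
split; last by rewrite det_rows3.
have d i j : (rows3 x y (cross x y) *m (rows3 x y (cross x y))^T) i j = (i == j)%:R.
  have d1 := dot_cross_l x y; have d2 := dot_cross_r x y.
  rewrite mulmx_trE; case: i => -[|[|[|//]]] i; case: j => -[|[|[|//]]] j;
    rewrite ?(rowK _ _) /= ?xx ?yy ?xy ?cc ?d1 ?d2// dotC.
  - by rewrite xy.
  - by rewrite d1.
  - by rewrite d2.
by apply/matrixP => i j; rewrite d mxE.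
Qed.

Lemma lin1_mx_mulmxr A (f : 'rV[R]_3 -> 'rV[R]_3) : (forall x, f x = x *m A) -> lin1_mx f = A.
Proof.
by move=> H; apply/row_matrixP => i; apply/rowP => j; rewrite !mxE H -rowE mxE.
Qed.

Lemma diff_mulmx A (p : 'rV[R]_3) : differentiable (fun x => x *m A) p /\
  'J (fun x => x *m A) p = A.
Proof.
have dA : differentiable (fun x : 'rV[R]_3 => x *m A) p.
  apply: differentiable_row => j.
  have -> : (fun y : 'rV[R]_3 => (y *m A) 0 j) = \sum_k (fun y => A k j *: y 0 k).
    by apply/funext => y; rewrite fct_sumE mxE; apply: eq_bigr => k _; rewrite mulrC.
  apply: differentiable_sum => k; apply: differentiableZ; exact: differentiable_coord.
split=> //; apply: lin1_mx_mulmxr => v; rewrite -deriveE//.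
have : derivable (fun x : 'rV[R]_3 => x *m A) p v by exact: diff_derivable.
move=> _; rewrite /derive; apply: (@cvg_lim 'rV[R]_3) => //.
apply: (@cvg_trans _ ((fun=> v *m A) @ (0:R)^')); last exact: cvg_cst.
apply: near_eq_cvg; near=> h.
rewrite /= mulmxDl addrK -scalemxAl scalerA mulVf ?scale1r//.
by near: h; exact: nbhs_dnbhs_neq.
Unshelve. all: by end_near. Qed.

Lemma SO3_congruence A (f g : 'rV[R]_2 -> 'rV[R]_3) : SO3 A -> (forall x : 'rV[R]_2, g x = f x *m A) ->
  congruent f g.
Proof.
move=> SA H; exists (fun x => x *m A); split=> //.
- by move=> x y; rewrite -mulmxBl enorm_SO3.
- by move=> p; have [dA ->] := diff_mulmx A p; split=> //; case: SA => _ ->.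
Qed.

(* An isometry fixing the origin preserves inner products, hence agrees with
   the linear map sending the standard basis to its image. *)
Lemma congruence_SO3 (f g : 'rV[R]_2 -> 'rV[R]_3) p : f p = 0 -> g p = 0 -> congruent f g ->
  exists2 A, SO3 A & forall x : 'rV[R]_2, g x = f x *m A.
Proof.
move=> fp gp [T [iT oT gT]].
have T0 : T 0 = 0 by rewrite -{1}fp -gT gp.
have nT x : dot (T x) (T x) = dot x x.
  by have := iT x 0; rewrite T0 !subr0 -!enorm_dot => ->.
have dT x y : dot (T x) (T y) = dot x y.
  have : dot (T x - T y) (T x - T y) = dot (x - y) (x - y) by rewrite -!enorm_dot iT.
  rewrite !dotDl !dotDr !dotNl !dotNr !nT (dotC (T y)) (dotC y x).
  by move: (dot (T x) (T y)) (dot x y) (dot x x) (dot y y) => a b c d E; lra.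
pose A : 'M[R]_3 := \matrix_i T (delta_mx 0 i).
have rA i : row i A = T (delta_mx 0 i) by rewrite rowK.
have AAT : A *m A^T = 1%:M.
  apply/matrixP => i j; rewrite mulmx_trE !rA dT dot_mx trmx_delta mul_delta_mx_cond.
  by rewrite !mxE; case: (i == j); rewrite ?mulr1n ?mulr0n !mxE.
have TA x : T x = x *m A.
  have ATA := mulmx1C AAT.
  have E : T x *m A^T = x.
    apply/rowP => i; rewrite [LHS]mxE.
    transitivity (dot (T x) (T (delta_mx 0 i))).
      by apply: eq_bigr => k _; rewrite !mxE.
    rewrite dT /dot (bigD1 i)//= big1 ?addr0 => [|k /negbTE ki]; first by rewrite !mxE !eqxx mulr1.
    by rewrite !mxE ki mulr0.
  by rewrite -{2}E -mulmxA ATA mulmx1.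
have TE : T = (fun x => x *m A) by apply/funext.
exists A; last by move=> x; rewrite gT TA.
split=> //.
have [_] := oT 0; rewrite TE; have [_ ->] := diff_mulmx A 0 => dA.
have : \det A ^+ 2 = 1 by rewrite expr2 -{2}det_tr -det_mulmx AAT det1.
by move/eqP; rewrite sqrf_eq1 => /orP[/eqP->//|/eqP E]; move: dA; rewrite E oppr_gt0 ltr10.
Qed.
End Vectors.

(** * The surfaces of the theorem *)

Section IntegralFromZero.
Context {R : realType}.
Local Notation mu := (@lebesgue_measure R).

Lemma int0_0 (h : R -> R) : int0 h 0 = 0.
Proof. by rewrite /int0 lexx set_itv1 Rintegral_set1. Qed.

Lemma int0_derive (h : R -> R) (v : R) : continuous h -> is_derive v 1 (int0 h) (h v).
Proof.
(* The base point [a] lies to the left of both 0 and v, so a single primitive [F] serves both signs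
   and [int0] is [F - F 0] near v. *)
move=> ch; pose a := Num.min v 0 - 1; pose u := Num.max v 0 + 1.
have av : a < v by rewrite /a ltrBlDr (le_lt_trans (y := v))// ?ge_min ?lexx// ltrDl.
have a0 : a < 0 by rewrite /a ltrBlDr (le_lt_trans (y := 0))// ?ge_min ?lexx ?orbT// ltrDl.
have vu : v < u by rewrite /u (le_lt_trans (y := Num.max v 0))// ?le_max ?lexx// ltrDl.
have u0 : 0 < u by rewrite /u (le_lt_trans (y := Num.max v 0))// ?le_max ?lexx ?orbT// ltrDl.
have Ih b c : mu.-integrable `[b, c] (EFin \o h).
  apply: continuous_compact_integrable; first exact: segment_compact.
  exact: continuous_subspaceT.
pose F x := \int[mu]_(t in `[a, x]) h t.
have [dF EF] := continuous_FTC1_closed vu (Ih a u) av (ch v).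
have dF' : is_derive v 1 F (h v) by split; [exact: dF|rewrite -derive1E; exact: EF].
have split x y : a < x -> x <= y -> F y - F x = \int[mu]_(t in `[x, y]) h t.
  move=> ax xy; rewrite /F Rintegral_itvB//; last by rewrite bnd_simp; exact: ltW.
  rewrite Rintegral_itv_obnd_cbnd//.
  apply: (integrableS _ _ _ (Ih x y)) => //; apply: subset_itvr; by rewrite bnd_simp.
have E : \forall x \near v, F x - F 0 = int0 h x.
  near=> x; have ax : a < x by near: x; exact: lt_nbhsr.
  rewrite /int0; case: ifP => [x0|/negbT]; first exact: split.
  by rewrite -ltNge => x0; rewrite -(split x 0 ax (ltW x0)) opprB.
apply: near_eq_is_derive E _.
have := is_deriveB dF' (is_derive_cst (F 0) v (1 : R)).
by rewrite subr0.
Unshelve. all: by end_near. Qed.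

Lemma smooth_of_derive (I : set R) (f f' : R -> R) : open I ->
  (forall x : R, I x -> is_derive x 1 f (f' x)) -> smooth I f' -> smooth I f.
Proof.
move=> oI df sf' k; apply: (smS (k := k)).
apply: (@smSI R R I oI k _ (fun v x => v * f' x)).
- by move=> x /df/(is_derive_real 1) [].
- by move=> v x /df/(is_derive_real v) [].
- by move=> v; apply: (smM oI) => //; exact: (sm_cst oI).
Qed.

Lemma smooth_atan : smooth setT (@atan R).
Proof.
have d (x : R) : setT x -> is_derive x 1 (@atan R) ((1 + x * x)^-1).
  by move=> _; have := is_derive1_atan x; rewrite expr2.
apply: (smooth_of_derive openT d).
have sid := smooth_id (@openT R).
apply: (smoothV openT) => [x _|].
  by rewrite lt0r_neq0// ltr_wpDr// -expr2 sqr_ge0.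
by apply: (smoothD openT); [exact: (smooth_cst openT)|exact: (smoothM openT)].
Qed.

Lemma smooth_sqrt1 : smooth setT (fun v : R => Num.sqrt (1 + v ^+ 2)).
Proof.
have sid := smooth_id (@openT R).
have d (x : R) : setT x -> is_derive x 1 (fun v : R => Num.sqrt (1 + v ^+ 2)) (x * isqrt1 x).
  by move=> _; exact: is_derive_sqrt1.
apply: (smooth_of_derive openT d).
apply: (smoothM openT) => //; apply: bsm_smooth => k; by have [] := bsm_squash (R := R) k.
Qed.

Lemma continuous_smooth (f : R -> R) : smooth setT f -> continuous f.
Proof. by move=> sf x; apply/differentiable_continuous/(smooth_diff sf). Qed.

Lemma is_derive_unique (f g f' : R -> R) (x0 : R) : f x0 = g x0 ->
  (forall x : R, is_derive x 1 f (f' x)) -> (forall x : R, is_derive x 1 g (f' x)) -> f =1 g.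
Proof.
move=> fg df dg x; apply/eqP; rewrite -subr_eq0; apply/eqP.
have := @is_derive_0_is_cst R (fun x => f x - g x) x x0.
rewrite fg subrr; apply => y.
by have := is_deriveB (df y) (dg y); rewrite subrr.
Qed.

End IntegralFromZero.

(** * Derivatives of curves in space and on the sphere *)

Section VectorCurves.
Context {R : realType}.
Implicit Types (f g : R -> 'rV[R]_3).

Definition is_derivev (s : R) f (v : 'rV[R]_3) :=
  forall j, is_derive s 1 (fun t => f t 0 j) (v 0 j).

Lemma is_derivev_is (s : R) f v : is_derivev s f v -> is_derive s 1 f v.
Proof.
move=> H; have df : derivable f s 1 by apply: derivable_row => j; case: (H j).
by split=> //; apply/rowP => j; rewrite derive_row//; case: (H j).
Qed.

Lemma is_derive_derivev (s : R) f v : is_derive s 1 f v -> is_derivev s f v.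
Proof.
move=> [df <-] j; split; first by have /derivable_mxP := df.
by rewrite derive_row.
Qed.

Lemma is_derivev_dot (s : R) f g v w : is_derivev s f v -> is_derivev s g w ->
  is_derive s 1 (fun t => dot (f t) (g t)) (dot v (g s) + dot (f s) w).
Proof.
move=> df dg.
have -> : (fun t => dot (f t) (g t)) =
   (fun t => f t 0 0 * g t 0 0 + f t 0 1 * g t 0 1 + f t 0 2 * g t 0 2).
  by apply/funext => t; rewrite dot3E.
have := is_deriveD (is_deriveD (is_derive_mul (df 0) (dg 0)) (is_derive_mul (df 1) (dg 1)))
  (is_derive_mul (df 2) (dg 2)).
by rewrite !dot3E; congr (is_derive _ _ _ _); ring.
Qed.

Lemma is_derivev_mulmx s f v (A : 'M[R]_3) : is_derivev s f v -> is_derivev s (fun t => f t *m A) (v *m A).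
Proof.
move=> df j.
have -> : (fun t => (f t *m A) 0 j) = (fun t => f t 0 0 * A 0 j + f t 0 1 * A 1 j + f t 0 2 * A 2 j).
  by apply/funext => t; rewrite mxE sum3.
have dc (c : R) := is_derive_cst c s (1 : R).
have := is_deriveD (is_deriveD (is_derive_mul (df 0) (dc (A 0 j))) (is_derive_mul (df 1) (dc (A 1 j))))
  (is_derive_mul (df 2) (dc (A 2 j))).
by rewrite !mulr0 !addr0 mxE sum3.
Qed.

Lemma open_curve_dom : open (@curve_dom R).
Proof. exact: interval_open. Qed.

Lemma atan_curve_dom (v : R) : curve_dom (atan v).
Proof. by rewrite /curve_dom /= in_itv /= atan_gtNpi2 atan_ltpi2. Qed.

Lemma curve_dom0 : @curve_dom R 0.
Proof. by rewrite -atan0; exact: atan_curve_dom. Qed.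

Context (c : R -> 'rV[R]_3) (hc : arclength_sphere_curve c).

Lemma curve_chain n s : curve_dom s -> is_derivev s (derive1n n c) (derive1n n.+1 c s).
Proof.
move=> Is; apply: is_derive_derivev; have [d _ _] := hc Is.
by split; [exact: d|rewrite derive1nS derive1E].
Qed.

Lemma smooth_curve n : smoothv curve_dom (derive1n n c).
Proof.
move=> j; apply: (@smooth_chain R curve_dom (fun n s => derive1n n c s 0 j) open_curve_dom).
by move=> k s Is; exact: curve_chain.
Qed.

Lemma dot_curve s : curve_dom s -> dot (c s) (c s) = 1.
Proof. by move=> /hc [_ /enorm1]. Qed.

Lemma dot_curve' s : curve_dom s -> dot (derive1 c s) (derive1 c s) = 1.
Proof. by move=> /hc [_ _ /enorm1]. Qed.

Lemma near_curve_dom s (P : R -> Prop) : curve_dom s -> (forall t, curve_dom t -> P t) ->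
  \forall t \near s, P t.
Proof. by move=> Is H; apply: filterS H (open_nbhs_nbhs (conj open_curve_dom Is)). Qed.

Lemma dot_curve_curve' s : curve_dom s -> dot (c s) (derive1 c s) = 0.
Proof.
move=> Is; have H := is_derivev_dot (curve_chain 0 Is) (curve_chain 0 Is).
have H1 : is_derive s 1 (fun t => dot (c t) (c t)) 0.
  have E : \forall t \near s, cst (1 : R) t = dot (c t) (c t).
    by apply: near_curve_dom Is _ => t /dot_curve ->.
  exact: (near_eq_is_derive E (is_derive_cst (1 : R) s (1 : R))).
have [_ E1] := H; have [_ E2] := H1; rewrite E2 dotC in E1.
by move: E1; rewrite derive1n0 -/(derive1 c); move: (dot _ _) => x; lra.
Qed.
End VectorCurves.

Lemma frame_unitmx (R : realType) (x y : 'rV[R]_3) (a k m : R) :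
  dot x x = 1 -> dot x y = 0 -> dot y y = m -> m != 0 -> k != 0 ->
  rows3 x y (k *: (a *: y + cross x y)) \in unitmx.
Proof.
move=> xx xy yy m0 k0; set n := cross x y.
have yx : dot y x = 0 by rewrite dotC.
have xn : dot x n = 0 by exact: dot_cross_l.
have yn : dot y n = 0 by exact: dot_cross_r.
have nx : dot n x = 0 by rewrite dotC.
have ny : dot n y = 0 by rewrite dotC.
have nn : dot n n = m by rewrite dot_cross_cross xx yy xy expr0n subr0 mul1r.
(* The rows of [N] are the dual basis of x, y, k (a y + n). *)
pose N := rows3 x (m^-1 *: (y - a *: n)) ((k * m)^-1 *: n).
suff MN : rows3 x y (k *: (a *: y + n)) *m N^T = 1%:M by have [] := mulmx1_unit MN.
apply/matrixP => i j; rewrite mulmx_trE [RHS]mxE !rowK.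
case: i => -[|[|[|//]]] i; case: j => -[|[|[|//]]] j /=;
  rewrite ?(dotDl, dotDr, dotZl, dotZr, dotNl, dotNr) ?xx ?xy ?yx ?yy ?xn ?yn ?nx ?ny ?nn.
all: rewrite ?(mulr0, addr0, subr0, oppr0, add0r) //.
- by rewrite mulVf.
- by field.
- by field; rewrite k0 m0.
Qed.

(** * First fundamental form and singularity of the ruled surface *)

Section Surface.
Context {R : realType} (a02 a11 : R).
Let m : R := 1 + a11 ^+ 2.
Let w : R := Num.sqrt m.

Let scale_coord (a : R) (x : 'rV[R]_3) j : (a *: x) 0 j = a * x 0 j.
Proof. by rewrite mxE. Qed.

Lemma m_gt0 : 0 < m. Proof. by rewrite /m ltr_wpDr// sqr_ge0. Qed.
Lemma w_gt0 : 0 < w. Proof. by rewrite sqrtr_gt0 m_gt0. Qed.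
Lemma w_sqr : w ^+ 2 = m. Proof. by rewrite sqr_sqrtr// ltW// m_gt0. Qed.

Section Curve.
Context (c : R -> 'rV[R]_3) (hc : arclength_sphere_curve c).

Let theta (v : R) : R := atan (v * w).
Let rho (v : R) : R := Num.sqrt (1 + (v * w) ^+ 2).
Local Notation xi := (xi a11 c).
Local Notation B := (B a11 c).
Local Notation gamma := (gamma a02 a11 c).

Let rho_gt0 v : 0 < rho v. Proof. exact: sqrt1_gt0. Qed.
Let rho_sqr v : rho v ^+ 2 = 1 + m * v ^+ 2.
Proof. by rewrite /rho sqr_sqrt1 exprMn w_sqr mulrC. Qed.

Lemma xiE v : xi v = rho v *: c (theta v).
Proof. by rewrite /Defs.xi /rho exprMn w_sqr [_ * m]mulrC. Qed.

Let is_derive_mulw (v : R) : is_derive v 1 (fun v => v * w) w.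
Proof.
have := is_derive_mul (is_derive_id v (1 : R)) (is_derive_cst w v (1 : R)).
by rewrite mul1r mulr0 addr0.
Qed.

Let is_derive_rho (v : R) : is_derive v 1 rho (m * v / rho v).
Proof.
have := is_derive_comp (f := fun x : R => Num.sqrt (1 + x ^+ 2)) (u := fun v => v * w) (is_derive_sqrt1 (v * w)) (is_derive_mulw v).
have -> : squash (v * w) * w = m * v / rho v by rewrite -w_sqr /squash -/(rho v); ring.
by [].
Qed.

Let is_derive_theta (v : R) : is_derive v 1 theta (w / rho v ^+ 2).
Proof.
have := is_derive_comp (f := @atan R) (u := fun v => v * w) (is_derive1_atan (v * w)) (is_derive_mulw v).
have -> : (1 + (v * w) ^+ 2)^-1 * w = w / rho v ^+ 2 by rewrite rho_sqr exprMn w_sqr mulrC [v ^+ 2 * m]mulrC.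
by [].
Qed.

Definition dxi v : 'rV[R]_3 := (m * v / rho v) *: c (theta v) + (w / rho v) *: derive1 c (theta v).

Lemma is_derivev_xi v : is_derivev v xi (dxi v).
Proof.
move=> j; have r0 := lt0r_neq0 (rho_gt0 v).
have -> : (fun t => xi t 0 j) = (fun t => rho t * c (theta t) 0 j).
  by apply/funext => t; rewrite xiE scale_coord.
have dc := is_derive_comp (u := theta) (curve_chain hc 0 (atan_curve_dom (v * w)) j) (is_derive_theta v).
have := is_derive_mul (is_derive_rho v) dc.
rewrite !mxE derive1n0 derive1n1 /theta.
move: (c _ 0 j) (derive1 c _ 0 j) => x y.
by have -> : m * v / rho v * x + rho v * (y * (w / rho v ^+ 2)) = m * v / rho v * x + w / rho v * y by field.
Qed.

Lemma derive1_xi v : derive1 xi v = dxi v.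
Proof. by rewrite derive1E; have [_ ->] := is_derivev_is (is_derivev_xi v). Qed.

Let cc v := dot_curve hc (atan_curve_dom (v * w)).
Let dd v := dot_curve' hc (atan_curve_dom (v * w)).
Let cd v := dot_curve_curve' hc (atan_curve_dom (v * w)).

Lemma dot_xi v : dot (xi v) (xi v) = 1 + m * v ^+ 2.
Proof. by rewrite xiE dotZl dotZr cc mulr1 -expr2 rho_sqr. Qed.

Lemma dot_xi_dxi v : dot (xi v) (dxi v) = m * v.
Proof.
have r0 := lt0r_neq0 (rho_gt0 v).
rewrite xiE dotZl dotDr !dotZr cc cd; by field.
Qed.

(** The components of xi' along c and c' are m v / rho and w / rho, and m^2 v^2 + w^2 = m rho^2. The
    arctangent in the parameter of [c] is matched to the square root so that this length is
    constant. *)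
Lemma dot_dxi v : dot (dxi v) (dxi v) = m.
Proof.
have r0 := lt0r_neq0 (rho_gt0 v).
rewrite dotDl !dotDr !dotZl !dotZr cc dd cd (dotC _ (c _)) cd.
transitivity ((m ^+ 2 * v ^+ 2 + w ^+ 2) / rho v ^+ 2); first by field.
rewrite w_sqr; have -> : m ^+ 2 * v ^+ 2 + m = m * rho v ^+ 2 by rewrite rho_sqr; ring.
by field.
Qed.

Let sT : open [set: R] := openT.

Lemma smooth_xi : smoothv setT xi.
Proof.
move=> j; have sid := smooth_id sT.
have sw : smooth setT (fun v : R => v * w) by exact: (smoothM sT sid (smooth_cst sT w)).
have sth : smooth setT theta.
  exact: (@smooth_comp1 _ _ _ sT setT (@atan R) (fun v => v * w) _ (smooth_atan (R := R)) sw).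
apply: (smooth_ext sT (f := fun v => rho v * c (theta v) 0 j)) => [v _|].
  by rewrite xiE mxE.
apply: (smoothM sT).
  exact: (@smooth_comp1 _ _ _ sT setT (fun v => Num.sqrt (1 + v ^+ 2)) (fun v => v * w) _ (smooth_sqrt1 (R := R)) sw).
apply: (@smooth_comp1 _ _ _ sT curve_dom (fun s => c s 0 j) theta) => //.
  by move=> v _; exact: atan_curve_dom.
exact: (smooth_curve hc 0 j).
Qed.

Lemma derive1_xiE : derive1 xi = 'D_1 xi.
Proof. by apply/funext => v; rewrite derive1E. Qed.

Lemma smooth_dxi : smoothv setT (derive1 xi).
Proof. by rewrite derive1_xiE; exact: (smoothv_derive (1 : R) sT smooth_xi). Qed.

Lemma smooth_B : smoothv setT B.
Proof.
have sx := smooth_xi; have sd := smooth_dxi.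
have sc : smoothv setT (fun v => cross (xi v) (derive1 xi v)).
  have p i j : smooth setT (fun v => xi v 0 i * derive1 xi v 0 j).
    exact: (smoothM sT (sx i) (sd j)).
  move=> j; case: j => -[|[|[|//]]] i.
  - by apply: (smooth_ext sT _ (smoothB sT (p 1 2) (p 2 1))) => v _; rewrite [RHS]mxE.
  - by apply: (smooth_ext sT _ (smoothB sT (p 2 0) (p 0 2))) => v _; rewrite [RHS]mxE.
  - by apply: (smooth_ext sT _ (smoothB sT (p 0 1) (p 1 0))) => v _; rewrite [RHS]mxE.
move=> j; apply: (smooth_ext sT _ (smoothD sT (smoothM sT (smooth_cst sT a11) (sd j)) (sc j))).
by move=> v _; rewrite [in RHS]mxE [X in _ = X + _]mxE.
Qed.

Let kap : R := a02 / m.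

Lemma is_derivev_gamma v : is_derivev v gamma (kap * v *: B v).
Proof.
move=> j.
have -> : (fun t => gamma t 0 j) = (fun t => kap * int0 (fun t => (t *: B t) 0 j) t).
  by apply/funext => t; rewrite !mxE.
have ch : continuous (fun t : R => (t *: B t) 0 j).
  apply: continuous_smooth; apply: (smooth_ext sT _ (smoothM sT (smooth_id sT) (smooth_B j))).
  by move=> t _; rewrite scale_coord.
have H := is_derive_mul (is_derive_cst kap v (1 : R)) (int0_derive v ch).
have E x (y : 'rV[R]_3) : 0 * x + kap * ((v *: y) 0 j) = (kap * v *: y) 0 j.
  by rewrite !scale_coord; ring.
by rewrite E in H.
Qed.

Lemma gamma0 : gamma 0 = 0.
Proof. by apply/rowP => j; rewrite !mxE int0_0 mulr0. Qed.

Lemma D_gammaE v : 'D_1 gamma v = kap * v *: B v.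
Proof. by have [_ ->] := is_derivev_is (is_derivev_gamma v). Qed.

Lemma D_gamma : 'D_1 gamma = (fun v => kap * v *: B v).
Proof. by apply/funext => v; exact: D_gammaE. Qed.

Let smooth_kvB j : smooth setT (fun v => (kap * v *: B v) 0 j).
Proof.
apply: (smooth_ext sT _ (smoothM sT (smoothM sT (smooth_cst sT kap) (smooth_id sT)) (smooth_B j))).
by move=> v _; rewrite scale_coord.
Qed.

Lemma smooth_gamma : smoothv setT gamma.
Proof.
move=> j; exact: (smooth_of_derive sT (fun v _ => is_derivev_gamma v j) (smooth_kvB j)).
Qed.

Lemma DD_gamma : 'D_1 ('D_1 gamma) 0 = kap *: B 0.
Proof.
rewrite D_gamma; suff H : is_derivev 0 (fun v => kap * v *: B v) (kap *: B 0).
  by have [_ ->] := is_derivev_is H.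
move=> j.
have -> : (fun t => (kap * t *: B t) 0 j) = (fun t => kap * t * B t 0 j).
  by apply/funext => t; rewrite scale_coord.
have d1 := is_derive_mul (is_derive_cst kap (0 : R) (1 : R)) (is_derive_id (0 : R) (1 : R)).
have d2 : is_derive (0 : R) 1 (fun t => B t 0 j) ('D_1 (fun t => B t 0 j) 0).
  exact: (smooth_derive_is (1 : R) (smooth_B j) (I : setT (0 : R))).
have H := is_derive_mul d1 d2.
have E x (y : 'rV[R]_3) : (0 * 0 + kap * 1) * y 0 j + kap * 0 * x = (kap *: y) 0 j.
  by rewrite scale_coord; ring.
by rewrite E in H.
Qed.

Lemma f_E : f_ a02 a11 c = ruled gamma xi.
Proof. by []. Qed.

Lemma BE v : B v = a11 *: dxi v + cross (xi v) (dxi v).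
Proof. by rewrite /Defs.B !derive1_xi. Qed.

Lemma dot_xi_B v : dot (xi v) (B v) = a11 * (m * v).
Proof. by rewrite BE dotDr dotZr dot_xi_dxi dot_cross_l addr0. Qed.

Lemma dot_dxi_B v : dot (dxi v) (B v) = a11 * m.
Proof. by rewrite BE dotDr dotZr dot_dxi dot_cross_r addr0. Qed.

(** By Lagrange's identity the vector product contributes (1 + m v^2) m - m^2 v^2 = m, orthogonally
    to the a11^2 m of the first term; together they give m^2. *)
Lemma dot_B v : dot (B v) (B v) = m ^+ 2.
Proof.
rewrite BE dotDl !dotDr !dotZl !dotZr dot_dxi dot_cross_cross dot_xi dot_dxi dot_xi_dxi.
by rewrite (dotC _ (dxi v)) dot_cross_r /m; ring.
Qed.

(** Positivity of [a02] makes [kap] nonzero, so gamma''(0) has a component along xi(0) x xi'(0) and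
    completes the frame. *)
Lemma f_cross_cap : 0 < a02 -> cross_cap setT (f_ a02 a11 c) 0.
Proof.
move=> a020; have m0 := lt0r_neq0 m_gt0.
have k0 : kap != 0 by rewrite lt0r_neq0// divr_gt0// m_gt0.
pose M := rows3 (xi 0) (dxi 0) (kap *: B 0).
have uM : M \in unitmx.
  rewrite /M BE; apply: (@frame_unitmx _ _ _ a11 kap m) => //.
  - by rewrite dot_xi expr0n mulr0 addr0.
  - by rewrite dot_xi_dxi mulr0.
  - exact: dot_dxi.
rewrite f_E; apply: (ruled_cross_cap smooth_gamma smooth_xi gamma0 _ uM).
- by rewrite D_gammaE mulr0 scale0r.
- exact: rows3_0.
- by rewrite rows3_1 -derive1_xi derive1E.
- by rewrite rows3_2 DD_gamma.
Qed.

Lemma first_fundamental_form (x : 'rV[R]_2) : let u := x 0 0 in let v := x 0 1 in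
  let f := f_ a02 a11 c in
  [/\ dot (partial 0 f x) (partial 0 f x) = 1 + m * v ^+ 2,
      dot (partial 0 f x) (partial 1 f x) = kap * v * (a11 * (m * v)) + u * (m * v) &
      dot (partial 1 f x) (partial 1 f x) =
        (kap * v) ^+ 2 * m ^+ 2 + 2 * (kap * v) * u * (a11 * m) + u ^+ 2 * m].
Proof.
move=> u v f.
have p0 : partial 0 f x = xi v by exact: (partial_ruled0 smooth_gamma smooth_xi).
have p1 : partial 1 f x = kap * v *: B v + u *: dxi v.
  rewrite -D_gammaE -derive1_xi derive1E.
  exact: (partial_ruled1 smooth_gamma smooth_xi).
rewrite p0 p1; split; first exact: dot_xi.
  rewrite dotDr (dotZr (kap * v)) (dotZr u) dot_xi_B dot_xi_dxi//.
rewrite dotDl !dotDr !(dotZl (kap * v)) !(dotZl u) !(dotZr (kap * v)) !(dotZr u).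
by rewrite dot_B dot_dxi (dotC (B v)) dot_dxi_B; ring.
Qed.

End Curve.
End Surface.

(** * Great circles and geodesics *)

Section GreatCircles.
Context {R : realType}.
Implicit Types (p q : 'rV[R]_3).

Definition circle p q (s : R) : 'rV[R]_3 := cos s *: p + sin s *: q.

Lemma derive1_circle p q : derive1 (circle p q) = circle q (- p).
Proof.
apply/funext => s; rewrite derive1E.
suff H : is_derivev s (circle p q) (circle q (- p) s) by have [_ ->] := is_derivev_is H.
move=> j.
have -> : (fun t => circle p q t 0 j) = (fun t => cos t * p 0 j + sin t * q 0 j).
  by apply/funext => t; rewrite !mxE.
have dc (c : R) := is_derive_cst c s (1 : R).
have := is_deriveD (is_derive_mul (is_derive_cos s) (dc (p 0 j))) (is_derive_mul (is_derive_sin s) (dc (q 0 j))).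
have -> : circle q (- p) s 0 j = - sin s * p 0 j + cos s * 0 + (cos s * q 0 j + sin s * 0).
  by rewrite !mxE; ring.
by [].
Qed.

Lemma derivable_circle p q s : derivable (circle p q) s 1.
Proof.
apply: derivable_row => j.
have -> : (fun t => circle p q t 0 j) = (fun t => cos t * p 0 j + sin t * q 0 j).
  by apply/funext => t; rewrite !mxE.
have dc (c : R) := is_derive_cst c s (1 : R).
by case: (is_deriveD (is_derive_mul (is_derive_cos s) (dc (p 0 j))) (is_derive_mul (is_derive_sin s) (dc (q 0 j)))).
Qed.

Lemma dot_circle p q s : dot p p = 1 -> dot q q = 1 -> dot p q = 0 -> dot (circle p q s) (circle p q s) = 1.
Proof.
move=> pp qq pq; rewrite /circle dotDl !dotDr !dotZl !dotZr (dotC q) pp qq pq.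
by rewrite -[RHS](cos2Dsin2 s); ring.
Qed.

Lemma circle_arclength p q : dot p p = 1 -> dot q q = 1 -> dot p q = 0 ->
  arclength_sphere_curve (circle p q).
Proof.
move=> pp qq pq s _; split.
- move=> k; have [p' [q' ->]] : exists p' q', derive1n k (circle p q) = circle p' q'.
    elim: k => [|k [p' [q' IH]]]; first by exists p, q.
    by exists q', (- p'); rewrite derive1nS IH derive1_circle.
  exact: derivable_circle.
- by rewrite /enorm dot_circle// sqrtr1.
- rewrite derive1_circle /enorm dot_circle ?sqrtr1//.
    by rewrite dotNl dotNr opprK.
  by rewrite dotNr dotC pq oppr0.
Qed.

Lemma circle_mulmx p q (A : 'M[R]_3) s : circle p q s *m A = circle (p *m A) (q *m A) s.
Proof. by rewrite mulmxDl -!scalemxAl. Qed.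

Lemma circle_geodesic (c : R -> 'rV[R]_3) p q : dot p p = 1 -> dot q q = 1 -> dot p q = 0 ->
  (forall s, curve_dom s -> c s = circle p q s) -> geodesic_S2 c.
Proof.
move=> pp qq pq H s Is.
have E1 t : curve_dom t -> derive1 c t = circle q (- p) t.
  move=> It; rewrite -derive1_circle !derive1E; apply: near_eq_derive.
  exact: near_curve_dom It H.
have E2 : derive1n 2 c s = - circle p q s.
  rewrite derive1nS derive1n1 derive1E.
  have -> : 'D_1 (derive1 c) s = 'D_1 (circle q (- p)) s.
    by apply: near_eq_derive; exact: near_curve_dom Is E1.
  by rewrite -derive1E derive1_circle /circle !scalerN -opprD.
rewrite E2 H// dotNl dot_circle// scaleN1r opprK addNr//.
Qed.

Lemma geodesic_circle (c : R -> 'rV[R]_3) : arclength_sphere_curve c -> geodesic_S2 c ->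
  forall s, curve_dom s -> c s = circle (c 0) (derive1 c 0) s.
Proof.
move=> hc gc.
(* Differentiating c . c' = 0 gives c'' . c = -1, which turns the geodesic equation into c'' = -
   c. *)
have cc0 s : curve_dom s -> derive1n 2 c s = - c s.
  move=> Is; have := gc s Is.
  have d0 : dot (derive1n 2 c s) (c s) = -1.
    have H := is_derivev_dot (curve_chain hc 0 Is) (curve_chain hc 1 Is).
    have H0 : is_derive s 1 (fun t => dot (derive1n 0 c t) (derive1n 1 c t)) 0.
      have E : \forall t \near s, cst (0 : R) t = dot (derive1n 0 c t) (derive1n 1 c t).
        by apply: near_curve_dom Is _ => t /(dot_curve_curve' hc) <-.
      exact: (near_eq_is_derive E (is_derive_cst (0 : R) s (1 : R))).
    have [_ E1] := H; have [_ E2] := H0; rewrite E2 in E1.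
    have c1 := dot_curve' hc Is.
    rewrite dotC; move: E1; rewrite derive1n0 derive1n1 c1.
    by move: (dot _ _) => x; lra.
  by rewrite d0 scaleN1r opprK => /eqP; rewrite addr_eq0 => /eqP.
have d0 := @curve_dom0 R.
(* Both [cos s c - sin s c'] and [sin s c + cos s c'] have zero derivative. *)
pose P j (s : R) := cos s * c s 0 j - sin s * derive1 c s 0 j.
pose Q j (s : R) := sin s * c s 0 j + cos s * derive1 c s 0 j.
have dc j s : curve_dom s -> is_derive s 1 (fun t => c t 0 j) (derive1 c s 0 j).
  by move=> Is; exact: (curve_chain hc 0 Is j).
have dd j s : curve_dom s -> is_derive s 1 (fun t => derive1 c t 0 j) (- c s 0 j).
  move=> Is; have := curve_chain hc 1 Is j; rewrite derive1n1 cc0//.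
  by have -> : (- c s) 0 j = - c s 0 j by rewrite mxE.
have dP j s : curve_dom s -> is_derive s 1 (P j) 0.
  move=> Is; have := is_deriveB (is_derive_mul (is_derive_cos s) (dc j s Is)) (is_derive_mul (is_derive_sin s) (dd j s Is)).
  have -> : - sin s * c s 0 j + cos s * derive1 c s 0 j - (cos s * derive1 c s 0 j + sin s * - c s 0 j) = 0 by ring.
  by [].
have dQ j s : curve_dom s -> is_derive s 1 (Q j) 0.
  move=> Is; have := is_deriveD (is_derive_mul (is_derive_sin s) (dc j s Is)) (is_derive_mul (is_derive_cos s) (dd j s Is)).
  have -> : cos s * c s 0 j + sin s * derive1 c s 0 j + (- sin s * derive1 c s 0 j + cos s * - c s 0 j) = 0 by ring.
  by [].
have cst0 (f : R -> R) : (forall s, curve_dom s -> is_derive s 1 f 0) -> forall s, curve_dom s -> f s = f 0.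
  move=> df s Is.
  have mid t : Num.min 0 s <= t <= Num.max 0 s -> curve_dom t.
    move=> /andP[t1 t2]; move: Is d0; rewrite /curve_dom /= !in_itv /= => /andP[s1 s2] /andP[z1 z2].
    by apply/andP; split; [apply: lt_le_trans t1; rewrite lt_min z1 s1|apply: le_lt_trans t2 _; rewrite gt_max z2 s2].
  have cf : {within `[Num.min 0 s, Num.max 0 s], continuous f}.
    apply: continuous_in_subspaceT => t; rewrite inE /= in_itv /= => /mid It.
    by apply/differentiable_continuous/derivable1_diffP; case: (df t It).
  have := @mvt_lipschitz R f (fun=> 0) _ _ 0 cf.
  move=> /(_ _ _ 0 s); rewrite mul0r => H; apply/eqP; rewrite -subr_eq0 -normr_le0; apply: H.
  - by move=> t /andP[t1 t2]; apply/df/mid; rewrite !ltW.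
  - by move=> t _; rewrite normr0.
  - by rewrite ge_min le_max lexx.
  - by rewrite ge_min le_max lexx !orbT.
move=> s Is; apply/rowP => j.
have EP := cst0 _ (dP j) s Is; have EQ := cst0 _ (dQ j) s Is.
rewrite /P /Q cos0 sin0 !mul1r !mul0r subr0 add0r in EP EQ.
rewrite [RHS]mxE [X in _ = X + _]mxE [X in _ = _ + X]mxE -EP -EQ; transitivity ((cos s ^+ 2 + sin s ^+ 2) * c s 0 j); last by ring.
by rewrite cos2Dsin2 mul1r.
Qed.

End GreatCircles.

(** * Congruence of the surfaces and the model great circle *)

Section Congruence.
Context {R : realType} (a02 a11 : R).

Let w : R := Num.sqrt (1 + a11 ^+ 2).
Let w0 : 0 < w. Proof. exact: w_gt0. Qed.
Let w2 : w ^+ 2 = 1 + a11 ^+ 2. Proof. exact: w_sqr. Qed.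

Lemma f_origin (c : R -> 'rV[R]_3) : f_ a02 a11 c 0 = 0.
Proof. by rewrite /f_ !mxE gamma0 scale0r addr0. Qed.

Lemma f_ruling (c : R -> 'rV[R]_3) v : f_ a02 a11 c (row2 1 v) - f_ a02 a11 c (row2 0 v) = xi a11 c v.
Proof. by rewrite /f_ !row2_0 !row2_1 scale0r addr0 scale1r addrAC subrr add0r. Qed.

(** [congruent] compares the two maps at equal parameters, so a rotation relating the surfaces
    relates the differences between u = 1 and u = 0 on each ruling, that is, the vectors xi(v). *)
Lemma congruent_curve (c1 c2 : R -> 'rV[R]_3) :
  congruent (f_ a02 a11 c1) (f_ a02 a11 c2) -> congruent_S2 c1 c2.
Proof.
move=> /(congruence_SO3 (f_origin c1) (f_origin c2)) [A SA H].
exists A; split=> // s Is.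
(* The parameter at which [chat] takes the value of the curve at [s]; every point of the open
   interval is reached in this way. *)
pose v := tan s / w.
have vw : v * w = tan s by rewrite /v mulfVK// lt0r_neq0.
have E : xi a11 c2 v = xi a11 c1 v *m A.
  by rewrite -!f_ruling !H mulmxBl.
move: E; rewrite !xiE -/w vw tanK; last by [].
rewrite -scalemxAl => /(scalerI _); apply.
by rewrite lt0r_neq0// sqrt1_gt0.
Qed.

Lemma curve_congruent (c1 c2 : R -> 'rV[R]_3) : arclength_sphere_curve c1 -> arclength_sphere_curve c2 ->
  congruent_S2 c1 c2 -> congruent (f_ a02 a11 c1) (f_ a02 a11 c2).
Proof.
move=> h1 h2 [A [SA H]]; apply: (SO3_congruence SA).
have xiA v : xi a11 c2 v = xi a11 c1 v *m A.
  by rewrite !xiE -scalemxAl H//; exact: atan_curve_dom.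
have dxiA v : derive1 (xi a11 c2) v = derive1 (xi a11 c1) v *m A.
  have -> : xi a11 c2 = (fun v => xi a11 c1 v *m A) by apply/funext.
  rewrite (derive1_xi a11 h1) derive1E.
  by have [_ ->] := is_derivev_is (is_derivev_mulmx A (is_derivev_xi a11 h1 v)).
have BA v : B a11 c2 v = B a11 c1 v *m A.
  by rewrite /B xiA dxiA (cross_SO3 SA) mulmxDl -scalemxAl.
(* Instead of moving the rotation through the integral, both sides are compared as primitives: they
   vanish at 0 and have the same derivative. *)
have gA v : gamma a02 a11 c2 v = gamma a02 a11 c1 v *m A.
  apply/rowP => j.
  have g0 : gamma a02 a11 c2 0 0 j = (gamma a02 a11 c1 0 *m A) 0 j by rewrite !gamma0 mul0mx.
  have D (u : R) : is_derive u 1 (fun v => (gamma a02 a11 c1 v *m A) 0 j)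
      ((a02 / (1 + a11 ^+ 2) * u *: B a11 c2 u) 0 j).
    have := is_derivev_mulmx A (is_derivev_gamma a02 a11 h1 u) j.
    by rewrite BA scalemxAl.
  exact: (is_derive_unique g0 (fun u => is_derivev_gamma a02 a11 h2 u j) D v).
by move=> x; rewrite /f_ gA xiA mulmxDl scalemxAl.
Qed.

(** The great circle traced by the normalised ruling direction (1, v, a11 v) of [f_0], parametrized
    by arc length. *)
Definition model_curve : R -> 'rV[R]_3 := circle (vec3 1 0 0) (w^-1 *: vec3 0 1 a11).

Let pp : dot (vec3 1 0 0 : 'rV[R]_3) (vec3 1 0 0) = 1.
Proof. by rewrite dot3E !vec3_0 !vec3_1 !vec3_2; ring. Qed.
Let qq : dot (w^-1 *: vec3 0 1 a11) (w^-1 *: vec3 0 1 a11) = 1.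
Proof.
rewrite dotZl dotZr dot3E !vec3_0 !vec3_1 !vec3_2 mulr0 add0r mulr1 -expr2 -w2.
by have := lt0r_neq0 w0 => ?; field.
Qed.
Let pq : dot (vec3 1 0 0) (w^-1 *: vec3 0 1 a11) = 0.
Proof. by rewrite dotZr dot3E !vec3_0 !vec3_1 !vec3_2; ring. Qed.

Lemma model_curve_arclength : arclength_sphere_curve model_curve.
Proof. exact: circle_arclength. Qed.

Lemma model_curve0 : model_curve 0 = vec3 1 0 0.
Proof. by rewrite /model_curve /circle cos0 sin0 scale1r scale0r addr0. Qed.

Lemma derive1_model_curve0 : derive1 model_curve 0 = w^-1 *: vec3 0 1 a11.
Proof. by rewrite /model_curve derive1_circle /circle cos0 sin0 scale1r scale0r addr0. Qed.

Lemma model_surface : f_ a02 a11 model_curve = f_0 a02 a11.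
Proof.
have hm := model_curve_arclength.
have xiE0 v : xi a11 model_curve v = vec3 1 v (a11 * v).
  rewrite xiE -/w /model_curve /circle.
  have s0 := sqrt1_gt0 (v * w).
  have ct := cos_atan (v * w).
  have st : sin (atan (v * w)) = v * w * cos (atan (v * w)).
    by rewrite -[X in _ = X * _](atanK (v * w)) /tan mulfVK// ct invr_neq0// lt0r_neq0.
  rewrite st ct; move: (lt0r_neq0 s0) (lt0r_neq0 w0) {ct st}.
  move: (Num.sqrt (1 + (v * w) ^+ 2)) => s h1 h2.
  by apply: vec3P; rewrite !mxE /=; field; rewrite ?h1 ?h2.
have dxiE v : derive1 (xi a11 model_curve) v = vec3 0 1 a11.
  rewrite derive1E; suff H : is_derivev v (xi a11 model_curve) (vec3 0 1 a11).
    by have [_ ->] := is_derivev_is H.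
  have -> : xi a11 model_curve = (fun v => vec3 1 v (a11 * v)) by apply/funext.
  move=> j; case: j => -[|[|[|//]]] i.
  - have -> : (fun t : R => vec3 1 t (a11 * t) 0 (Ordinal i)) = cst 1 by apply/funext => t; rewrite mxE.
    by rewrite mxE /=; exact: is_derive_cst.
  - have -> : (fun t : R => vec3 1 t (a11 * t) 0 (Ordinal i)) = id by apply/funext => t; rewrite mxE.
    by rewrite mxE /=; exact: is_derive_id.
  - have -> : (fun t : R => vec3 1 t (a11 * t) 0 (Ordinal i)) = (fun t => a11 * t) by apply/funext => t; rewrite mxE.
    rewrite mxE /=; have := is_derive_mul (is_derive_cst a11 v (1 : R)) (is_derive_id v (1 : R)).
    by rewrite mul0r add0r mulr1.
(* The vector product is (0, - a11, 1) for every v; adding a11 (0, 1, a11) cancels the middle entry.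
   The integral of t B(t) is then vertical, as in [f_0]. *)
have BE0 v : B a11 model_curve v = vec3 0 0 (1 + a11 ^+ 2).
  rewrite /B xiE0 dxiE; have [c0 c1 c2] := crossE (vec3 1 v (a11 * v)) (vec3 0 1 a11).
  apply: vec3P; rewrite [LHS]mxE ?c0 ?c1 ?c2 ?[X in X + _]mxE !vec3_0 !vec3_1 !vec3_2; ring.
have m0 := lt0r_neq0 (m_gt0 a11).
have gE v : gamma a02 a11 model_curve v = 2^-1 *: vec3 0 0 (a02 * v ^+ 2).
  apply/rowP => j.
  have g0 : gamma a02 a11 model_curve 0 0 j = (2^-1 *: vec3 0 0 (a02 * (0 : R) ^+ 2)) 0 j.
    by rewrite gamma0 !mxE expr0n mulr0; case: j => -[|[|[|//]]] i /=; rewrite mulr0.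
  suff D (u : R) : is_derive u 1 (fun v : R => (2^-1 *: vec3 0 0 (a02 * v ^+ 2)) 0 j)
      ((a02 / (1 + a11 ^+ 2) * u *: B a11 model_curve u) 0 j).
    exact: (is_derive_unique g0 (fun u => is_derivev_gamma a02 a11 hm u j) D v).
  rewrite BE0; case: j {g0} => -[|[|[|//]]] i.
  - have -> : (fun t : R => (2^-1 *: vec3 0 0 (a02 * t ^+ 2)) 0 (Ordinal i)) = cst 0.
      by apply/funext => t; rewrite !mxE /= mulr0.
    by rewrite !mxE /= mulr0; exact: is_derive_cst.
  - have -> : (fun t : R => (2^-1 *: vec3 0 0 (a02 * t ^+ 2)) 0 (Ordinal i)) = cst 0.
      by apply/funext => t; rewrite !mxE /= mulr0.
    by rewrite !mxE /= mulr0; exact: is_derive_cst.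
  - have -> : (fun t : R => (2^-1 *: vec3 0 0 (a02 * t ^+ 2)) 0 (Ordinal i)) = (fun t => (2^-1 * a02) * (t * t)).
      by apply/funext => t; rewrite !mxE /=; ring.
    have := is_derive_mul (is_derive_cst (2^-1 * a02) u (1 : R)) (is_derive_mul (is_derive_id u (1 : R)) (is_derive_id u (1 : R))).
    have -> : (a02 / (1 + a11 ^+ 2) * u *: vec3 0 0 (1 + a11 ^+ 2)) 0 (Ordinal i) =
       0 * (u * u) + 2^-1 * a02 * (1 * u + u * 1) by rewrite !mxE /=; field.
    by [].
by apply/funext => x; rewrite /f_ /f_0 gE xiE0.
Qed.

End Congruence.

Theorem theorem2 (R : realType) (a02 a11 : R) (ha02 : 0 < a02) :
  (forall c : R -> 'rV[R]_3, arclength_sphere_curve c ->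
     cross_cap setT (f_ a02 a11 c) 0 /\
     isometric setT (f_ a02 a11 c) (f_0 a02 a11)) /\
  (forall c1 c2 : R -> 'rV[R]_3,
     arclength_sphere_curve c1 -> arclength_sphere_curve c2 ->
     (congruent (f_ a02 a11 c1) (f_ a02 a11 c2) <-> congruent_S2 c1 c2)) /\
  (forall c : R -> 'rV[R]_3, arclength_sphere_curve c ->
     (congruent (f_ a02 a11 c) (f_0 a02 a11) <-> geodesic_S2 c)).
Proof.
have hm := model_curve_arclength a11.
split; last split.
- move=> c hc; have C := f_cross_cap a11 hc ha02; split; first exact: C.
  rewrite -(model_surface a02 a11); split; [exact: C|exact: f_cross_cap|move=> x _].
  have [e1 e2 e3] := first_fundamental_form a02 a11 hc x.
  have [e1' e2' e3'] := first_fundamental_form a02 a11 hm x.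
  split; [exact: etrans e1 (esym e1')|exact: etrans e2 (esym e2')|exact: etrans e3 (esym e3')].
- move=> c1 c2 h1 h2; split; first exact: congruent_curve.
  exact: curve_congruent.
move=> c hc; rewrite -(model_surface a02 a11); split.
  move=> /congruent_curve [A [SA H]].
  have SA' := SO3_tr SA; have AAT : A *m A^T = 1%:M by case: SA.
  (* Pulled back by the inverse rotation, the model circle becomes the great circle through the
     rotated point and tangent vector. *)
  have cE s : curve_dom s -> c s = circle (vec3 1 0 0 *m A^T) ((Num.sqrt (1 + a11 ^+ 2))^-1 *: vec3 0 1 a11 *m A^T) s.
    by move=> Is; rewrite -circle_mulmx -/(model_curve a11 s) H// -mulmxA AAT mulmx1.
  have h0 := @curve_dom0 R.
  apply: circle_geodesic cE; rewrite (dot_SO3 SA') -?(derive1_model_curve0 a11) -?(model_curve0 a11).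
  - exact: (dot_curve hm h0).
  - exact: (dot_curve' hm h0).
  - exact: (dot_curve_curve' hm h0).
move=> gc; apply: curve_congruent => //.
have h0 := @curve_dom0 R.
(* A great circle is determined by its position and velocity at 0, so the rotation matching the
   orthonormal frames there carries [c] to the model circle. *)
pose F1 := rows3 (c 0) (derive1 c 0) (cross (c 0) (derive1 c 0)).
pose F2 := rows3 (model_curve a11 0) (derive1 (model_curve a11) 0) (cross (model_curve a11 0) (derive1 (model_curve a11) 0)).
have S1 : SO3 F1 by apply: frame_SO3; [exact: (dot_curve hc h0)|exact: (dot_curve' hc h0)|exact: (dot_curve_curve' hc h0)].
have S2 : SO3 F2 by apply: frame_SO3; [exact: (dot_curve hm h0)|exact: (dot_curve' hm h0)|exact: (dot_curve_curve' hm h0)].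
have [A SA FA] : exists2 A, SO3 A & F1 *m A = F2.
  exists (F1^T *m F2); first exact: SO3_mul (SO3_tr S1) S2.
  by rewrite mulmxA; case: S1 => -> _; rewrite mul1mx.
exists A; split=> // s Is.
rewrite /F1 /F2 rows3_mulmx in FA.
have r0 : c 0 *m A = model_curve a11 0 by have := congr1 (row 0) FA; rewrite 2!rows3_0.
have r1 : derive1 c 0 *m A = derive1 (model_curve a11) 0 by have := congr1 (row 1) FA; rewrite 2!rows3_1.
rewrite (geodesic_circle hc gc Is) circle_mulmx r0 r1.
by rewrite model_curve0 derive1_model_curve0.
Qed.
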